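(* (E. Noether.) Let $a,b\in\widetilde{\mathbb R}$, with $a<b$, and $F\in\mathcal{GC}^\infty([a,b]\times\widetilde{\mathbb R}^d\times\widetilde{\mathbb R}^d,\widetilde{\mathbb R})$. Let $u\in\mathcal{GC}^\infty([a,b],\widetilde{\mathbb R}^d)$ be a solution of the Euler-Lagrange equation $F_u(t,u,\dot u)-\frac{d}{dt}F_{\dot u}(t,u,\dot u)=0$ corresponding to $F$. Suppose that $0$ is a sharply interior point of $J\subseteq\widetilde{\mathbb R}$ and $(X_s)_{s\in J}$ is a generalized smooth family in $\mathcal{GC}^\infty((a,b)\times\widetilde{\mathbb R}^d,(a,b)\times\widetilde{\mathbb R}^d)$. Denote by $T_s(t,l)\in(a,b)$ and $L_s(t,l)\in\widetilde{\mathbb R}^d$, for all $(t,l)\in(a,b)\times\widetilde{\mathbb R}^d$, the two projections of $X_s(t,l)=(T_s(t,l),L_s(t,l))$ on $(a,b)$ and $\widetilde{\mathbb R}^d$ respectively. Assume that for all $t\in(a,b)$: (i) $\frac{\partial}{\partial t}T_s(t,u(t))\in\widetilde{\mathbb R}$ is invertible for all $s\in J$; (ii) $T_0(t,u(t))=t$ and $L_0(t,u(t))=u(t)$; (iii) for all $s\in J$, $$F(t,u(t),\dot u(t))=F\left[T_s(t,u(t)),L_s(t,u(t)),\frac{\frac{\partial}{\partial t}L_s(t,u(t))}{\frac{\partial}{\partial t}T_s(t,u(t))}\right]\cdot\frac{\partial}{\partial t}T_s(t,u(t)).$$ Then the quantity (summation over repeated indices $j,k=1,\ldots,d$) $$F_{\dot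 u^j}(t,u(t),\dot u(t))\left.\frac{\partial}{\partial s}\right|_{s=0}L^j_s(t,u(t))+\left[F(t,u(t),\dot u(t))-F_{\dot u^k}(t,u(t),\dot u(t))\dot u^k(t)\right]\left.\frac{\partial}{\partial s}\right|_{s=0}T_s(t,u(t))$$ is constant in $t\in[a,b]$.
   Context: Generalized numbers. Let $I_0=(0,1]\subseteq\mathbb R$; ''for $\varepsilon$ small'' means for all $\varepsilon\in(0,\varepsilon_0]$ for some $\varepsilon_0\in I_0$. Fix a net $\rho=(\rho_\varepsilon)_{\varepsilon\in I_0}$ of reals with $\rho_\varepsilon\to0^+$ as $\varepsilon\to0^+$. A net $(x_\varepsilon)$ in $\mathbb R^n$ is moderate if $|x_\varepsilon|=O(\rho_\varepsilon^{-N})$ for some $N\in\mathbb R_{>0}$; $(x_\varepsilon)\sim(y_\varepsilon)$ if $|x_\varepsilon-y_\varepsilon|=O(\rho_\varepsilon^{N})$ for every $N\in\mathbb R_{>0}$. $\widetilde{\mathbb R}$ is the ring of moderate real nets modulo $\sim$, with classes $[x_\varepsilon]$; $\widetilde{\mathbb R}^n$ is defined analogously. $\mathbb R\subseteq\widetilde{\mathbb R}$ via constant nets. $x\le y$ iff there are representatives with $x_\varepsilon\le y_\varepsilon$ for all $\varepsilon$; $x<y$ iff $y-x\ge0$ and $y-x$ is invertible; $|[x_\varepsilon]|=[|x_\varepsilon|]$ (Euclidean norm). $[a,b]=\{x\in\widetilde{\mathbb R}:a\le x\le b\}$, $(a,b)=\{x\in\widetilde{\mathbb R}:a<x<b\}$.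 The sharp topology on $\widetilde{\mathbb R}^n$ has as base the balls $B_r(c)=\{x:|x-c|<r\}$, $r\in\widetilde{\mathbb R}$, $r>0$; ''sharply interior'' refers to it. Generalized smooth functions (GSF). For $\Omega_\varepsilon\subseteq\mathbb R^n$ open, $\langle\Omega_\varepsilon\rangle$ is the set of $[x_\varepsilon]\in\widetilde{\mathbb R}^n$ such that for every representative $x_\varepsilon\in\Omega_\varepsilon$ for $\varepsilon$ small. For $X\subseteq\widetilde{\mathbb R}^n$, $Y\subseteq\widetilde{\mathbb R}^k$, $\mathcal{GC}^\infty(X,Y)$ is the set of maps $f:X\to Y$ for which there are $f_\varepsilon\in C^\infty(\Omega_\varepsilon,\mathbb R^k)$ with $X\subseteq\langle\Omega_\varepsilon\rangle$, $f([x_\varepsilon])=[f_\varepsilon(x_\varepsilon)]$ and $(\partial^\alpha f_\varepsilon(x_\varepsilon))$ moderate for all $[x_\varepsilon]\in X$ and all multi-indices $\alpha$. Derivatives are $\partial^\alpha f([x_\varepsilon])=[\partial^\alpha f_\varepsilon(x_\varepsilon)]$ at sharply interior points and one-sided limits at endpoints of intervals. $(X_s)_{s\in J}$ is a generalized smooth family in $\mathcal{GC}^\infty(X,Y)$ if $(s,x)\mapsto X_s(x)$ belongs to $\mathcal{GC}^\infty(J\times X,Y)$. $F_u$ and $F_{\dot u}$ (with components $F_{u^j}$, $F_{\dot u^j}$) are the partial gradients of $F$ with respect to its second and third variables. $\frac{\partial}{\partial t}T_s(t,u(t))$ denotes the derivative of $t\mapsto T_s(t,u(t))$, and similarly for $L_s$.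 *)

(* Defs.v *)
From HB Require Import structures.
From mathcomp Require Import all_boot all_order all_algebra ring_quotient.
From mathcomp Require Import all_classical all_reals all_analysis.

Set Implicit Arguments.
Unset Strict Implicit.
Unset Printing Implicit Defensive.

Import Order.TTheory GRing.Theory Num.Theory.
Import numFieldNormedType.Exports.

Local Open Scope classical_set_scope.
Local Open Scope ring_scope.

(* Nets indexed by (0,1] are total functions of a real index e, of which only
   the values for e in (0,1] are ever used; "for e small" is the filter 0^'+.
   The convergence to the filter 0^'+ says that rho_e tends to 0 and is
   positive for e small. *)
Record gauge (R : realType) := Gauge {
  gauge_net :> R -> R;
  gauge_cvg : gauge_net e @[e --> 0^'+] --> 0^'+ }.

Section Nets.
Context {R : realType} (rho : gauge R).
Implicit Types (x y : R -> R) (p q N : R).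

Definition gauge_bigO x p :=
  exists C : R, \forall e \near 0^'+, `|x e| <= C * rho e `^ p.

Definition moderate x := exists2 N, 0 < N & gauge_bigO x (- N).

Definition negligible x := forall N, 0 < N -> gauge_bigO x N.

Lemma gauge_near_gt0 : \forall e \near 0^'+, 0 < rho e.
Proof. exact: (gauge_cvg rho (nbhs_right_gt 0)). Qed.

Lemma gauge_near_lt r : 0 < r -> \forall e \near 0^'+, rho e < r.
Proof. by move=> r0; exact: (gauge_cvg rho (nbhs_right_lt r0)). Qed.

Lemma gauge_bigOW x p q : q <= p -> gauge_bigO x p -> gauge_bigO x q.
Proof.
move=> qp [C xC]; exists `|C|; near=> e.
have re0 : 0 < rho e by near: e; exact: gauge_near_gt0.
have re1 : rho e <= 1.
  by apply: ltW; near: e; exact: (gauge_near_lt (@ltr01 R)).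
apply: (@le_trans _ _ (C * rho e `^ p)); first by near: e.
apply: (@le_trans _ _ (`|C| * rho e `^ p)).
  by rewrite ler_wpM2r ?powR_ge0 ?ler_norm.
by rewrite ler_wpM2l //; apply: ger_powR => //; rewrite re0 re1.
Unshelve. all: by end_near. Qed.

Lemma gauge_bigOD x y p :
  gauge_bigO x p -> gauge_bigO y p -> gauge_bigO (x + y) p.
Proof.
move=> [C xC] [D yD]; exists (C + D); near=> e.
apply: (le_trans (ler_normD _ _)); rewrite mulrDl lerD //; by near: e.
Unshelve. all: by end_near. Qed.

Lemma gauge_bigON x p : gauge_bigO x p -> gauge_bigO (- x) p.
Proof.
by move=> [C xC]; exists C; near=> e; rewrite /= normrN; near: e.
Unshelve. all: by end_near. Qed.

Lemma gauge_bigOM x y p q :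
  gauge_bigO x p -> gauge_bigO y q -> gauge_bigO (x * y) (p + q).
Proof.
move=> [C xC] [D yD]; exists (C * D); near=> e.
have re0 : 0 < rho e by near: e; exact: gauge_near_gt0.
have -> : (x * y) e = x e * y e by [].
have pqE : rho e `^ (p + q) = rho e `^ p * rho e `^ q.
  by apply: powRD; apply/implyP => _; rewrite gt_eqF.
by rewrite normrM pqE mulrACA ler_pM //; near: e.
Unshelve. all: by end_near. Qed.

Lemma gauge_bigO_cst (r : R) : gauge_bigO (cst r) 0.
Proof. by exists `|r|; near=> e; rewrite powRr0 mulr1.
Unshelve. all: by end_near. Qed.

Lemma gauge_bigO_le x y p : (forall e, `|x e| <= `|y e|) ->
  gauge_bigO y p -> gauge_bigO x p.
Proof.
move=> xy [C yC]; exists C; near=> e; apply: (le_trans (xy e)); by near: e.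
Unshelve. all: by end_near. Qed.

Lemma moderate_bigO x p : gauge_bigO x p -> moderate x.
Proof.
move=> xp; exists (`|p| + 1); first by rewrite ltr_wpDl.
apply: gauge_bigOW xp; rewrite lerNl; apply: (@le_trans _ _ `|p|).
  by rewrite -normrN ler_norm.
by rewrite lerDl.
Qed.

Lemma moderateD x y : moderate x -> moderate y -> moderate (x + y).
Proof.
move=> [M M0 xM] [N N0 yN]; apply: (@moderate_bigO _ (- (M + N))).
by apply: gauge_bigOD; [apply: gauge_bigOW xM|apply: gauge_bigOW yN];
  rewrite lerN2 ?lerDl ?lerDr ltW.
Qed.

Lemma moderateN x : moderate x -> moderate (- x).
Proof. by move=> [M M0 xM]; exists M => //; apply: gauge_bigON. Qed.

Lemma moderateM x y : moderate x -> moderate y -> moderate (x * y).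
Proof.
move=> [M M0 xM] [N N0 yN]; apply: (@moderate_bigO _ (- M + - N)).
exact: gauge_bigOM.
Qed.

Lemma moderate_cst r : moderate (cst r).
Proof. exact: moderate_bigO (gauge_bigO_cst r). Qed.

Lemma negligible_moderate x : negligible x -> moderate x.
Proof. by move=> /(_ 1 ltr01) /moderate_bigO. Qed.

Lemma negligibleD x y : negligible x -> negligible y -> negligible (x + y).
Proof. by move=> xn yn N N0; apply: gauge_bigOD; [exact: xn|exact: yn]. Qed.

Lemma negligibleM x y : moderate x -> negligible y -> negligible (x * y).
Proof.
move=> [M M0 xM] yn N N0.
have -> : N = - M + (M + N) by rewrite addKr.
by apply: gauge_bigOM => //; apply: yn; exact: addr_gt0.
Qed.

Lemma negligible1 : ~ negligible 1.
Proof.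
move=> /(_ 1 ltr01) [C hC].
suff : \forall e \near (0 : R)^'+, False.
  by move=> /filter_ex [].
near=> e.
have re0 : 0 < rho e by near: e; exact: gauge_near_gt0.
have reC : rho e < (`|C| + 1)^-1.
  near: e; apply: gauge_near_lt; rewrite invr_gt0; exact: ltr_wpDl.
have hCe : `|1 : R| <= C * rho e `^ 1 by near: e.
move: hCe; rewrite normr1 (powRr1 (ltW re0)) leNgt => /negP; apply.
apply: (@le_lt_trans _ _ (`|C| * rho e)).
  by rewrite ler_wpM2r ?ler_norm // ltW.
apply: (@le_lt_trans _ _ ((`|C| + 1) * rho e)).
  by rewrite ler_wpM2r ?lerDl // ltW.
by rewrite -ltr_pdivlMl ?mulr1 //; exact: ltr_wpDl.
Unshelve. all: by end_near. Qed.

Definition moderate_pred : {pred R -> R} := fun x => `[< moderate x >].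

Lemma moderate_subring_closed : subring_closed moderate_pred.
Proof.
split=> [|x y /asboolP xm /asboolP ym|x y /asboolP xm /asboolP ym];
  apply/asboolP.
- exact: moderate_cst.
- exact: moderateD xm (moderateN ym).
- exact: moderateM.
Qed.

HB.instance Definition _ :=
  GRing.isSubringClosed.Build (R -> R) moderate_pred moderate_subring_closed.

Record mnet := MNet { mnet_fun :> R -> R; mnetP : mnet_fun \in moderate_pred }.

HB.instance Definition _ := [isSub for mnet_fun].
HB.instance Definition _ := [Choice of mnet by <:].
HB.instance Definition _ := [SubChoice_isSubComNzRing of mnet by <:].

Definition negligible_pred : {pred mnet} := fun z : mnet => `[< negligible z >].

Lemma negligible_idealr_closed : idealr_closed negligible_pred.
Proof.
split=> [||z x y /asboolP xn /asboolP yn].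
- apply/asboolP => N N0; exists 0; near=> e.
  by rewrite mul0r normr0.
- by apply/asboolP; exact: negligible1.
- apply/asboolP; apply: negligibleD => //; apply: negligibleM => //.
  by have /asboolP := mnetP z.
Unshelve. all: by end_near. Qed.

HB.instance Definition _ :=
  isIdealr.Build mnet negligible_pred negligible_idealr_closed.

Definition GR : Type := {ideal_quot negligible_pred}.

HB.instance Definition _ := GRing.ComNzRing.on GR.
HB.instance Definition _ := EqQuotient.on GR.

Definition GR_unit : {pred GR} := fun z : GR => `[< exists y : GR, y * z = 1 >].

Definition GR_inv (z : GR) : GR := xget z [set y : GR | y * z = 1].

Lemma GR_mulVx : {in GR_unit, left_inverse 1 GR_inv *%R}.
Proof.
move=> x /asboolP [y yx].
by rewrite /GR_inv; case: xgetP => [z -> //|/(_ y)]; rewrite /= yx.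
Qed.

Lemma GR_unitPl (x y : GR) : y * x = 1 -> GR_unit x.
Proof. by move=> yx; apply/asboolP; exists y. Qed.

Lemma GR_inv_out : {in [predC GR_unit], GR_inv =1 id}.
Proof.
move=> x /negP xu; rewrite /GR_inv; case: xgetP => // y _ yx.
by case: xu; apply/asboolP; exists y.
Qed.

HB.instance Definition _ :=
  GRing.ComNzRing_hasMulInverse.Build GR GR_mulVx GR_unitPl GR_inv_out.

End Nets.

Section GeneralizedPoints.
Context {R : realType} {rho : gauge R}.
Local Notation GR := (GR rho).

(* The class [x_e] of a moderate net (a default value on other nets). *)
Definition gclass (x : R -> R) : GR :=
  \pi_(GR)%qT (insubd (0 : mnet rho) x).

Definition is_rep (x : R -> R) (a : GR) := moderate rho x /\ gclass x = a.

Lemma gclass_eq (x y : R -> R) : moderate rho x -> moderate rho y ->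
  gclass x = gclass y <-> negligible rho (x - y).
Proof.
move=> xm ym.
have vx : val (insubd (0 : mnet rho) x) = x by rewrite insubdK //; apply/asboolP.
have vy : val (insubd (0 : mnet rho) y) = y by rewrite insubdK //; apply/asboolP.
rewrite /gclass; split=> [/eqP|xy].
  by rewrite -Quotient.idealrBE => /asboolP; rewrite /= vx vy.
by apply/eqP; rewrite -Quotient.idealrBE; apply/asboolP; rewrite /= vx vy.
Qed.

Definition grepr (a : GR) : R -> R := val (repr a).

Lemma grepr_is_rep (a : GR) : is_rep (grepr a) a.
Proof.
split; first by have /asboolP := valP (repr a).
by rewrite /gclass /grepr valKd reprK.
Qed.

Definition enorm n (x : 'rV[R]_n) : R := Num.sqrt (\sum_i x 0 i ^+ 2).

(* The quotient of the moderate nets in R^n is identified with row vectors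
   over GR; [gvec_eq] and [gvec_surj] justify this. *)
Definition gvec n (x : R -> 'rV[R]_n) : 'rV[GR]_n :=
  \row_i gclass (fun e => x e 0 i).

Definition vmoderate n (x : R -> 'rV[R]_n) := moderate rho (fun e => enorm (x e)).

Definition is_vrep n (x : R -> 'rV[R]_n) (a : 'rV[GR]_n) :=
  vmoderate x /\ gvec x = a.

Definition vrepr n (a : 'rV[GR]_n) : R -> 'rV[R]_n :=
  fun e => \row_i grepr (a 0 i) e.

Lemma enorm_ge0 n (x : 'rV[R]_n) : 0 <= enorm x.
Proof. exact: sqrtr_ge0. Qed.

Lemma ler_enorm n (x : 'rV[R]_n) i : `|x 0 i| <= enorm x.
Proof.
rewrite -sqrtr_sqr /enorm ler_wsqrtr // (bigD1 i) //= lerDl.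
by apply: sumr_ge0 => j _; exact: sqr_ge0.
Qed.

Lemma enorm_le_sum n (x : 'rV[R]_n) : enorm x <= \sum_i `|x 0 i|.
Proof.
have s0 : 0 <= \sum_i `|x 0 i| by apply: sumr_ge0.
rewrite -(ger0_norm s0) -sqrtr_sqr /enorm ler_wsqrtr // expr2 mulr_suml.
apply: ler_sum => i _; rewrite -real_normK ?num_real // expr2 ler_wpM2l //.
by rewrite (bigD1 i) //= lerDl; apply: sumr_ge0.
Qed.

Lemma gauge_bigO_enorm n (x : R -> 'rV[R]_n) p :
  gauge_bigO rho (fun e => enorm (x e)) p <->
  forall i, gauge_bigO rho (fun e => x e 0 i) p.
Proof.
split=> [xp i|xp].
  apply: gauge_bigO_le xp => e; rewrite [leRHS]ger0_norm ?enorm_ge0 //.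
  exact: ler_enorm.
apply: (@gauge_bigO_le _ _ _ (fun e => \sum_i `|x e 0 i|)).
  move=> e; rewrite !ger0_norm ?enorm_ge0 ?sumr_ge0 //; exact: enorm_le_sum.
have -> : (fun e => \sum_i `|x e 0 i|) = \sum_i (fun e => `|x e 0 i|).
  by apply/funext => e; rewrite fct_sumE.
elim/big_ind: _ => [|f g|i _]; last 1 first.
- by apply: gauge_bigO_le (xp i) => e; rewrite normr_id.
- by exists 0; near=> e; rewrite mul0r normr0.
- exact: gauge_bigOD.
Unshelve. all: by end_near. Qed.

Lemma vmoderateP n (x : R -> 'rV[R]_n) :
  vmoderate x <-> forall i, moderate rho (fun e => x e 0 i).
Proof.
split=> [[N N0 xN] i|xm].
  by exists N => //; move/gauge_bigO_enorm : xN; exact.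
have /choice [N NP] : forall i, exists N, 0 < N /\
    gauge_bigO rho (fun e => x e 0 i) (- N).
  by move=> i; have [N N0 xN] := xm i; exists N.
exists (1 + \sum_i N i).
  by rewrite ltr_wpDr // sumr_ge0 // => i _; rewrite ltW //; case: (NP i).
apply/gauge_bigO_enorm => i; apply: gauge_bigOW (NP i).2.
rewrite lerN2 (bigD1 i) //= addrCA lerDl addr_ge0 // sumr_ge0 // => j _.
by rewrite ltW //; case: (NP j).
Qed.

Lemma gvec_eq n (x y : R -> 'rV[R]_n) : vmoderate x -> vmoderate y ->
  gvec x = gvec y <-> negligible rho (fun e => enorm (x e - y e)).
Proof.
move=> /vmoderateP xm /vmoderateP ym; split=> [xy N N0|xy].
  apply/gauge_bigO_enorm => i.
  have := congr1 (fun v : 'rV_n => v 0 i) xy; rewrite !mxE.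
  move=> /(gclass_eq (xm i) (ym i)) /(_ N N0).
  by apply: gauge_bigO_le => e; rewrite !mxE.
apply/rowP => i; rewrite !mxE; apply/gclass_eq => // N N0.
move/(_ N N0)/gauge_bigO_enorm : xy => /(_ i).
by apply: gauge_bigO_le => e; rewrite !mxE.
Qed.

Lemma gvec_surj n (a : 'rV[GR]_n) : is_vrep (vrepr a) a.
Proof.
split.
  apply/vmoderateP => i; have [+ _] := grepr_is_rep (a 0 i).
  by congr moderate; apply/funext => e; rewrite mxE.
apply/rowP => i; rewrite mxE; have [_ +] := grepr_is_rep (a 0 i).
by move=> <-; congr gclass; apply/funext => e; rewrite mxE.
Qed.

Definition gle (a b : GR) := exists x y : R -> R,
  [/\ is_rep x a, is_rep y b & forall e, 0 < e <= 1 -> x e <= y e].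

Definition glt (a b : GR) := gle 0 (b - a) /\ b - a \is a GRing.unit.

Definition gcc (a b : GR) : set GR := [set t | gle a t /\ gle t b].

Definition goo (a b : GR) : set GR := [set t | glt a t /\ glt t b].

Definition gnorm n (a : 'rV[GR]_n) : GR := gclass (fun e => enorm (vrepr a e)).

Definition gball n (c : 'rV[GR]_n) (r : GR) : set 'rV[GR]_n :=
  [set a | glt (gnorm (a - c)) r].

Definition sharp_interior n (A : set 'rV[GR]_n) : set 'rV[GR]_n :=
  [set c | exists2 r, glt 0 r & gball c r `<=` A].

Definition sharp_lim n k (A : set 'rV[GR]_n) (g : 'rV[GR]_n -> 'rV[GR]_k)
    (c : 'rV[GR]_n) (v : 'rV[GR]_k) :=
  forall r, glt 0 r -> exists2 q, glt 0 q &
    forall a, A a -> gball c q a -> gball v r (g a).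

End GeneralizedPoints.

Section SmoothNets.
Context {R : realType}.

(* A multi-index is given by the list of the coordinate directions in which
   one differentiates; their order is immaterial for smooth functions. *)
Definition partial n k (w : seq 'I_n) (f : 'rV[R]_n -> 'rV[R]_k) :
    'rV[R]_n -> 'rV[R]_k :=
  foldr (fun i (g : 'rV[R]_n -> 'rV[R]_k) x => 'D_(delta_mx 0 i) g x) f w.

(* Differentiability of all iterated partial derivatives gives their
   continuity, so that this is C^infinity on an open set U. *)
Definition smooth_on n k (U : set 'rV[R]_n) (f : 'rV[R]_n -> 'rV[R]_k) :=
  forall w x, U x -> differentiable (partial w f) x.

End SmoothNets.

Section GeneralizedSmoothFunctions.
Context {R : realType} {rho : gauge R}.
Local Notation GR := (GR rho).

Definition strong_int n (U : R -> set 'rV[R]_n) : set 'rV[GR]_n :=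
  [set a | forall x, is_vrep x a -> \forall e \near 0^'+, U e (x e)].

(* The values of f outside X are irrelevant. *)
Definition defined_by n k (X : set 'rV[GR]_n) (f : 'rV[GR]_n -> 'rV[GR]_k)
    (U : R -> set 'rV[R]_n) (fe : R -> 'rV[R]_n -> 'rV[R]_k) :=
  [/\ forall e, 0 < e <= 1 -> open (U e) /\ smooth_on (U e) (fe e),
      X `<=` strong_int U,
      forall a x, X a -> is_vrep x a -> is_vrep (fun e => fe e (x e)) (f a) &
      forall a x w, X a -> is_vrep x a ->
        vmoderate (rho := rho) (fun e => partial w (fe e) (x e))].

Definition GSF n k (X : set 'rV[GR]_n) (Y : set 'rV[GR]_k)
    (f : 'rV[GR]_n -> 'rV[GR]_k) :=
  (forall a, X a -> Y (f a)) /\ exists U fe, defined_by X f U fe.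

(* The derivative along w of a GSF f on X: the class of the derivatives of any
   defining net at sharply interior points of X, and their sharp limit from
   the sharp interior of X at the other points. *)
Definition gpartial_int n k (X : set 'rV[GR]_n) (f : 'rV[GR]_n -> 'rV[GR]_k)
    (w : seq 'I_n) (a : 'rV[GR]_n) : 'rV[GR]_k :=
  xget 0 [set v | exists U fe x, [/\ defined_by X f U fe, is_vrep x a &
                    is_vrep (fun e => partial w (fe e) (x e)) v]].

Definition gpartial n k (X : set 'rV[GR]_n) (f : 'rV[GR]_n -> 'rV[GR]_k)
    (w : seq 'I_n) (a : 'rV[GR]_n) : 'rV[GR]_k :=
  if pselect (sharp_interior X a) then gpartial_int X f w a
  else xget 0 [set v | sharp_lim (sharp_interior X) (gpartial_int X f w) a v].

(* Points, sets and functions of one generalized scalar variable, seen in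
   dimension 1. *)
Definition pt (t : GR) : 'rV[GR]_1 := const_mx t.

Definition line (A : set GR) : set 'rV[GR]_1 := [set x | A (x 0 0)].

Definition lift1 k (g : GR -> 'rV[GR]_k) : 'rV[GR]_1 -> 'rV[GR]_k :=
  fun x => g (x 0 0).

Definition gderivv k (A : set GR) (g : GR -> 'rV[GR]_k) (t : GR) : 'rV[GR]_k :=
  gpartial (line A) (lift1 g) [:: ord0] (pt t).

Definition gderiv (A : set GR) (g : GR -> GR) (t : GR) : GR :=
  gderivv A (fun t' => pt (g t')) t 0 0.

(* Coordinates on GR^(1+n) = GR x GR^n. *)
Definition gpair n (t : GR) (l : 'rV[GR]_n) : 'rV[GR]_(1 + n) :=
  row_mx (pt t) l.

Definition gfst n (x : 'rV[GR]_(1 + n)) : GR := lsubmx x 0 0.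

Definition gsnd n (x : 'rV[GR]_(1 + n)) : 'rV[GR]_n := rsubmx x.

Definition gprod n (A : set GR) (B : set 'rV[GR]_n) : set 'rV[GR]_(1 + n) :=
  [set x | A (gfst x) /\ B (gsnd x)].

Definition gs_family n k (J : set GR) (X : set 'rV[GR]_n) (Y : set 'rV[GR]_k)
    (f : GR -> 'rV[GR]_n -> 'rV[GR]_k) :=
  GSF (gprod J X) Y (fun x => f (gfst x) (gsnd x)).

End GeneralizedSmoothFunctions.

Section Lagrangian.
Context {R : realType} {rho : gauge R} {d : nat}.
Local Notation GR := (GR rho).
Variables (a b : GR) (F : GR -> 'rV[GR]_d -> 'rV[GR]_d -> GR).

Definition lagr_dom : set 'rV[GR]_(1 + (d + d)) := gprod (gcc a b) setT.

Definition lagr_map (x : 'rV[GR]_(1 + (d + d))) : 'rV[GR]_1 :=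
  pt (F (gfst x) (lsubmx (gsnd x)) (rsubmx (gsnd x))).

(* The coordinates of the argument of [lagr_map] are (t, u, udot), in this
   order: the gradients in u and udot are in the directions below. *)
Definition lagr_u (j : 'I_d) (t : GR) (l v : 'rV[GR]_d) : GR :=
  gpartial lagr_dom lagr_map [:: rshift 1 (lshift d j)]
    (gpair t (row_mx l v)) 0 0.

Definition lagr_udot (j : 'I_d) (t : GR) (l v : 'rV[GR]_d) : GR :=
  gpartial lagr_dom lagr_map [:: rshift 1 (rshift d j)]
    (gpair t (row_mx l v)) 0 0.

Definition euler_lagrange (u : GR -> 'rV[GR]_d) :=
  let du := gderivv (gcc a b) u in
  forall t, gcc a b t -> forall j,
    lagr_u j t (u t) (du t)
    - gderiv (gcc a b) (fun t' => lagr_udot j t' (u t') (du t')) t = 0.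

End Lagrangian.

(* Main.v *)
(**
  Everything is computed on representatives. A net of smooth functions whose
  partial derivatives are moderate at all the points of a set is determined there
  up to negligible nets by its point values, and so are its derivatives: with
  h = rho^k the difference quotient over a step h has an error h sup |f''|, where
  sup |f''| is bounded by one power of rho because a net of bad points would be a
  generalized point with a non-moderate value. Hence derivatives at sharply interior
  points do not depend on the defining net. The same uniform bound gives sharp
  Lipschitz continuity up to the boundary of [a, b], so that t -> F_udot(t, u, udot)
  is a generalized smooth function on the closed interval and the Euler-Lagrange
  equation is an equality of classes of ordinary derivatives.

  At s = 0 one has T = t and L = u along the curve, hence T' = 1 and L' = u'.
  Differentiating the invariance identity in s at s = 0 and inserting the
  Euler-Lagrange equation shows that the derivative in t of the Noether quantity
  vanishes on (a, b); by the mean value theorem on representatives the quantity is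
  constant on (a, b), and the limits at the end points are limits of a constant.
*)
Require Import Defs.
From mathcomp Require Import all_boot all_order all_algebra ring lra.
From mathcomp Require Import all_classical all_reals all_analysis.

Set Implicit Arguments.
Unset Strict Implicit.
Unset Printing Implicit Defensive.

Import Order.TTheory GRing.Theory Num.Theory.
Import numFieldNormedType.Exports.

Local Open Scope classical_set_scope.
Local Open Scope ring_scope.
Local Notation negligible := Defs.negligible.

(** * Nets, classes and the sharp topology *)

Section NetEstimates.
Context {R : realType} (rho : gauge R).
Implicit Types x y z : R -> R.

(** A generalized function is known only through its values at classes of nets, and its defining
    functions live on open sets [U e] that contain a given representative merely for e small. There
    is no compact set to argue on, so that even the inclusion of a segment in [U e] needs a
    selection of nets. Since rho tends to 0, one more power of rho absorbs any finite constant; most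
    shifts of an exponent by one or two have this origin.

    T_s and L_s exist over the open interval only, whereas the Euler-Lagrange equation
    differentiates on the closed one. The latter forces the study of derivatives up to the boundary,
    the former the passage to limits in the conclusion.

    Everything along the curve is collected in nets of the two real variables (s, t), on domains
    where T' has no zero. An identity known only on the line s = 0 may be differentiated there in t,
    one known for all s in J also in s; the symmetry of mixed derivatives joins the two kinds of
    information. *)

Lemma gauge_near01 :
  \forall e \near 0^'+, [/\ 0 < rho e, 0 <= rho e & rho e <= 1].
Proof.
have r0 := gauge_near_gt0 rho; near=> e; split; first by near: e.
  by apply: ltW; near: e.
by apply: ltW; near: e; apply: gauge_near_lt.
Unshelve. all: by end_near. Qed.

Lemma near_index : \forall e \near (0 : R)^'+, 0 < e <= 1.
Proof.
near=> e; apply/andP; split; first by near: e; exact: nbhs_right_gt.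
by apply: ltW; near: e; apply: nbhs_right_lt.
Unshelve. all: by end_near. Qed.

(** An extra power of rho swallows the constant of the O-bound, hence the successor of
    [Num.bound N]. From here on only natural exponents without constants occur; [negligible_netP] is
    the analogue for negligible nets. *)
Lemma moderate_netP x : moderate rho x <->
  exists n : nat, \forall e \near 0^'+, `|x e| * rho e ^+ n <= 1.
Proof.
split=> [[N N0 [C xC]]|[n xn]].
  exists (Num.bound N).+1.
  near=> e.
  have [r0 r0' r1] : [/\ 0 < rho e, 0 <= rho e & rho e <= 1].
    by near: e; exact: gauge_near01.
  have rC : rho e < (`|C| + 1)^-1.
    by near: e; apply: gauge_near_lt; rewrite invr_gt0 ltr_wpDl.
  apply: (@le_trans _ _ (C * rho e `^ (- N) * rho e ^+ (Num.bound N).+1)).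
    by rewrite ler_wpM2r ?exprn_ge0 //; near: e.
  apply: (@le_trans _ _ (`|C| * (rho e `^ (- N) * rho e ^+ (Num.bound N)) * rho e)).
    rewrite exprSr !mulrA ler_wpM2r // ler_wpM2r ?exprn_ge0 //.
    by rewrite ler_wpM2r ?powR_ge0 ?ler_norm.
  apply: (@le_trans _ _ (`|C| * 1 * rho e)).
    rewrite ler_wpM2r // ler_wpM2l //.
    rewrite -powR_mulrn // -powRD; last by apply/implyP => _; rewrite gt_eqF.
    rewrite -[leRHS](powRr0 (rho e)); apply: ger_powR; first by rewrite r0.
    by rewrite addrC subr_ge0 ltW // archi_boundP // ltW.
  rewrite mulr1; apply: (@le_trans _ _ ((`|C| + 1) * rho e)).
    by rewrite ler_wpM2r // lerDl.
  by rewrite mulrC -ler_pdivlMr ?ltr_wpDl // mul1r ltW.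
exists n.+1%:R; first by rewrite ltr0n.
apply: (@gauge_bigOW _ _ _ (- n%:R)); first by rewrite lerN2 ler_nat.
exists 1; near=> e.
have [r0 r0' r1] : [/\ 0 < rho e, 0 <= rho e & rho e <= 1].
  by near: e; exact: gauge_near01.
rewrite mul1r powRN powR_mulrn // -[leRHS]mul1r ler_pdivlMr ?exprn_gt0 //.
by near: e.
Unshelve. all: by end_near. Qed.

Lemma negligible_netP x : negligible rho x <->
  forall n : nat, \forall e \near 0^'+, `|x e| <= rho e ^+ n.
Proof.
split=> [xn n|xn N N0].
  have [|C xC] := xn n.+1%:R; first by rewrite ltr0n.
  near=> e.
  have [r0 r0' r1] : [/\ 0 < rho e, 0 <= rho e & rho e <= 1].
    by near: e; exact: gauge_near01.
  have rC : rho e < (`|C| + 1)^-1.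
    by near: e; apply: gauge_near_lt; rewrite invr_gt0 ltr_wpDl.
  apply: (@le_trans _ _ (C * rho e `^ n.+1%:R)); first by near: e.
  rewrite powR_mulrn // exprSr mulrCA ler_piMr ?exprn_ge0 //.
  apply: (@le_trans _ _ ((`|C| + 1) * rho e)).
    by rewrite ler_wpM2r // (le_trans (ler_norm C)) // lerDl.
  by rewrite mulrC -ler_pdivlMr ?ltr_wpDl // mul1r ltW.
exists 1; near=> e.
have [r0 r0' r1] : [/\ 0 < rho e, 0 <= rho e & rho e <= 1].
  by near: e; exact: gauge_near01.
rewrite mul1r; apply: (@le_trans _ _ (rho e ^+ (Num.bound N))); first by near: e.
rewrite -powR_mulrn //; apply: ger_powR; first by rewrite r0.
by rewrite ltW // archi_boundP // ltW.
Unshelve. all: by end_near. Qed.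

Lemma moderate_near_le x y : moderate rho y ->
  (\forall e \near 0^'+, `|x e| <= `|y e|) -> moderate rho x.
Proof.
move=> /moderate_netP [n yn] xy; apply/moderate_netP; exists n; near=> e.
have [r0 r0' r1] : [/\ 0 < rho e, 0 <= rho e & rho e <= 1].
  by near: e; exact: gauge_near01.
apply: (@le_trans _ _ (`|y e| * rho e ^+ n)); last by near: e.
by rewrite ler_wpM2r ?exprn_ge0 //; near: e.
Unshelve. all: by end_near. Qed.

Lemma negligible_near_le x y : negligible rho y ->
  (\forall e \near 0^'+, `|x e| <= `|y e|) -> negligible rho x.
Proof.
move=> /negligible_netP yn xy; apply/negligible_netP => n.
by near=> e; apply: (@le_trans _ _ `|y e|); near: e => //; exact: yn.
Unshelve. all: by end_near. Qed.

Lemma moderate_near_eq x y : moderate rho x ->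
  (\forall e \near 0^'+, x e = y e) -> moderate rho y.
Proof.
by move=> xm xy; apply: moderate_near_le xm _; apply: filterS xy => e ->.
Qed.

Lemma negligible_near_eq x y : negligible rho x ->
  (\forall e \near 0^'+, x e = y e) -> negligible rho y.
Proof.
by move=> xm xy; apply: negligible_near_le xm _; apply: filterS xy => e ->.
Qed.

Lemma negligible0 : negligible rho (cst 0).
Proof.
apply/negligible_netP => n; near=> e; rewrite normr0 exprn_ge0 //.
by apply: ltW; near: e; exact: gauge_near_gt0.
Unshelve. all: by end_near. Qed.

Lemma negligibleN x : negligible rho x -> negligible rho (- x).
Proof.
by move=> xn; apply: negligible_near_le xn _; near=> e; rewrite normrN.
Unshelve. all: by end_near. Qed.

Lemma negligibleMr x y : negligible rho x -> moderate rho y ->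
  negligible rho (fun e => x e * y e).
Proof.
move=> xn ym; apply: negligible_near_eq (negligibleM ym xn) _.
by near=> e; rewrite mulrC.
Unshelve. all: by end_near. Qed.

Lemma negligible_sum (I : finType) (x : I -> R -> R) :
  (forall i, negligible rho (x i)) -> negligible rho (fun e => \sum_i x i e).
Proof.
move=> xm; rewrite (_ : (fun _ => _) = \sum_i x i); last first.
  by apply/funext => e; rewrite fct_sumE.
elim/big_ind: _ => // [|f g]; [exact: negligible0|exact: negligibleD].
Qed.

Lemma moderate_gaugeX n : moderate rho (fun e => rho e ^+ n).
Proof.
apply/moderate_netP; exists 0%N; near=> e.
have [r0 r0' r1] : [/\ 0 < rho e, 0 <= rho e & rho e <= 1].
  by near: e; exact: gauge_near01.
by rewrite mulr1 ger0_norm ?exprn_ge0 // exprn_ile1.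
Unshelve. all: by end_near. Qed.

Lemma gauge_near_leX m n : (m <= n)%N ->
  \forall e \near 0^'+, rho e ^+ n <= rho e ^+ m.
Proof.
move=> mn; near=> e.
have [r0 r0' r1] : [/\ 0 < rho e, 0 <= rho e & rho e <= 1].
  by near: e; exact: gauge_near01.
by rewrite ler_wiXn2l.
Unshelve. all: by end_near. Qed.

End NetEstimates.

(** * Classes of nets: ring operations, units and order *)

Section Classes.
Context {R : realType} {rho : gauge R}.
Local Notation GR := (GR rho).
Local Notation cl := (@gclass R rho).
Local Notation moderate := (moderate rho).
Local Notation negligible := (Defs.negligible rho).
Implicit Types x y z : R -> R.

Lemma gclassE x (xm : x \in moderate_pred rho) : cl x = \pi_(GR)%qT (MNet xm).
Proof.
rewrite /gclass; congr (\pi_(GR)%qT _); apply/val_inj.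
by rewrite insubdK //; exact: xm.
Qed.

Lemma gclassD x y : moderate x -> moderate y -> cl (fun e => x e + y e) = cl x + cl y.
Proof.
move=> /asboolP xm /asboolP ym.
rewrite (gclassE xm) (gclassE ym) -[RHS]Quotient.pi_add /gclass.
congr (\pi_(GR)%qT _); apply/val_inj; rewrite insubdK //.
by apply/asboolP; apply: moderateD; exact/asboolP.
Qed.

Lemma gclassM x y : moderate x -> moderate y -> cl (fun e => x e * y e) = cl x * cl y.
Proof.
move=> /asboolP xm /asboolP ym.
rewrite (gclassE xm) (gclassE ym) -[RHS]Quotient.pi_mul /gclass.
congr (\pi_(GR)%qT _); apply/val_inj; rewrite insubdK //.
by apply/asboolP; apply: moderateM; exact/asboolP.
Qed.

Lemma gclass0 : cl (cst 0) = 0.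
Proof.
have m0 := moderate_cst rho (0 : R).
by apply: (@addrI _ (cl (cst 0))); rewrite -gclassD // addr0; congr gclass;
  apply/funext => e /=; rewrite addr0.
Qed.

Lemma gclassN x : moderate x -> cl (fun e => - x e) = - cl x.
Proof.
move=> xm; apply/eqP; rewrite -addr_eq0; apply/eqP.
rewrite -gclassD //; last exact: moderateN.
by rewrite -gclass0; congr gclass; apply/funext => e; rewrite addNr.
Qed.

Lemma gclassB x y : moderate x -> moderate y -> cl (fun e => x e - y e) = cl x - cl y.
Proof. by move=> xm ym; rewrite gclassD ?gclassN //; exact: moderateN. Qed.

Lemma gclass1 : cl (cst 1) = 1.
Proof.
have m1 : cst 1 \in moderate_pred rho by apply/asboolP; exact: moderate_cst.
rewrite (gclassE m1).
rewrite [RHS](_ : _ = \pi_(GR)%qT 1); last by rewrite piE.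
by congr (\pi_(GR)%qT _); exact/val_inj.
Qed.

Lemma gclass_sum (I : finType) (x : I -> R -> R) : (forall i, moderate (x i)) ->
  cl (fun e => \sum_i x i e) = \sum_i cl (x i).
Proof.
move=> xm; suff: moderate (fun e => \sum_i x i e) /\
    cl (fun e => \sum_i x i e) = \sum_i cl (x i) by case.
elim: (index_enum I) => [|i s [ms cs]].
  split; under eq_fun do rewrite big_nil; first exact: moderate_cst.
  by rewrite big_nil; exact: gclass0.
split; under eq_fun do rewrite big_cons; first exact: moderateD.
by rewrite big_cons gclassD // cs.
Qed.

Lemma gclass_near_eq x y : moderate x -> (\forall e \near 0^'+, x e = y e) ->
  cl x = cl y.
Proof.
move=> xm xy; apply/gclass_eq => //; first exact: moderate_near_eq xy.
by apply: negligible_near_eq (negligible0 rho) _; near=> e;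
  rewrite /= -[(x - y) e]/(x e - y e) (near xy e) // subrr.
Unshelve. all: by end_near. Qed.

Lemma gclass_eq0 x : moderate x -> cl x = 0 <-> negligible x.
Proof.
move=> xm; rewrite -gclass0 (gclass_eq xm); last exact: moderate_cst.
by rewrite (_ : x - cst 0 = x) //; apply/funext => e; rewrite [LHS]subr0.
Qed.

Lemma grepr_moderate (a : GR) : moderate (grepr a).
Proof. by case: (grepr_is_rep a). Qed.

Lemma greprK (a : GR) : cl (grepr a) = a.
Proof. by case: (grepr_is_rep a). Qed.

(** An inverse [z] makes |z x| at least 1/2 for e small, while |z| is at most rho^-n; the factor 1/2
    costs one power, hence [n.+1]. Conversely, the lower bound on |x| is what makes the net of
    pointwise inverses moderate. *)
Lemma gclass_unitP x : moderate x ->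
  cl x \is a GRing.unit <->
  exists n : nat, \forall e \near 0^'+, rho e ^+ n <= `|x e|.
Proof.
move=> xm; split.
  move=> /asboolP [y]; rewrite -{1}(greprK y); have ym := grepr_moderate y.
  set z := grepr y in ym *; rewrite -gclassM // -gclass1.
  have zxm := moderateM ym xm.
  move=> /(gclass_eq zxm (moderate_cst _ _)) /negligible_netP /(_ 1%N) h.
  have /moderate_netP [n zn] := ym.
  exists n.+1; near=> e.
  have [r0 r0' r1] : [/\ 0 < rho e, 0 <= rho e & rho e <= 1].
    by near: e; exact: gauge_near01.
  have rh : rho e < 2^-1 by near: e; apply: gauge_near_lt; rewrite invr_gt0.
  have zne : `|z e| * rho e ^+ n <= 1 by near: e.
  have he : `|z e * x e - 1| <= rho e by near: e; apply: filterS h => e;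
    rewrite expr1.
  have zx : 2^-1 <= `|z e| * `|x e|.
    rewrite -normrM; have := ler_norm (z e * x e); move: he.
    rewrite ler_norml => /andP[]; lra.
  rewrite exprS; apply: (@le_trans _ _ (2^-1 * rho e ^+ n)).
    by rewrite ler_wpM2r ?exprn_ge0 // ltW.
  apply: (@le_trans _ _ (`|z e| * `|x e| * rho e ^+ n)).
    by rewrite ler_wpM2r ?exprn_ge0.
  by rewrite mulrAC ler_piMl.
move=> [n xn].
have ym : moderate (fun e => (x e)^-1).
  apply/moderate_netP; exists n; near=> e.
  have [r0 r0' r1] : [/\ 0 < rho e, 0 <= rho e & rho e <= 1].
    by near: e; exact: gauge_near01.
  have xne : rho e ^+ n <= `|x e| by near: e.
  have x0 : 0 < `|x e| by apply: lt_le_trans xne; rewrite exprn_gt0.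
  by rewrite normfV mulrC ler_pdivrMr // mul1r.
apply/asboolP; exists (cl (fun e => (x e)^-1)).
rewrite -gclassM // -gclass1; apply: gclass_near_eq; first exact: moderateM.
near=> e.
have [r0 r0' r1] : [/\ 0 < rho e, 0 <= rho e & rho e <= 1].
  by near: e; exact: gauge_near01.
have xne : rho e ^+ n <= `|x e| by near: e.
rewrite mulVf // -normr_gt0; apply: lt_le_trans xne; rewrite exprn_gt0 //.
Unshelve. all: by end_near. Qed.

(** The order asks for representatives comparable at every index. Replacing y by max(x, y) achieves
    this, and it stays in the class of y because it exceeds y by at most |z|. *)
Lemma gle_repP x y : moderate x -> moderate y ->
  gle (cl x) (cl y) <->
  exists z, [/\ negligible z & \forall e \near 0^'+, x e <= y e + z e].
Proof.
move=> xm ym; split.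
  move=> [x' [y' [[x'm x'E] [y'm y'E] xy]]].
  move/(gclass_eq x'm xm) : x'E => xn; move/(gclass_eq y'm ym) : y'E => yn.
  exists ((y' - y) - (x' - x)); split.
    by apply: negligibleD => //; exact: negligibleN.
  near=> e.
  have : x' e <= y' e by apply: xy; near: e; exact: near_index.
  rewrite -[(_ - _ : R -> R) e]/((y' e - y e) - (x' e - x e)); lra.
move=> [z [zn xy]].
have mm : moderate (fun e => Num.max (x e) (y e)).
  apply: (@moderate_near_le _ _ _ (fun e => `|x e| + `|y e|)).
    apply: moderateD; [apply: moderate_near_le xm _|apply: moderate_near_le ym _];
    by apply: filterE => e; rewrite normr_id.
  near=> e; rewrite [leRHS]ger0_norm ?addr_ge0 //.
  by rewrite /Num.max; case: ifP => _; rewrite ?lerDl ?lerDr.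
exists x, (fun e => Num.max (x e) (y e)); split=> //; last first.
  by move=> e _; rewrite le_max lexx.
split=> //; apply/gclass_eq => //.
apply: negligible_near_le zn _; near=> e.
have xye : x e <= y e + z e by near: e.
rewrite -[(_ - _ : R -> R) e]/(Num.max (x e) (y e) - y e) /Num.max.
case: ltP => h; first by rewrite subrr normr0.
by rewrite ger0_norm ?subr_ge0 // (le_trans _ (ler_norm _)) //; lra.
Unshelve. all: by end_near. Qed.

Lemma gle_near x y : moderate x -> moderate y ->
  (\forall e \near 0^'+, x e <= y e) -> gle (cl x) (cl y).
Proof.
move=> xm ym xy; apply/gle_repP => //; exists (cst 0); split;
  first exact: negligible0.
by apply: filterS xy => e; rewrite addr0.
Qed.

Lemma glt_repP x y : moderate x -> moderate y ->
  glt (cl x) (cl y) <->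
  exists n : nat, \forall e \near 0^'+, x e + rho e ^+ n <= y e.
Proof.
move=> xm ym; rewrite /glt -gclassB // -gclass0.
have yxm : moderate (fun e => y e - x e) by apply: moderateD => //; exact: moderateN.
split=> [[/(gle_repP (moderate_cst _ _) yxm) [z [zn h]]]|[n h]].
  move=> /(gclass_unitP yxm) [n hn]; exists n.
  near=> e.
  have [r0 r0' r1] : [/\ 0 < rho e, 0 <= rho e & rho e <= 1].
    by near: e; exact: gauge_near01.
  have he : 0 <= y e - x e + z e by near: e.
  have hne : rho e ^+ n <= `|y e - x e| by near: e.
  have ze : `|z e| <= rho e ^+ n.+1 by near: e; move/negligible_netP : zn; exact.
  have rn : rho e ^+ n.+1 < rho e ^+ n.
    rewrite exprS gtr_pMl ?exprn_gt0 //; near: e; exact: gauge_near_lt.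
  case: (lerP 0 (y e - x e)) => yx.
    by move: hne; rewrite ger0_norm //; lra.
  move: hne; rewrite ltr0_norm // => hne; move: ze; rewrite ler_norml => /andP[]; lra.
split.
  apply: gle_near => //; first exact: moderate_cst.
  near=> e.
  have [r0 r0' r1] : [/\ 0 < rho e, 0 <= rho e & rho e <= 1].
    by near: e; exact: gauge_near01.
  have he : x e + rho e ^+ n <= y e by near: e.
  have : 0 < rho e ^+ n by rewrite exprn_gt0.
  rewrite /=; lra.
apply/gclass_unitP => //; exists n; near=> e.
have he : x e + rho e ^+ n <= y e by near: e.
apply: le_trans (ler_norm _); lra.
Unshelve. all: by end_near. Qed.

Lemma glt_gle (a b : GR) : glt a b -> gle a b.
Proof.
rewrite -(greprK a) -(greprK b).
move=> /(glt_repP (grepr_moderate a) (grepr_moderate b)) [n h].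
apply: gle_near; [exact: grepr_moderate..|].
near=> e.
have he : grepr a e + rho e ^+ n <= grepr b e by near: e.
have [r0 r0' r1] : [/\ 0 < rho e, 0 <= rho e & rho e <= 1].
  by near: e; exact: gauge_near01.
by apply: le_trans he; rewrite lerDl exprn_ge0 // ltW.
Unshelve. all: by end_near. Qed.

End Classes.

(** * The sharp topology in terms of representatives *)

Section SharpTopology.
Context {R : realType} {rho : gauge R}.
Local Notation GR := (GR rho).
Local Notation cl := (@gclass R rho).
Local Notation moderate := (moderate rho).
Local Notation negligible := (Defs.negligible rho).
Local Notation vmoderate := (vmoderate (rho := rho)).
Local Notation gvec := (@gvec R rho _).

(** Closeness of order m for nets rather than classes, coordinate by coordinate; as there are
    finitely many coordinates, the range of e may depend on the coordinate. *)
Definition vclose n (x y : R -> 'rV[R]_n) (m : nat) :=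
  forall i, \forall e \near 0^'+, `|y e 0 i - x e 0 i| <= rho e ^+ m.

Lemma vclose_refl n (x : R -> 'rV[R]_n) m : vclose x x m.
Proof.
move=> i; move: (gauge_near01 rho); apply: filterS => e [_ r0 _].
by rewrite subrr normr0 exprn_ge0.
Qed.

Lemma vrepr_moderate n (a : 'rV[GR]_n) : vmoderate (vrepr a).
Proof. by case: (gvec_surj a). Qed.

Lemma vreprK n (a : 'rV[GR]_n) : gvec (vrepr a) = a.
Proof. by case: (gvec_surj a). Qed.

Lemma vmoderate_coord n (x : R -> 'rV[R]_n) i :
  vmoderate x -> moderate (fun e => x e 0 i).
Proof. by move/vmoderateP. Qed.

Lemma vrepr_coord n (a : 'rV[GR]_n) i : cl (fun e => vrepr a e 0 i) = a 0 i.
Proof. by rewrite -[in RHS](vreprK a) mxE. Qed.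

(** The additional power of rho pays for the n coordinates of the Euclidean norm, each counted twice
    because of the negligible gap between [w] and y - x, and for the margin required by a strict
    inequality: 2n + 1 terms in all. *)
Lemma gball_near n (x y : R -> 'rV[R]_n) (r : GR) m :
  vmoderate x -> vmoderate y ->
  (\forall e \near 0^'+, rho e ^+ m <= grepr r e) ->
  vclose x y m.+1 -> gball (gvec x) r (gvec y).
Proof.
move=> xm ym rm xy; rewrite /gball /= /gnorm -[X in glt _ X]greprK.
set w := vrepr (gvec y - gvec x); have wm : vmoderate w by exact: vrepr_moderate.
apply/glt_repP => //; first exact: grepr_moderate.
have wE i : negligible (fun e => w e 0 i - (y e 0 i - x e 0 i)).
  have dm : moderate (fun e => y e 0 i - x e 0 i).
    by apply: moderateD; [|apply: moderateN]; exact: vmoderate_coord.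
  apply: (proj1 (gclass_eq (vmoderate_coord i wm) dm)).
  by rewrite vrepr_coord !mxE gclassB //; exact: vmoderate_coord.
have key : \forall e \near 0^'+, forall i, `|w e 0 i| <= rho e ^+ m.+1 *+ 2.
  apply: filter_forall => i; near=> e.
  have h1 : `|w e 0 i - (y e 0 i - x e 0 i)| <= rho e ^+ m.+1.
    by near: e; move/negligible_netP : (wE i); exact.
  have h2 : `|y e 0 i - x e 0 i| <= rho e ^+ m.+1 by near: e; exact: xy.
  rewrite -[w e 0 i](subrK (y e 0 i - x e 0 i)).
  by rewrite (le_trans (ler_normD _ _)) // mulr2n lerD.
exists m.+1; near=> e.
have [r0 r0' r1] : [/\ 0 < rho e, 0 <= rho e & rho e <= 1].
  by near: e; exact: gauge_near01.
have rn : rho e <= (n.*2.+1%:R)^-1.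
  by apply: ltW; near: e; apply: gauge_near_lt; rewrite invr_gt0 ltr0n.
have keye : forall i, `|w e 0 i| <= rho e ^+ m.+1 *+ 2 by near: e.
apply: (@le_trans _ _ (rho e ^+ m)); last by near: e.
apply: (@le_trans _ _ (\sum_(i < n) rho e ^+ m.+1 *+ 2 + rho e ^+ m.+1)).
  by rewrite lerD2r (le_trans (enorm_le_sum _)) // ler_sum.
rewrite sumr_const card_ord -mulrnA mul2n -mulrSr exprS -mulrnAl.
rewrite ler_piMl ?exprn_ge0 // -mulr_natr -ler_pdivlMr ?ltr0n // div1r //.
Unshelve. all: by end_near. Qed.

Lemma gball_coord n (x y : R -> 'rV[R]_n) (r : R -> R) :
  vmoderate x -> vmoderate y -> moderate r ->
  gball (gvec x) (cl r) (gvec y) ->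
  forall i, \forall e \near 0^'+, `|y e 0 i - x e 0 i| <= r e.
Proof.
move=> xm ym rm; rewrite /gball /= /gnorm.
set w := vrepr (gvec y - gvec x); have wm : vmoderate w by exact: vrepr_moderate.
move=> /(glt_repP wm rm) [k wk] i.
have dm : moderate (fun e => y e 0 i - x e 0 i).
  by apply: moderateD; [|apply: moderateN]; exact: vmoderate_coord.
have wE : negligible (fun e => (y e 0 i - x e 0 i) - w e 0 i).
  apply: (proj1 (gclass_eq dm (vmoderate_coord i wm))).
  by rewrite vrepr_coord !mxE gclassB //; exact: vmoderate_coord.
near=> e.
have h1 : `|y e 0 i - x e 0 i - w e 0 i| <= rho e ^+ k.
  by near: e; move/negligible_netP : wE; exact.
have h2 : enorm (w e) + rho e ^+ k <= r e by near: e.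
rewrite -(subrK (w e 0 i) (y e 0 i - x e 0 i)) (le_trans (ler_normD _ _)) //.
by apply: le_trans h2; rewrite addrC lerD // ler_enorm.
Unshelve. all: by end_near. Qed.

Lemma gt0_gauge_le (r : GR) : glt 0 r ->
  exists m : nat, \forall e \near 0^'+, rho e ^+ m <= grepr r e.
Proof.
rewrite -gclass0 -{1}(greprK r).
move=> /(glt_repP (moderate_cst _ _) (grepr_moderate _)) [m h]; exists m.
by apply: filterS h => e /=; rewrite add0r.
Qed.

Lemma gt0_gaugeX m : glt 0 (cl (fun e => rho e ^+ m)).
Proof.
rewrite -gclass0; apply/glt_repP; [exact: moderate_cst|exact: moderate_gaugeX|].
by exists m; near=> e; rewrite /= add0r.
Unshelve. all: by end_near. Qed.

(** Every radius r > 0 dominates some power of rho, so the radii rho^m give a base of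
    neighbourhoods. *)
Lemma sharp_interiorP n (A : set 'rV[GR]_n) (x : R -> 'rV[R]_n) :
  vmoderate x ->
  sharp_interior A (gvec x) <->
  exists m : nat, forall y, vmoderate y -> vclose x y m -> A (gvec y).
Proof.
move=> xm; split=> [[r /gt0_gauge_le [m rm] h]|[m h]].
  by exists m.+1 => y ym xy; apply: h; exact: gball_near xy.
exists (cl (fun e => rho e ^+ m)); first exact: gt0_gaugeX.
move=> a; rewrite -(vreprK a) => h'; apply: h; first exact: vrepr_moderate.
exact: gball_coord xm (vrepr_moderate _) (moderate_gaugeX rho m) h'.
Qed.

Lemma sharp_limP n k (A : set 'rV[GR]_n) (g : 'rV[GR]_n -> 'rV[GR]_k)
    (x : R -> 'rV[R]_n) (v : R -> 'rV[R]_k) :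
  vmoderate x -> vmoderate v ->
  sharp_lim A g (gvec x) (gvec v) <->
  forall m : nat, exists p : nat, forall y, vmoderate y -> vclose x y p ->
    A (gvec y) -> forall w, is_vrep w (g (gvec y)) -> vclose v w m.
Proof.
move=> xm vm; split=> [h m|h r /gt0_gauge_le [m rm]].
  have [q /gt0_gauge_le [p qp] {}h] := h _ (gt0_gaugeX m).
  exists p.+1 => y ym xy Ay w [wm wE].
  apply: (gball_coord vm wm (moderate_gaugeX rho m)).
  by rewrite wE; apply: h => //; exact: gball_near xy.
have [p {}h] := h m.+1.
exists (cl (fun e => rho e ^+ p)); first exact: gt0_gaugeX.
move=> a Aa; rewrite -(vreprK a) => h'.
have am := vrepr_moderate a.
rewrite -(vreprK (g _)); apply: gball_near rm _ => //; first exact: vrepr_moderate.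
apply: (h (vrepr a)) => //; last exact: gvec_surj.
  exact: gball_coord xm am (moderate_gaugeX rho p) h'.
by rewrite vreprK.
Qed.

Lemma gvec_eqP n (x y : R -> 'rV[R]_n) : vmoderate x -> vmoderate y ->
  (gvec x = gvec y) <-> forall i, negligible (fun e => y e 0 i - x e 0 i).
Proof.
move=> xm ym; split=> [xy i|xy].
  apply: (proj1 (gclass_eq (vmoderate_coord i ym) (vmoderate_coord i xm))).
  by move: (congr1 (fun v : 'rV_n => v 0 i) xy); rewrite !mxE.
apply/rowP => i; rewrite !mxE; apply/esym.
by apply/gclass_eq; [exact: vmoderate_coord..|exact: xy].
Qed.

Lemma gvec_closeP n (x y : R -> 'rV[R]_n) : vmoderate x -> vmoderate y ->
  (gvec x = gvec y) <-> forall m, vclose x y m.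
Proof.
move=> xm ym; rewrite gvec_eqP //; split=> h.
  by move=> m i; move/negligible_netP : (h i); exact.
by move=> i; apply/negligible_netP => m; exact: h.
Qed.

Lemma vclose_moderate n (x y : R -> 'rV[R]_n) m :
  vmoderate x -> vclose x y m -> vmoderate y.
Proof.
move=> xm xy; apply/vmoderateP => i.
apply: (@moderate_near_le _ _ _ (fun e => `|x e 0 i| + 1)).
  apply: moderateD; last exact: moderate_cst.
  apply: (@moderate_near_le _ _ _ (fun e => x e 0 i)).
    exact: vmoderate_coord.
  by apply: filterE => e; rewrite normr_id.
near=> e.
have [r0 r0' r1] : [/\ 0 < rho e, 0 <= rho e & rho e <= 1].
  by near: e; exact: gauge_near01.
have h : `|y e 0 i - x e 0 i| <= rho e ^+ m by near: e; exact: xy.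
rewrite [leRHS]ger0_norm ?addr_ge0 // -[y e 0 i](subrK (x e 0 i)) addrC.
rewrite (le_trans (ler_normD _ _)) // lerD // (le_trans h) //.
by rewrite exprn_ile1.
Unshelve. all: by end_near. Qed.

(** The assumption that [A] has points arbitrarily close to [x] excludes the vacuous case, in which
    every value is a limit. Two errors rho^(m+1) fit under rho^m. *)
Lemma sharp_lim_unique n k (A : set 'rV[GR]_n) (g : 'rV[GR]_n -> 'rV[GR]_k)
    (x : R -> 'rV[R]_n) (v v' : 'rV[GR]_k) :
  vmoderate x ->
  (forall p, exists y, [/\ vmoderate y, vclose x y p & A (gvec y)]) ->
  sharp_lim A g (gvec x) v -> sharp_lim A g (gvec x) v' -> v = v'.
Proof.
move=> xm xA; rewrite -(vreprK v) -(vreprK v').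
have vm := vrepr_moderate v; have v'm := vrepr_moderate v'.
move=> /(sharp_limP _ _ xm vm) h /(sharp_limP _ _ xm v'm) h'.
apply/gvec_closeP => // m i.
have [p hp] := h m.+1; have [p' hp'] := h' m.+1.
have [y [ym xy Ay]] := xA (maxn p p').
have yp q : (q <= maxn p p')%N -> vclose x y q.
  move=> qpp j; near=> e; apply: (@le_trans _ _ (rho e ^+ maxn p p')).
    by near: e; exact: xy.
  by near: e; exact: gauge_near_leX.
have wP := gvec_surj (g (gvec y)).
have hw := hp y ym (yp _ (leq_maxl _ _)) Ay _ wP.
have hw' := hp' y ym (yp _ (leq_maxr _ _)) Ay _ wP.
set w := vrepr (g (gvec y)) in hw hw'.
near=> e.
have [r0 r0' r1] : [/\ 0 < rho e, 0 <= rho e & rho e <= 1].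
  by near: e; exact: gauge_near01.
have hv : `|w e 0 i - vrepr v e 0 i| <= rho e ^+ m.+1 by near: e; exact: hw.
have hv' : `|w e 0 i - vrepr v' e 0 i| <= rho e ^+ m.+1 by near: e; exact: hw'.
have rh : rho e <= 2^-1 by apply: ltW; near: e; apply: gauge_near_lt;
  rewrite invr_gt0.
have r2 : rho e ^+ m.+1 + rho e ^+ m.+1 <= rho e ^+ m.
  have := ler_wpM2r (exprn_ge0 m r0') rh; rewrite exprS; lra.
apply: le_trans r2; apply: le_trans (lerD hv hv').
rewrite (_ : vrepr v' e 0 i - vrepr v e 0 i =
  (w e 0 i - vrepr v e 0 i) - (w e 0 i - vrepr v' e 0 i)); last by ring.
exact: ler_normB.
Unshelve. all: by end_near. Qed.

End SharpTopology.

(** * Differential calculus on row vectors *)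

Section RowCalculus.
Context {R : realType}.
Local Notation δ i := (delta_mx 0 i).

(** A step h along v moves the inner map by exactly h w, so the two difference quotients are the
    same. *)
Lemma derive_affine (V W : normedModType R) n (f : V -> W) (g : 'rV[R]_n -> V) a v w :
  (forall h, g (h *: v + a) = h *: w + g a) ->
  'D_v (fun x => f (g x)) a = 'D_w f (g a).
Proof.
move=> gE; by rewrite /derive; under eq_fun do rewrite /= gE.
Qed.

Lemma differentiable_rV n k (g : 'rV[R]_n -> 'rV[R]_k) x :
  (forall j, differentiable (fun y => g y 0 j : R) x) -> differentiable g x.
Proof.
move=> gd; rewrite (_ : g = \sum_(j < k) (fun y => g y 0 j *: δ j)); last first.
  by apply/funext => y; rewrite fct_sumE [LHS]row_sum_delta.
by apply: differentiable_sum => j; exact: differentiableZl.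
Qed.

Lemma differentiable_row_coord n k (g : 'rV[R]_n -> 'rV[R]_k) x j :
  differentiable g x -> differentiable (fun y => g y 0 j : R) x.
Proof.
move=> gd; apply: (@differentiable_comp _ _ _ _ g (fun z : 'rV_k => z 0 j : R)) => //.
exact: differentiable_coord.
Qed.

Lemma derive_row_coord n k (g : 'rV[R]_n -> 'rV[R]_k) x v j :
  differentiable g x -> ('D_v g x) 0 j = 'D_v (fun y => g y 0 j : R) x.
Proof. by move=> gd; rewrite derive_mx ?mxE //; exact: diff_derivable. Qed.

Lemma derive_sum_delta n (f : 'rV[R]_n -> R) x v : differentiable f x ->
  'D_v f x = \sum_i v 0 i * 'D_(δ i) f x.
Proof.
move=> fd; rewrite deriveE // {1}[v]row_sum_delta linear_sum.
by apply: eq_bigr => i _; rewrite linearZ deriveE.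
Qed.

Lemma differentiable_chain n k (f : 'rV[R]_k -> R) (g : 'rV[R]_n -> 'rV[R]_k) x :
  differentiable f (g x) -> (forall j, differentiable (fun y => g y 0 j : R) x) ->
  differentiable (fun y => f (g y)) x.
Proof.
by move=> fd gd; apply: differentiable_comp => //; exact: differentiable_rV.
Qed.

Lemma derive_chain n k (f : 'rV[R]_k -> R) (g : 'rV[R]_n -> 'rV[R]_k) x v :
  differentiable f (g x) -> (forall j, differentiable (fun y => g y 0 j : R) x) ->
  'D_v (fun y => f (g y)) x =
  \sum_j 'D_(δ j) f (g x) * 'D_v (fun y => g y 0 j) x.
Proof.
move=> fd gd; have gdx := differentiable_rV gd.
rewrite deriveE; last exact: differentiable_chain.
rewrite (@diff_comp _ _ _ _ g f) //= -(deriveE v gdx) -(deriveE _ fd).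
rewrite derive_sum_delta //; apply: eq_bigr => j _.
by rewrite derive_row_coord // mulrC.
Qed.

Lemma derive_mvt n (f : 'rV[R]_n -> R) x v (h : R) : 0 <= h ->
  (forall t, 0 <= t <= h -> differentiable f (x + t *: v)) ->
  exists2 t, 0 <= t <= h & f (x + h *: v) - f x = h * 'D_v f (x + t *: v).
Proof.
move=> h0 fd.
pose phi (t : R) := f (x + t *: v).
have phid t : 0 <= t <= h -> is_derive t 1 phi ('D_v f (x + t *: v)).
  move=> th; have phid : differentiable phi t.
    apply: (@differentiable_comp _ _ _ _ (fun s : R => x + s *: v)) => //.
    exact: fd.
  apply: DeriveDef; first exact/derivable1_diffP.
  rewrite /derive /phi; under eq_fun do rewrite /= [_ *: 1]mulr1 scalerDl addrCA.
  by [].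
have [t||t] := @MVT_segment R phi (fun t => 'D_v f (x + t *: v)) 0 h h0.
- by rewrite in_itv /= => /andP[t0 th]; apply: phid; rewrite !ltW.
- apply: derivable_within_continuous => t; rewrite in_itv /= => th.
  by case: (phid t th).
- rewrite in_itv /= => th; rewrite /phi scale0r addr0 subr0 mulrC => E.
  by exists t.
Qed.

Lemma segment_mvt n (f : 'rV[R]_n -> R) x y :
  (forall t, 0 <= t <= 1 -> differentiable f (x + t *: (y - x))) ->
  exists2 t, 0 <= t <= 1 &
    f y - f x = \sum_i (y 0 i - x 0 i) * 'D_(δ i) f (x + t *: (y - x)).
Proof.
move=> fd; have [t th] := derive_mvt ler01 fd.
rewrite scale1r subrKC mul1r derive_sum_delta; last exact: fd.
move=> E; exists t => //; rewrite E; apply: eq_bigr => i _.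
by rewrite !mxE.
Qed.

(** The mean value theorem twice: in the direction v for g(z) = f(z + h w) - f(z), then in the
    direction w for the derivative of f along v. *)
Lemma second_difference n (f : 'rV[R]_n -> R) x v w (h : R) : 0 <= h ->
  (forall s t, 0 <= s <= h -> 0 <= t <= h ->
    differentiable f (x + s *: v + t *: w) /\
    differentiable ('D_v f) (x + s *: v + t *: w)) ->
  exists s t, [/\ 0 <= s <= h, 0 <= t <= h &
    f (x + h *: v + h *: w) - f (x + h *: v) - (f (x + h *: w) - f x) =
    h * (h * 'D_w ('D_v f) (x + s *: v + t *: w))].
Proof.
move=> h0 fd; pose g z := f (z + h *: w) - f z.
have hh : 0 <= h <= h by rewrite h0 lexx.
have h00 : 0 <= (0 : R) <= h by rewrite lexx h0.
have sd z : differentiable f (z + h *: w) ->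
  differentiable (fun z => f (z + h *: w)) z.
  move=> fz; apply: (@differentiable_comp _ _ _ _ (fun z => z + h *: w)) => //.
have fd0 s : 0 <= s <= h -> differentiable f (x + s *: v).
  by move=> sh; have [] := fd s 0 sh h00; rewrite scale0r addr0.
have gd s : 0 <= s <= h -> differentiable g (x + s *: v).
  move=> sh; apply: differentiableB; last exact: fd0.
  by apply: sd; have [] := fd s h sh hh.
have [s sh E] := derive_mvt h0 gd.
have [|t th E'] := @derive_mvt _ ('D_v f) (x + s *: v) w h h0.
  by move=> t th; have [] := fd s t sh th.
exists s, t; split=> //.
rewrite -E' -[LHS](_ : g (x + h *: v) - g x = _); last by rewrite /g; ring.
rewrite E; congr (_ * _).
have d1 : derivable (fun z => f (z + h *: w)) (x + s *: v) v.
  by apply: diff_derivable; apply: sd; have [] := fd s h sh hh.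
rewrite (deriveB d1); last by apply: diff_derivable; exact: fd0.
congr (_ - _).
apply: (@derive_affine _ _ _ f (fun z => z + h *: w)) => r.
exact: esym (addrA _ _ _).
Qed.

Lemma dist_half (A B C D e : R) :
  A = B -> `|C - A| <= e / 2 -> `|D - B| <= e / 2 -> `|C - D| <= e.
Proof.
move=> <-; rewrite !ler_norml => /andP[? ?] /andP[? ?]; apply/andP; split; lra.
Qed.

(* Both mixed derivatives are limits of the same second difference quotient. *)
Lemma derive_comm n (f : 'rV[R]_n -> R) x v w :
  (\forall z \near x, [/\ differentiable f z, differentiable ('D_v f) z &
     differentiable ('D_w f) z]) ->
  {for x, continuous ('D_w ('D_v f))} -> {for x, continuous ('D_v ('D_w f))} ->
  'D_w ('D_v f) x = 'D_v ('D_w f) x.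
Proof.
move=> fd c1 c2; apply/eqP; rewrite -subr_eq0 -normr_le0; apply/ler_addgt0Pr => e e0.
rewrite add0r.
have e20 : 0 < e / 2 by rewrite divr_gt0.
have /nbhs_ballP [r /= r0 rP] : \forall z \near x,
    [/\ differentiable f z, differentiable ('D_v f) z & differentiable ('D_w f) z] /\
    `|'D_w ('D_v f) x - 'D_w ('D_v f) z| <= e / 2 /\
    `|'D_v ('D_w f) x - 'D_v ('D_w f) z| <= e / 2.
  have h1 : \forall z \near x, `|'D_w ('D_v f) x - 'D_w ('D_v f) z| <= e / 2.
    by move/cvgrPdist_le : c1 => /(_ _ e20).
  have h2 : \forall z \near x, `|'D_v ('D_w f) x - 'D_v ('D_w f) z| <= e / 2.
    by move/cvgrPdist_le : c2 => /(_ _ e20).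
  by apply: filterS3 fd h1 h2.
(* The summand 1 keeps [M] positive; with h = r / (2 M) all points x + s v + t w with s, t in [0, h]
   stay in the ball of radius r. *)
pose M := `|v| + `|w| + 1.
have M0 : 0 < M by rewrite ltr_wpDl // addr_ge0.
pose h := r / 2 / M.
have h0 : 0 < h by rewrite !divr_gt0.
have hM : h * M < r by rewrite /h divfK ?gt_eqF // ltr_pdivrMr // ltr_pMr // ltr1n.
have inb s t : 0 <= s <= h -> 0 <= t <= h -> ball x r (x + s *: v + t *: w).
  move=> /andP[s0 sh] /andP[t0 th].
  rewrite -ball_normE /= -addrA opprD addNKr normrN.
  rewrite (le_lt_trans (ler_normD _ _)) // !normrZ !ger0_norm //.
  apply: le_lt_trans hM; rewrite /M !mulrDr mulr1.
  by rewrite -addrA lerD ?ler_wpM2r // (le_trans _ (_ : h * `|w| <= _)) ?lerDl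
    ?ler_wpM2r // ltW.
have [|s [t [sh th E]]] := @second_difference _ f x v w h (ltW h0).
  by move=> s t sh th; have [[]] := rP _ (inb s t sh th).
have [|t' [s' [th' sh' E']]] := @second_difference _ f x w v h (ltW h0).
  by move=> p q ph qh; rewrite addrAC; have [[]] := rP _ (inb q p qh ph).
have {}E : 'D_w ('D_v f) (x + s *: v + t *: w) =
  'D_v ('D_w f) (x + s' *: v + t' *: w).
  have hn0 : h != 0 by rewrite gt_eqF.
  have swap (A B C D : R) : A - B - (C - D) = A - C - (B - D) by ring.
  have p1 : x + h *: w + h *: v = x + h *: v + h *: w by exact: addrAC.
  have p2 : x + t' *: w + s' *: v = x + s' *: v + t' *: w by exact: addrAC.
  rewrite p1 p2 in E'.
  by apply: (mulfI hn0); apply: (mulfI hn0);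
    exact: etrans (esym E) (etrans (swap _ _ _ _) E').
have [_ [p1 _]] := rP _ (inb s t sh th).
have [_ [_ p2]] := rP _ (inb s' t' sh' th').
exact: dist_half E p1 p2.
Qed.

Lemma open_preimage_in (V W : normedModType R) (U : set V) (A : set W) (g : V -> W) :
  open U -> open A -> (forall x, U x -> {for x, continuous g}) ->
  open (U `&` g @^-1` A).
Proof.
rewrite !openE => Uo Ao gc x [Ux Agx].
by apply: filterI; [exact: Uo|apply: (gc x Ux); exact: Ao].
Qed.

Fixpoint spartial n (w : seq 'I_n) (f : 'rV[R]_n -> R) : 'rV[R]_n -> R :=
  if w is i :: w' then (fun x => 'D_(δ i) (spartial w' f) x) else f.

Lemma spartial_rcons n (w : seq 'I_n) i (f : 'rV[R]_n -> R) :
  spartial (rcons w i) f = spartial w (fun x => 'D_(δ i) f x).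
Proof. by elim: w => //= j w ->. Qed.

Lemma open_near (V : topologicalType) (U : set V) (P : V -> Prop) x : open U ->
  U x -> (forall y, U y -> P y) -> \forall y \near x, P y.
Proof. by rewrite openE => Uo Ux UP; exact: filterS (Uo _ Ux). Qed.

Lemma partial_coord n k (f : 'rV[R]_n -> 'rV[R]_k) (U : set 'rV[R]_n) w j x :
  open U -> smooth_on U f -> U x ->
  partial w f x 0 j = spartial w (fun y => f y 0 j) x.
Proof.
move=> Uo fs; elim: w x => [//|i w IH] x Ux /=.
rewrite derive_row_coord; last exact: fs.
by apply: near_eq_derive; apply: (open_near Uo Ux) => y Uy; exact: IH.
Qed.

(** Serves to carry differentiability across a local equality: the difference of the two functions
    vanishes near the point, hence has the differential 0 there. *)
Lemma differentiable_near0 (V W : normedModType R) (h : V -> W) (x : V) :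
  (\forall y \near x, h y = 0) -> differentiable h x.
Proof.
move=> h0.
have hx : h x = 0 by exact: nbhs_singleton h0.
have E : h \o shift x = cst (h x) + (0 : V -> W) +o_ (0 : V) id.
  apply/eqaddoP => _ /posnumP[e]; near=> y.
  rewrite /= -[X in `|X|]/(h (y + x) - (h x + 0)) hx addr0 subr0.
  rewrite (_ : h (y + x) = 0) ?normr0 ?mulr_ge0 //.
  by near: y; move: h0; rewrite (near_shift 0) subr0.
have c0 : continuous (0 : V -> W) by exact: cst_continuous.
apply/diff_locallyP; rewrite (diff_unique c0 E); split => //.
Unshelve. all: by end_near. Qed.

Lemma differentiable_near_eq n (f g : 'rV[R]_n -> R) x :
  (\forall y \near x, f y = g y) -> differentiable f x -> differentiable g x.
Proof.
move=> fg fd; rewrite -(subrK f g); apply: differentiableD => //.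
by apply: differentiable_near0; apply: filterS fg => y fy;
  rewrite -[LHS]/(g y - f y) fy subrr.
Qed.

End RowCalculus.

(** * Nets of smooth functions with moderate derivatives *)

Section TameNets.
Context {R : realType} {rho : gauge R}.
Local Notation GR := (GR rho).
Local Notation moderate := (moderate rho).
Local Notation vmoderate := (vmoderate (rho := rho)).
Local Notation gvec := (@gvec R rho _).
Local Notation δ i := (delta_mx 0 i).

Definition nets n (X : set 'rV[GR]_n) : set (R -> 'rV[R]_n) :=
  [set x | vmoderate x /\ X (gvec x)].

Definition gdom n (X : set 'rV[GR]_n) (U : R -> set 'rV[R]_n) :=
  (forall e, 0 < e <= 1 -> open (U e)) /\ X `<=` strong_int U.

Definition pd n (i : 'I_n) (f : R -> 'rV[R]_n -> R) : R -> 'rV[R]_n -> R :=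
  fun e x => 'D_(δ i) (f e) x.

(* Differentiating first and recursing on [pd i f], rather than on the outermost
   derivative, makes the closure under products, inverses and composition a
   plain induction on [m]. *)
Fixpoint tame m n (X : set 'rV[GR]_n) (U : R -> set 'rV[R]_n)
    (f : R -> 'rV[R]_n -> R) : Prop :=
  [/\ forall e x, 0 < e <= 1 -> U e x -> differentiable (f e) x,
      forall x, nets X x -> moderate (fun e => f e (x e)) &
      if m is m'.+1 then forall i, tame m' X U (pd i f) else True].

Lemma gdom_near n (X : set 'rV[GR]_n) U x : gdom X U -> nets X x ->
  \forall e \near 0^'+, U e (x e).
Proof. by move=> [_ XU] [xm xX]; exact: (XU _ xX x). Qed.

Section Fixed.
Variables (n : nat) (X : set 'rV[GR]_n) (U : R -> set 'rV[R]_n).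
Implicit Types f g : R -> 'rV[R]_n -> R.

Lemma tame_diff m f : tame m X U f ->
  forall e x, 0 < e <= 1 -> U e x -> differentiable (f e) x.
Proof. by case: m => [|m] []. Qed.

Lemma tame_moderate m f : tame m X U f ->
  forall x, nets X x -> moderate (fun e => f e (x e)).
Proof. by case: m => [|m] []. Qed.

Lemma tame_pd m f i : tame m.+1 X U f -> tame m X U (pd i f).
Proof. by move=> [_ _]; exact. Qed.

Lemma tameW m f : tame m.+1 X U f -> tame m X U f.
Proof.
elim: m f => [|m IH] f [fd fm ft]; split=> //.
by move=> i; apply: IH; exact: ft.
Qed.

Hypothesis XU : gdom X U.

(** As [U e] is open, equality on it is equality near each of its points and passes to the
    derivatives. *)
Lemma tame_eq m f g : (forall e x, 0 < e <= 1 -> U e x -> f e x = g e x) ->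
  tame m X U f -> tame m X U g.
Proof.
elim: m f g => [|m IH] f g fg ft; have fd := tame_diff ft;
  have fm := tame_moderate ft.
all: have fgn e x : 0 < e <= 1 -> U e x -> \forall y \near x, f e y = g e y
  by move=> e1 Ux; apply: (open_near (XU.1 e e1) Ux) => y; exact: fg.
all: have gd e x : 0 < e <= 1 -> U e x -> differentiable (g e) x
  by move=> e1 Ux; exact: differentiable_near_eq (fgn e x e1 Ux) (fd e x e1 Ux).
all: have gm x : nets X x -> moderate (fun e => g e (x e))
  by (move=> Xx; apply: moderate_near_eq (fm x Xx) _;
      apply: filterS2 near_index (gdom_near XU Xx) => e; exact: fg).
  by [].
split=> // i; apply: IH (tame_pd i ft) => e x e1 Ux.
exact: near_eq_derive (fgn e x e1 Ux).
Qed.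

Lemma tame_cst m c : moderate c -> tame m X U (fun e _ => c e).
Proof.
elim: m c => [|m IH] c cm.
  by split.
split=> // i.
apply: (@tame_eq _ (fun e _ => 0)); last by apply: IH; exact: moderate_cst.
by move=> e x _ _; rewrite /pd derive_cst.
Qed.

Lemma tame_coord m i : tame m X U (fun _ x => x 0 i).
Proof.
have hm x : nets X x -> moderate (fun e => x e 0 i).
  by move=> [xm _]; exact: vmoderate_coord.
case: m => [|m]; first by split=> // e x _ _; exact: differentiable_coord.
split=> // [e x _ _|j]; first exact: differentiable_coord.
apply: (@tame_eq _ (fun _ _ => (j == i)%:R)); last first.
  by apply: tame_cst; exact: moderate_cst.
move=> e x _ _; rewrite /pd -(derive_row_coord (g := id)) //.
by rewrite derive_id mxE eqxx eq_sym.
Qed.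

Lemma tameD m f g : tame m X U f -> tame m X U g ->
  tame m X U (fun e x => f e x + g e x).
Proof.
elim: m f g => [|m IH] f g ft gt;
  have fd := tame_diff ft; have fm := tame_moderate ft;
  have gd := tame_diff gt; have gm := tame_moderate gt.
all: have hd e x : 0 < e <= 1 -> U e x -> differentiable (fun x => f e x + g e x) x
  by move=> e1 Ux; apply: differentiableD; [exact: fd|exact: gd].
all: have hm x : nets X x -> moderate (fun e => f e (x e) + g e (x e))
  by move=> Xx; apply: moderateD; [exact: fm|exact: gm].
  by [].
split=> // i; apply: tame_eq (IH _ _ (tame_pd i ft) (tame_pd i gt)) => e x e1 Ux.
rewrite /pd [RHS](@deriveD _ _ _ (f e) (g e)) //; apply: diff_derivable;
  [exact: fd|exact: gd].
Qed.

Lemma tame_sum m (I : finType) (f : I -> R -> 'rV[R]_n -> R) :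
  (forall j, tame m X U (f j)) -> tame m X U (fun e x => \sum_j f j e x).
Proof.
move=> ft; elim: (index_enum I) => [|j s IH].
  under eq_fun => e do under eq_fun => x do rewrite big_nil.
  by apply: tame_cst; exact: moderate_cst.
under eq_fun => e do under eq_fun => x do rewrite big_cons.
exact: tameD.
Qed.

Lemma derive_mulE (f g : 'rV[R]_n -> R) x v :
  differentiable f x -> differentiable g x ->
  'D_v (fun y => f y * g y) x = f x * 'D_v g x + g x * 'D_v f x.
Proof. by move=> fd gd; rewrite [LHS](@deriveM _ _ f g) //;
  exact: diff_derivable. Qed.

Lemma tameM m f g : tame m X U f -> tame m X U g ->
  tame m X U (fun e x => f e x * g e x).
Proof.
elim: m f g => [|m IH] f g ft gt;
  have fd := tame_diff ft; have fm := tame_moderate ft;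
  have gd := tame_diff gt; have gm := tame_moderate gt.
all: have hd e x : 0 < e <= 1 -> U e x -> differentiable (fun x => f e x * g e x) x
  by move=> e1 Ux; apply: differentiableM; [exact: fd|exact: gd].
all: have hm x : nets X x -> moderate (fun e => f e (x e) * g e (x e))
  by move=> Xx; apply: moderateM; [exact: fm|exact: gm].
  by [].
split=> // i.
have h := tameD (IH _ _ (tameW ft) (tame_pd i gt)) (IH _ _ (tameW gt) (tame_pd i ft)).
apply: tame_eq h => e x e1 Ux.
by rewrite /pd derive_mulE //; [exact: fd|exact: gd].
Qed.

(** Written with 1/f itself as a factor, so that the induction hypothesis of [tameV] and the closure
    under products give one derivative more. *)
Lemma derive_invE (f : 'rV[R]_n -> R) x v :
  differentiable f x -> f x != 0 ->
  'D_v (fun y => (f y)^-1) x = - 1 * ((f x)^-1 * ((f x)^-1 * 'D_v f x)).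
Proof.
move=> fd f0; rewrite [LHS](@deriveV _ _ f) //; last exact: diff_derivable.
by rewrite -[LHS]/(- f x ^- 2 * _) mulN1r mulNr mulrA -invfM -expr2.
Qed.

Lemma tameV m f : tame m X U f -> (forall e x, 0 < e <= 1 -> U e x -> f e x != 0) ->
  (forall x, nets X x -> moderate (fun e => (f e (x e))^-1)) ->
  tame m X U (fun e x => (f e x)^-1).
Proof.
move=> ft f0 hm; elim: m ft => [|m IH] ft; have fd := tame_diff ft.
all: have hd e x : 0 < e <= 1 -> U e x -> differentiable (fun x => (f e x)^-1) x
  by move=> e1 Ux; apply: differentiableV; [exact: fd|exact: f0].
  by [].
split=> // i; have ht := IH (tameW ft).
have h := tameM (tame_cst m (moderate_cst rho (-1))) (tameM ht (tameM ht (tame_pd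
  i ft))).
apply: tame_eq h => e x e1 Ux.
by rewrite /pd derive_invE //; [exact: fd|exact: f0].
Qed.

End Fixed.

(** The inner map must send [U e] into [V e] at every index, not only for e small, since [tame] asks
    for differentiability at every index. This is why domains are repeatedly cut down to preimages
    later on. *)
Lemma tame_comp m n k (X : set 'rV[GR]_n) U (Y : set 'rV[GR]_k) V f
    (g : R -> 'rV[R]_n -> 'rV[R]_k) : gdom X U ->
  (forall e x, 0 < e <= 1 -> U e x -> V e (g e x)) ->
  (forall x, nets X x -> nets Y (fun e => g e (x e))) ->
  tame m Y V f -> (forall j, tame m X U (fun e x => g e x 0 j)) ->
  tame m X U (fun e x => f e (g e x)).
Proof.
move=> XU UV XY; elim: m f => [|m IH] f ft gt;
  have fd := tame_diff ft; have fm := tame_moderate ft.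
all: have gd e x : 0 < e <= 1 -> U e x -> forall j,
  differentiable (fun x => g e x 0 j : R) x
  by move=> e1 Ux j; exact: (tame_diff (gt j)).
all: have hd e x : 0 < e <= 1 -> U e x -> differentiable (fun x => f e (g e x)) x
  by move=> e1 Ux; apply: differentiable_chain; [apply: fd => //;
    exact: UV|exact: gd].
all: have hm x : nets X x -> moderate (fun e => f e (g e (x e)))
  by move=> Xx; exact: fm (XY x Xx).
  by [].
split=> // i.
have h : tame m X U (fun e x => \sum_j pd j f e (g e x) * pd i (fun e x =>
  g e x 0 j) e x).
  apply: tame_sum => // j; apply: tameM => //; last exact: tame_pd.
  by apply: IH => [|j']; [exact: tame_pd|exact: tameW].
apply: tame_eq h => // e x e1 Ux.
by rewrite [RHS]/pd derive_chain //; [apply: fd => //; exact: UV|exact: gd].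
Qed.

End TameNets.

(** * Uniform bounds from bounds along nets *)

Section Uniformity.
Context {R : realType} {rho : gauge R}.
Local Notation moderate := (moderate rho).

(* A selected counterexample net replaces a compactness argument. *)
Lemma near_forall_selection (T : Type) (t0 : T) (K B : R -> set T) :
  (\forall e \near 0^'+, K e !=set0) ->
  (forall y : R -> T, (\forall e \near 0^'+, K e (y e)) ->
     \forall e \near 0^'+, B e (y e)) ->
  \forall e \near 0^'+, K e `<=` B e.
Proof.
move=> K0 KB.
have /choice [y yP] : forall e, exists y, K e !=set0 ->
    K e y /\ (B e y -> K e `<=` B e).
  move=> e; case: (pselect (exists2 t, K e t & ~ B e t)) => [[t Kt nBt]|h].
    by exists t => _; split.
  case: (pselect (K e !=set0)) => [[t Kt]|]; last by exists t0.
  exists t => _; split => // _ s Ks; apply: contrapT => nBs.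
  by apply: h; exists s.
have Ky : \forall e \near 0^'+, K e (y e) by apply: filterS K0 => e /yP [].
by apply: filterS2 (KB y Ky) K0 => e By /yP [_]; exact.
Qed.

(* The selected net picks, at each e, a point where g fails the bound with the
   largest possible exponent below 1/e. *)
Lemma uniform_moderate (T : Type) (t0 : T) (K : R -> set T) (g : R -> T -> R) :
  (\forall e \near 0^'+, K e !=set0) ->
  (forall y : R -> T, (\forall e \near 0^'+, K e (y e)) ->
     moderate (fun e => g e (y e))) ->
  exists N : nat, \forall e \near 0^'+, forall t, K e t -> `|g e t| * rho e ^+ N <= 1.
Proof.
move=> K0 Kg.
pose Q e (n : nat) := `[< exists2 t, K e t & 1 < `|g e t| * rho e ^+ n >].
(* The cap leaves finitely many failing exponents, so that there is a largest one; it grows without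
   bound as e tends to 0 and thus eventually admits any fixed exponent. *)
pose k e := Num.bound (e^-1 : R).
have /choice [y yP] : forall e, exists y, K e !=set0 ->
    K e y /\ forall n, (n <= k e)%N -> Q e n ->
      exists2 n', (n <= n')%N & 1 < `|g e y| * rho e ^+ n'.
  move=> e; case: (pselect (exists n, (n <= k e)%N && Q e n)) => [h|h].
    have kb n : (n <= k e)%N && Q e n -> (n <= k e)%N by case/andP.
    have [n' /andP[nk /asboolP[t Kt gt]] nmax] := ex_maxnP h kb.
    exists t => _; split => // n nke Qn; exists n' => //.
    by apply: nmax; rewrite nke.
  case: (pselect (K e !=set0)) => [[t Kt]|]; last by exists t0.
  exists t => _; split => // n nk Qn; exfalso; apply: h.
  by exists n; rewrite nk.
have Ky : \forall e \near 0^'+, K e (y e) by apply: filterS K0 => e /yP [].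
have /moderate_netP [N hN] := Kg y Ky.
exists N; near=> e => t Kt.
have [r0 r0' r1] : [/\ 0 < rho e, 0 <= rho e & rho e <= 1].
  by near: e; exact: gauge_near01.
have e0 : 0 < e by near: e; exact: nbhs_right_gt.
have eN : e < (N%:R + 1)^-1.
  by near: e; apply: nbhs_right_lt; rewrite invr_gt0 ltr_wpDl.
have gN : `|g e (y e)| * rho e ^+ N <= 1 by near: e.
rewrite leNgt; apply/negP => gt.
have Nk : (N <= k e)%N.
  rewrite -(ler_nat R); apply: (@le_trans _ _ e^-1).
    rewrite ltW // (@lt_trans _ _ (N%:R + 1)) ?ltrDl //.
    by rewrite -[ltLHS]invrK ltf_pV2 ?posrE ?invr_gt0 ?ltr_wpDl.
  by apply/ltW/archi_boundP; rewrite invr_ge0 ltW.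
have [|_ /(_ N Nk)] := yP e; first by exists t.
case; first by apply/asboolP; exists t.
move=> n' Nn' h; move: gN; rewrite leNgt => /negP; apply; apply: lt_le_trans h _.
by rewrite ler_wpM2l // ler_wiXn2l.
Unshelve. all: by end_near. Qed.

End Uniformity.

(** * Scalar nets of smooth functions and generalized smooth functions *)

Section GermsOfGSF.
Context {R : realType} {rho : gauge R}.
Local Notation GR := (GR rho).
Local Notation moderate := (moderate rho).
Local Notation negligible := (Defs.negligible rho).
Local Notation vmoderate := (vmoderate (rho := rho)).
Local Notation gvec := (@gvec R rho _).
Local Notation δ i := (delta_mx 0 i).

Definition gsmooth n (X : set 'rV[GR]_n) U (f : R -> 'rV[R]_n -> R) :=
  forall m, tame m X U f.

Lemma gsmooth_pd n (X : set 'rV[GR]_n) U f i :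
  gsmooth X U f -> gsmooth X U (pd i f).
Proof. by move=> ft m; exact: tame_pd (ft m.+1). Qed.

(** Reconciles two orders of recursion: [tame] splits off the derivative taken first, [spartial] and
    [partial] the one taken last. *)
Lemma gsmoothP n (X : set 'rV[GR]_n) U f :
  gsmooth X U f <->
  (forall w e x, 0 < e <= 1 -> U e x -> differentiable (spartial w (f e)) x) /\
  (forall w x, nets X x -> moderate (fun e => spartial w (f e) (x e))).
Proof.
split=> [ft|[fd fm] m].
  suff h w : (forall e x, 0 < e <= 1 -> U e x -> differentiable (spartial w (f e)) x)
      /\ (forall x, nets X x -> moderate (fun e => spartial w (f e) (x e))).
    by split=> w; have [] := h w.
  elim/last_ind: w f ft => [|w i IH] f ft.
    by split; [exact: tame_diff (ft 0%N)|exact: tame_moderate (ft 0%N)].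
  have [h1 h2] := IH _ (gsmooth_pd i ft).
  split=> [e x e1 Ux|x Xx]; first by rewrite spartial_rcons; exact: h1.
  under eq_fun do rewrite spartial_rcons.
  exact: h2.
elim: m f fd fm => [|m IH] f fd fm; split=> //.
- exact: fd [::].
- exact: fm [::].
- exact: fd [::].
- exact: fm [::].
move=> i; apply: IH => [w e x e1 Ux|w x Xx].
  by rewrite -spartial_rcons; exact: fd.
have := fm (rcons w i) x Xx; under eq_fun do rewrite spartial_rcons.
by [].
Qed.

Lemma near_partial_coord n k (X : set 'rV[GR]_n) U (fe : R -> 'rV[R]_n ->
  'rV[R]_k) w j x :
  gdom X U -> (forall e, 0 < e <= 1 -> smooth_on (U e) (fe e)) -> nets X x ->
  \forall e \near 0^'+, partial w (fe e) (x e) 0 j = spartial w (fun y =>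
    fe e y 0 j) (x e).
Proof.
move=> XU fs Xx; apply: filterS2 near_index (gdom_near XU Xx) => e e1 Ux.
by apply: partial_coord Ux; [exact: (XU.1 e e1)|exact: fs].
Qed.

Lemma defined_by_gdom n k (X : set 'rV[GR]_n) f U (fe : R -> 'rV[R]_n -> 'rV[R]_k) :
  defined_by X f U fe -> gdom X U.
Proof. by move=> [Uo XU _ _]; split=> // e /Uo []. Qed.

Lemma defined_by_gsmooth n k (X : set 'rV[GR]_n) f U (fe : R -> 'rV[R]_n ->
  'rV[R]_k) j :
  defined_by X f U fe -> gsmooth X U (fun e x => fe e x 0 j).
Proof.
move=> Xf; have XU := defined_by_gdom Xf; have [Uo _ _ fm] := Xf.
apply/gsmoothP; split=> [w e x e1 Ux|w x Xx].
  have [Ueo fs] := Uo e e1.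
  apply: (@differentiable_near_eq _ _ (fun y => partial w (fe e) y 0 j)).
    by apply: (open_near Ueo Ux) => y Uy; exact: partial_coord Uy.
  by apply: differentiable_row_coord; exact: fs.
apply: moderate_near_eq (near_partial_coord w j XU _ Xx); last first.
  by move=> e /Uo [].
by apply: vmoderate_coord; apply: fm (proj2 Xx) _; have [xm _] := Xx.
Qed.

Lemma defined_by_val n k (X : set 'rV[GR]_n) f U (fe : R -> 'rV[R]_n -> 'rV[R]_k) x :
  defined_by X f U fe -> nets X x ->
  vmoderate (fun e => fe e (x e)) /\ f (gvec x) = gvec (fun e => fe e (x e)).
Proof. by move=> [_ _ fv _] [xm xX]; have [] := fv _ _ xX (conj xm erefl). Qed.

Lemma gsmooth_defined_by n k (X : set 'rV[GR]_n) f U (fe : R -> 'rV[R]_n ->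
  'rV[R]_k) :
  gdom X U -> (forall j, gsmooth X U (fun e x => fe e x 0 j)) ->
  (forall x, nets X x -> f (gvec x) = gvec (fun e => fe e (x e))) ->
  defined_by X f U fe.
Proof.
move=> XU ft fE.
have fP j := proj1 (gsmoothP _ _ _) (ft j).
have fs e : 0 < e <= 1 -> smooth_on (U e) (fe e).
  move=> e1 w.
  (* Both claims go through one induction: a further derivative can be read coordinatewise only once
     the preceding one is known to be differentiable. *)
  suff h x : U e x ->
      (forall j, partial w (fe e) x 0 j = spartial w (fun y => fe e y 0 j) x) /\
      differentiable (partial w (fe e)) x by move=> x /h [].
  have Ueo := XU.1 e e1.
  elim: w x => [|i w IH] x Ux; first split => //.
    by apply: differentiable_rV => j; have [fd _] := fP j; exact: (fd [::]).
  have E y j : U e y ->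
      partial (i :: w) (fe e) y 0 j = spartial (i :: w) (fun y => fe e y 0 j) y.
    move=> Uy /=; have [_ dy] := IH y Uy.
    rewrite derive_row_coord //; apply: near_eq_derive.
    by apply: (open_near Ueo Uy) => z /IH [].
  split=> [j|]; first exact: E.
  apply: differentiable_rV => j; have [fd _] := fP j.
  apply: differentiable_near_eq (fd (i :: w) e x e1 Ux).
  by apply: (open_near Ueo Ux) => y Uy; rewrite E.
split=> [e e1|||].
- by split; [exact: (XU.1 e e1)|exact: fs].
- by have [] := XU.
- move=> a x Xa [xm xE]; rewrite -xE in Xa *.
  split; last exact/esym/fE.
  by apply/vmoderateP => j; exact: tame_moderate (ft j 0%N) x (conj xm Xa).
- move=> a x w Xa [xm xE]; rewrite -xE in Xa.
  apply/vmoderateP => j; have [_ fm] := fP j.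
  have xX : nets X x by [].
  apply: moderate_near_eq (fm w x xX) _.
  by apply: filterS (near_partial_coord w j XU fs xX) => e ->.
Qed.

(* With h = rho^k, one has |f'(0)| <= |f(h) - f(0)| / h + h sup |f''|. *)
Lemma negligible_pd n (X : set 'rV[GR]_n) U f i x m : gdom X U -> tame 2 X U f ->
  vmoderate x ->
  (forall c : R -> R, (\forall e \near 0^'+, `|c e| <= rho e ^+ m) ->
     X (gvec (fun e => x e + c e *: δ i)) /\
     negligible (fun e => f e (x e + c e *: δ i))) ->
  negligible (fun e => pd i f e (x e)).
Proof.
move=> XU ft xm xc.
pose K e : set R := [set c | `|c| <= rho e ^+ m].
have K0 : \forall e \near 0^'+, K e !=set0.
  by near=> e; exists 0; rewrite /K /= normr0 exprn_ge0 //;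
    near: e; apply: filterS (gauge_near01 rho) => e [].
have xcm c : (\forall e \near 0^'+, K e (c e)) -> nets X (fun e => x e + c e *: δ i).
  move=> Kc; have [Xc _] := xc c Kc; split => //.
  apply: (vclose_moderate xm (m := m)) => j; apply: filterS Kc => e Kce.
  rewrite !mxE addrAC subrr add0r normrM.
  by apply: le_trans Kce; rewrite ler_piMr // eqxx /= normr_nat lern1 leq_b1.
have seg : \forall e \near 0^'+, K e `<=` [set c | U e (x e + c *: δ i)].
  apply: (near_forall_selection 0 K0) => c Kc.
  exact: gdom_near XU (xcm c Kc).
have [N hN] := @uniform_moderate _ _ _ 0 K
  (fun e c => pd i (pd i f) e (x e + c *: δ i)) K0
  (fun c Kc => tame_moderate (tame_pd i (tame_pd i ft)) (xcm c Kc)).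
apply/negligible_netP => p.
(* With h = rho^k the step stays within rho^m, and h times the second derivative, bounded by rho^-N,
   is at most rho^(p+1). The values of f are taken below rho^(k+p+1), so the difference quotient is
   at most 2 rho^(p+1). The three terms fit under rho^p as soon as rho is at most 1/3. *)
pose k := (m + N + p).+1.
have fk c : (\forall e \near 0^'+, `|c e| <= rho e ^+ m) ->
    \forall e \near 0^'+, `|f e (x e + c e *: δ i)| <= rho e ^+ (k + p.+1).
  by move=> Kc; have [_ /negligible_netP] := xc c Kc; exact.
have f0 := fk (cst 0); have fh := fk (fun e => rho e ^+ k).
near=> e.
have [r0 r0' r1] : [/\ 0 < rho e, 0 <= rho e & rho e <= 1].
  by near: e; exact: gauge_near01.
have e1 : 0 < e <= 1 by near: e; exact: near_index.
pose h := rho e ^+ k; have h0 : 0 < h by rewrite exprn_gt0.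
have hm : h <= rho e ^+ m by rewrite /h ler_wiXn2l // /k -addnA ltnW // ltnS leq_addr.
have Kh t : 0 <= t <= h -> K e t.
  by move=> /andP[t0 th]; rewrite /K /= ger0_norm // (le_trans th).
have sege : K e `<=` [set c | U e (x e + c *: δ i)] by near: e.
have Ne t : K e t -> `|pd i (pd i f) e (x e + t *: δ i)| * rho e ^+ N <= 1.
  by move: t; near: e.
have f0e : `|f e (x e)| <= rho e ^+ (k + p.+1).
  rewrite -[x e](addr0) -(scale0r (δ i)); near: e; apply: f0.
  near=> e; rewrite normr0 exprn_ge0 //; near: e.
  by apply: filterS (gauge_near01 rho) => e [].
have fhe : `|f e (x e + h *: δ i)| <= rho e ^+ (k + p.+1).
  rewrite /h; near: e; apply: fh; near=> e.
  have [? ? ?] : [/\ 0 < rho e, 0 <= rho e & rho e <= 1].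
    by near: e; exact: gauge_near01.
  by rewrite ger0_norm ?exprn_ge0 // ler_wiXn2l // /k -addnA ltnW // ltnS leq_addr.
have rh : rho e <= 3^-1 by apply: ltW; near: e; apply: gauge_near_lt;
  rewrite invr_gt0.
have [t th E1] : exists2 t, 0 <= t <= h &
    f e (x e + h *: δ i) - f e (x e) = h * pd i f e (x e + t *: δ i).
  apply: derive_mvt (ltW h0) _ => t th; apply: (tame_diff ft) => //.
  by apply: sege; exact: Kh.
have /andP[t0 t1] := th.
have [s sh E2] : exists2 s, 0 <= s <= t &
    pd i f e (x e + t *: δ i) - pd i f e (x e) = t * pd i (pd i f) e (x e + s *: δ i).
  apply: derive_mvt t0 _ => s /andP[s0 s1]; apply: (tame_diff (tame_pd i ft)) => //.
  by apply: sege; apply: Kh; rewrite s0 (le_trans s1).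
have Ks : K e s by apply: Kh; case/andP: sh => -> /le_trans ->.
have {Ne Ks} := Ne s Ks; move: E1 E2 f0e fhe.
move: (f e (x e + h *: δ i)) (f e (x e)) (pd i f e (x e + t *: δ i)) (pd i f e (x e)).
move: (pd i (pd i f) e (x e + s *: δ i)) => A B C D E E1 E2 C1 B1 AN.
have h1 : `|D| <= rho e ^+ p.+1 + rho e ^+ p.+1.
  have -> : D = (B - C) / h by rewrite E1 mulrC mulKf // gt_eqF.
  rewrite normrM normfV (gtr0_norm h0) ler_pdivrMr // mulrDl -exprD addnC.
  by rewrite (le_trans (ler_normB _ _)) // lerD.
have h2 : `|t * A| <= rho e ^+ p.+1.
  rewrite normrM ger0_norm //; apply: (@le_trans _ _ (h * `|A|)).
    by rewrite ler_wpM2r.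
  have hE : h = rho e ^+ m * rho e ^+ N * rho e ^+ p.+1.
    by rewrite /h /k -!exprD addnS.
  rewrite (_ : h * _ = rho e ^+ m * (`|A| * rho e ^+ N) * rho e ^+ p.+1); last first.
    by rewrite hE; ring.
  rewrite ler_piMl ?exprn_ge0 // mulr_ile1 ?mulr_ge0 ?exprn_ge0 //.
  exact: exprn_ile1.
have -> : E = D - t * A by rewrite -E2 subKr.
have : rho e ^+ p.+1 * 3 <= rho e ^+ p.
  rewrite exprSr -mulrA ler_piMr ?exprn_ge0 //.
  by rewrite -ler_pdivlMr // mul1r.
apply: le_trans; rewrite (le_trans (ler_normB _ _)) // mulr_natr !mulrS mulr0n
  addr0 addrA.
exact: lerD.
Unshelve. all: by end_near. Qed.

End GermsOfGSF.

(** * Independence of the representative and of the defining net *)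

Section PointValues.
Context {R : realType} {rho : gauge R}.
Local Notation GR := (GR rho).
Local Notation cl := (@gclass R rho).
Local Notation negligible := (Defs.negligible rho).
Local Notation vmoderate := (vmoderate (rho := rho)).
Local Notation vclose := (vclose (rho := rho)).
Local Notation gvec := (@gvec R rho _).
Local Notation δ i := (delta_mx 0 i).

Definition btw n (x y : R -> 'rV[R]_n) (t : R -> R) : R -> 'rV[R]_n :=
  fun e => x e + t e *: (y e - x e).

(** All convex combinations, with a weight depending on e, are assumed to be generalized points of
    X; by selection the whole real segments then lie in [U e] for e small. The intermediate points
    form again such a combination, so derivatives are moderate along them. *)
Lemma net_mvt n (X : set 'rV[GR]_n) U f x y : gdom X U -> tame 1 X U f ->
  (forall t, (forall e, 0 <= t e <= 1) -> nets X (btw x y t)) ->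
  exists t, (forall e, 0 <= t e <= 1) /\ \forall e \near 0^'+,
    f e (y e) - f e (x e) =
    \sum_i (y e 0 i - x e 0 i) * pd i f e (btw x y t e).
Proof.
move=> XU ft xyX.
pose K (e : R) : set R := [set t | 0 <= t <= 1].
have K0 : \forall e \near (0 : R)^'+, K e !=set0.
  by apply: filterE => e; exists 0; rewrite /K /= lexx ler01.
have seg : \forall e \near 0^'+, K e `<=` [set t | U e (x e + t *: (y e - x e))].
  apply: (near_forall_selection 0 K0) => c Kc.
  (* [c] lies in [0, 1] only for e small, whereas the hypothesis wants a weight in [0, 1] at every
     index. *)
  pose t e := Num.max 0 (Num.min 1 (c e)).
  have t01 e : 0 <= t e <= 1.
    by rewrite /t le_max lexx /= ge_max ler01 ge_min lexx.
  apply: filterS2 (gdom_near XU (xyX t t01)) Kc => e.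
  rewrite /btw /K /= => + /andP[c0 c1]; rewrite /t (min_idPr c1) (max_idPr c0) //.
have /choice [t tP] : forall e, exists t, 0 <= t <= 1 /\
   (0 < e <= 1 -> K e `<=` [set t | U e (x e + t *: (y e - x e))] ->
    f e (y e) - f e (x e) =
    \sum_i (y e 0 i - x e 0 i) * pd i f e (x e + t *: (y e - x e))).
  move=> e; case: (pselect (0 < e <= 1 /\
     K e `<=` [set t | U e (x e + t *: (y e - x e))])) => [[e1 Ke]|h]; last first.
    by exists 0; rewrite lexx ler01; split=> // e1 Ke; exfalso; exact: h.
  have [|t t01 E] := @segment_mvt _ _ (f e) (x e) (y e).
    by move=> t /Ke; exact: (tame_diff ft).
  by exists t; split.
exists t; split=> [e|]; first by have [] := tP e.
by apply: filterS2 near_index seg => e e1 Ke; have [_] := tP e; apply.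
Qed.

Lemma btw_moderate n (x y : R -> 'rV[R]_n) t : vmoderate x -> vmoderate y ->
  (forall e, 0 <= t e <= 1) -> vmoderate (btw x y t).
Proof.
move=> xm ym t01; apply/vmoderateP => i.
under eq_fun do rewrite !mxE.
apply: moderateD; first exact: vmoderate_coord.
apply: moderateM; last first.
  by apply: moderateD; [|apply: moderateN]; exact: vmoderate_coord.
apply: moderate_near_le (moderate_cst rho 1) _; apply: filterE => e /=.
by have /andP[t0 t1] := t01 e; rewrite normr1 ger0_norm.
Qed.

Lemma btw_coord n (x y : R -> 'rV[R]_n) t e i :
  btw x y t e 0 i = x e 0 i + t e * (y e 0 i - x e 0 i).
Proof. by rewrite !mxE. Qed.

Lemma btw_class n (x y : R -> 'rV[R]_n) t : vmoderate x -> vmoderate y ->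
  (forall e, 0 <= t e <= 1) -> gvec x = gvec y -> gvec (btw x y t) = gvec x.
Proof.
move=> xm ym t01 /(gvec_eqP xm ym) xy; apply/esym/gvec_eqP => //.
  exact: btw_moderate.
move=> i; apply: negligible_near_le (xy i) _; apply: filterE => e.
rewrite btw_coord addrAC subrr add0r normrM.
by have /andP[t0 t1] := t01 e; rewrite ger0_norm // ler_piMl.
Qed.

(** The increment of f is a negligible difference times first derivatives at intermediate points;
    these points represent the same class, so the derivatives there are moderate. *)
Lemma tame_class n (X : set 'rV[GR]_n) U f x y : gdom X U -> tame 1 X U f ->
  nets X x -> vmoderate y -> gvec x = gvec y ->
  cl (fun e => f e (x e)) = cl (fun e => f e (y e)).
Proof.
move=> XU ft [xm xX] ym xy.
have bX t : (forall e, 0 <= t e <= 1) -> nets X (btw x y t).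
  by move=> t01; split; [exact: btw_moderate|rewrite btw_class].
have [t [t01 E]] := net_mvt XU ft bX.
have yX : nets X y by split => //; rewrite -xy.
apply/esym/gclass_eq; [exact: tame_moderate ft _ _..|].
apply: (@negligible_near_eq _ _ (fun e => \sum_i (y e 0 i - x e 0 i) * pd i f e
  (btw x y t e))).
  apply: negligible_sum => i; apply: negligibleMr.
    by move/(gvec_eqP xm ym): xy.
  exact: tame_moderate (tame_pd i ft) _ (bX t t01).
by apply: filterS E => e <-.
Qed.

Lemma gsmooth_class n (X : set 'rV[GR]_n) U f x y : gdom X U -> gsmooth X U f ->
  nets X x -> vmoderate y -> gvec x = gvec y ->
  cl (fun e => f e (x e)) = cl (fun e => f e (y e)).
Proof. by move=> XU ft; exact: tame_class (ft 1%N). Qed.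

Lemma gdomI n (X : set 'rV[GR]_n) U V : gdom X U -> gdom X V ->
  gdom X (fun e => U e `&` V e).
Proof.
move=> [Uo XU] [Vo XV]; split=> [e e1|a Xa x xa];
  first exact: openI (Uo _ e1) (Vo _ e1).
by apply: filterS2 (XU _ Xa x xa) (XV _ Xa x xa).
Qed.

Lemma tame_sub m n (X Y : set 'rV[GR]_n) U V f : Y `<=` X ->
  (forall e, V e `<=` U e) -> tame m X U f -> tame m Y V f.
Proof.
move=> YX VU; elim: m f => [|m IH] f [fd fm ft]; split=> //.
- by move=> e x e1 /VU; exact: fd.
- by move=> x [xm xY]; apply: fm; split => //; exact: YX.
- by move=> e x e1 /VU; exact: fd.
- by move=> x [xm xY]; apply: fm; split => //; exact: YX.
by move=> i; apply: IH; exact: ft.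
Qed.

Lemma near_partial1_coord n k (X : set 'rV[GR]_n) f U (fe : R -> 'rV[R]_n ->
  'rV[R]_k) x i j :
  defined_by X f U fe -> nets X x ->
  \forall e \near 0^'+, partial [:: i] (fe e) (x e) 0 j = pd i (fun e y =>
    fe e y 0 j) e (x e).
Proof.
move=> Xf xX; have [Uo _ _ _] := Xf.
by apply: near_partial_coord (defined_by_gdom Xf) _ xX => e /Uo [].
Qed.

Lemma partial1_class n k (X : set 'rV[GR]_n) f U (fe : R -> 'rV[R]_n ->
  'rV[R]_k) x i j :
  defined_by X f U fe -> nets X x ->
  gvec (fun e => partial [:: i] (fe e) (x e)) 0 j = cl (fun e => pd i (fun e y =>
    fe e y 0 j) e (x e)).
Proof.
move=> Xf xX; rewrite mxE; apply: gclass_near_eq;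
  last exact: near_partial1_coord Xf xX.
have [_ _ _ fm] := Xf; have [xm XX] := xX.
exact: vmoderate_coord (fm _ x [:: i] XX (conj xm erefl)).
Qed.

Lemma sharp_interior_sub n (X : set 'rV[GR]_n) x : vmoderate x ->
  sharp_interior X (gvec x) -> nets X x.
Proof.
move=> xm /(sharp_interiorP _ xm) [m h]; split => //; apply: h => // i.
move: (gauge_near01 rho); apply: filterS => e [_ r0 _].
by rewrite subrr normr0 exprn_ge0.
Qed.

Lemma derive_subE n (f g : 'rV[R]_n -> R) x v :
  differentiable f x -> differentiable g x ->
  'D_v (fun y => f y + (-1) * g y) x = 'D_v f x - 'D_v g x.
Proof.
move=> fd gd; under eq_fun do rewrite mulN1r.
by rewrite [LHS](@deriveB _ _ _ f g) //; exact: diff_derivable.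
Qed.

(** [xget] picks an arbitrary defining net and an arbitrary representative. The representative is
    exchanged by [gsmooth_class]; the difference of two defining nets has negligible values
    throughout a sharp neighbourhood, hence a negligible derivative. *)
Lemma gpartial_intE n k (X : set 'rV[GR]_n) f U (fe : R -> 'rV[R]_n -> 'rV[R]_k) x i :
  defined_by X f U fe -> vmoderate x -> sharp_interior X (gvec x) ->
  gpartial_int X f [:: i] (gvec x) = gvec (fun e => partial [:: i] (fe e) (x e)).
Proof.
move=> Xf xm xint; have xX := sharp_interior_sub xm xint.
have fm : vmoderate (fun e => partial [:: i] (fe e) (x e)).
  by have [_ _ _] := Xf; apply; [exact: xX.2|split].
rewrite /gpartial_int; case: xgetP => [v -> /= [U' [fe' [x' [Xf' [x'm x'x] [_
  <-]]]]]|]; last first.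
  by move=> /(_ (gvec (fun e => partial [:: i] (fe e) (x e)))) []; exists U, fe, x.
have x'X : nets X x' by split => //; rewrite x'x; exact: xX.2.
apply/rowP => j; apply: etrans (partial1_class i j Xf' x'X) _.
apply: etrans _ (esym (partial1_class i j Xf xX)).
have XU := defined_by_gdom Xf; have XU' := defined_by_gdom Xf'.
have ft := defined_by_gsmooth j Xf; have ft' := defined_by_gsmooth j Xf'.
rewrite (gsmooth_class XU' (gsmooth_pd i ft') x'X xm x'x).
pose V e := U e `&` U' e; have XV : gdom X V := gdomI XU XU'.
pose h e y := fe' e y 0 j + (-1) * fe e y 0 j.
have hV m : tame m X V h.
  apply: (tameD XV); first by apply: tame_sub (ft' m) => // e; exact: subIsetr.
  apply: (tameM XV); first by apply: (tame_cst XV); exact: moderate_cst.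
  by apply: tame_sub (ft m) => // e; exact: subIsetl.
have hE : negligible (fun e => pd i h e (x e)).
  have [m hm] := proj1 (sharp_interiorP X xm) xint.
  apply: (@negligible_pd _ _ _ X V h i x m) => // c cm.
  have xc : vclose x (fun e => x e + c e *: δ i) m.
    move=> l. apply: filterS cm => e ce; rewrite !mxE addrAC subrr add0r normrM.
    by apply: le_trans ce; rewrite ler_piMr // eqxx /= normr_nat lern1 leq_b1.
  have cX : nets X (fun e => x e + c e *: δ i).
    by split; [exact: vclose_moderate xc|apply: hm => //; exact: vclose_moderate xc].
  split; first exact: cX.2.
  have [vm vE] := defined_by_val Xf cX; have [vm' vE'] := defined_by_val Xf' cX.
  have hv : gvec (fun e => fe e (x e + c e *: δ i)) = gvec (fun e =>
    fe' e (x e + c e *: δ i)).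
    by rewrite -vE -vE'.
  apply: negligible_near_eq (proj1 (gvec_eqP vm vm') hv j) _; apply: filterE => e.
  by rewrite /h mulN1r.
have fpm := tame_moderate (gsmooth_pd i ft 0%N) xX.
have fpm' := tame_moderate (gsmooth_pd i ft' 0%N) xX.
apply/gclass_eq => //; apply: negligible_near_eq hE _.
apply: filterS2 near_index (gdom_near XV xX) => e e1 [Ue U'e].
apply: derive_subE; first exact: (tame_diff (ft' 0%N) e1 U'e).
exact: (tame_diff (ft 0%N) e1 Ue).
Qed.

Lemma gpartialE_int n k (X : set 'rV[GR]_n) f U (fe : R -> 'rV[R]_n -> 'rV[R]_k) x i :
  defined_by X f U fe -> vmoderate x -> sharp_interior X (gvec x) ->
  gpartial X f [:: i] (gvec x) = gvec (fun e => partial [:: i] (fe e) (x e)).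
Proof.
move=> Xf xm xint; rewrite /gpartial; case: pselect => [_xi|/(_ xint)//].
exact: gpartial_intE Xf xm xint.
Qed.

End PointValues.

(** * Values of derivatives up to the boundary *)

Section Clamp.
Context {R : realType}.
Implicit Types lo hi t z : R.

Definition clamp lo hi t := Num.max lo (Num.min hi t).

Lemma clamp_in lo hi t : lo <= hi -> lo <= clamp lo hi t <= hi.
Proof. by move=> lh; rewrite /clamp le_max lexx /= ge_max lh ge_min lexx. Qed.

Lemma clamp_dist lo hi t z : lo <= hi -> 0 <= z -> lo <= t + z -> t <= hi + z ->
  `|clamp lo hi t - t| <= z.
Proof.
move=> lh z0 lt th; rewrite /clamp.
case: (leP hi t) => h; [rewrite (max_idPr lh)|case: (leP lo t) => h'];
  rewrite ler_norml; lra.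
Qed.

Lemma dist_triangle2 (A B C r r' : R) :
  `|B - C| <= r -> `|B - A| <= r -> r *+ 2 <= r' -> `|C - A| <= r'.
Proof.
move=> h1 h2; apply: le_trans; rewrite mulr2n -(subrKA B).
by rewrite (le_trans (ler_normD _ _)) // lerD // distrC.
Qed.

Definition upd0 n (x : 'rV[R]_n.+1) t : 'rV[R]_n.+1 :=
  \row_i if i == ord0 then t else x 0 i.

End Clamp.

(** * The sets [a, b] x GR^n and clamped representatives *)

Section Slab.
Context {R : realType} {rho : gauge R}.
Local Notation GR := (GR rho).
Local Notation cl := (@gclass R rho).
Local Notation moderate := (moderate rho).
Local Notation negligible := (Defs.negligible rho).
Local Notation vmoderate := (vmoderate (rho := rho)).
Local Notation vclose := (vclose (rho := rho)).
Local Notation gvec := (@gvec R rho _).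

Lemma gauge_near_mulrn_le1 n : \forall e \near 0^'+, rho e *+ n <= 1.
Proof.
near=> e.
have : rho e < n.+1%:R^-1 by near: e; apply: gauge_near_lt; rewrite invr_gt0.
have [r0 r0' r1] : [/\ 0 < rho e, 0 <= rho e & rho e <= 1].
  by near: e; exact: gauge_near01.
rewrite -[X in _ < X]div1r ltr_pdivlMr // => h; apply: ltW; apply: le_lt_trans h.
by rewrite mulr_natr mulrS lerDr.
Unshelve. all: by end_near. Qed.

Lemma gauge_near_double m : \forall e \near 0^'+, rho e ^+ m.+1 *+ 2 <= rho e ^+ m.
Proof.
apply: filterS2 (gauge_near01 rho) (gauge_near_mulrn_le1 2) => e [r0 r0' _] r2.
by rewrite exprS -mulrnAl ler_piMl // exprn_ge0.
Qed.

Lemma vclose_sym n (x y : R -> 'rV[R]_n) m : vclose x y m -> vclose y x m.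
Proof. by move=> xy i; apply: filterS (xy i) => e; rewrite distrC. Qed.

Lemma vclose_trans n (x y z : R -> 'rV[R]_n) m :
  vclose x y m.+1 -> vclose y z m.+1 -> vclose x z m.
Proof.
move=> xy yz i; near=> e.
have [r0 r0' r1] : [/\ 0 < rho e, 0 <= rho e & rho e <= 1].
  by near: e; exact: gauge_near01.
have h1 : `|y e 0 i - x e 0 i| <= rho e ^+ m.+1 by near: e; exact: xy.
have h2 : `|z e 0 i - y e 0 i| <= rho e ^+ m.+1 by near: e; exact: yz.
have r2 : rho e *+ 2 <= 1 by near: e; exact: gauge_near_mulrn_le1.
rewrite -(subrKA (y e 0 i)); apply: le_trans (ler_normD _ _) _.
apply: le_trans (lerD h2 h1) _.
by rewrite -mulr2n exprS -mulrnAl ler_piMl // exprn_ge0.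
Unshelve. all: by end_near. Qed.

Lemma vcloseW n (x y : R -> 'rV[R]_n) m p : (m <= p)%N -> vclose x y p ->
  vclose x y m.
Proof.
move=> mp xy i; apply: filterS2 (xy i) (gauge_near_leX rho mp) => e; exact: le_trans.
Qed.

Variables (a b : GR).
Hypothesis ab : glt a b.

(** Covers at once the interval [a, b], for n = 0, and the domain of the Lagrangian, for n = 2d. *)
Definition slab n : set 'rV[GR]_n.+1 := [set x | gcc a b (x 0 ord0)].

Let ae := grepr a.
Let be := grepr b.

Lemma near_slab_width : exists n : nat,
  \forall e \near 0^'+, ae e + rho e ^+ n <= be e.
Proof.
apply/glt_repP; rewrite ?greprK //; exact: grepr_moderate.
Qed.

Lemma near_slab_le : \forall e \near 0^'+, ae e <= be e.
Proof.
have [n h] := near_slab_width; apply: filterS2 h (gauge_near01 rho) => e h [_ r0 _].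
by apply: le_trans h; rewrite lerDl exprn_ge0.
Qed.

Lemma gcc_near x : moderate x -> (\forall e \near 0^'+, ae e <= x e <= be e) ->
  gcc a b (cl x).
Proof.
move=> xm h; rewrite /gcc /= -(greprK a) -(greprK b).
by split; apply: gle_near => //; try exact: grepr_moderate;
  apply: filterS h => e /andP[].
Qed.

(** Membership in [a, b] bounds a representative only up to negligible nets [z] and [w]; truncation
    moves it by no more than |z| + |w|. *)
Lemma gcc_clamp x : moderate x -> gcc a b (cl x) ->
  negligible (fun e => clamp (ae e) (be e) (x e) - x e).
Proof.
move=> xm []; rewrite -{1}(greprK a) -{1}(greprK b).
move=> /(gle_repP (grepr_moderate _) xm) [z [zn zx]].
move=> /(gle_repP xm (grepr_moderate _)) [w [wn wx]].
apply: (@negligible_near_le _ _ _ (fun e => `|z e| + `|w e|)).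
  apply: negligibleD; [apply: negligible_near_le zn _|apply: negligible_near_le wn _];
    by apply: filterE => e; rewrite normr_id.
near=> e.
rewrite [leRHS]ger0_norm ?addr_ge0 //; apply: clamp_dist; rewrite ?addr_ge0 //.
- by near: e; exact: near_slab_le.
- have h : ae e <= x e + z e by near: e.
  by apply: le_trans h _; rewrite lerD2l (le_trans (ler_norm _)) // lerDl.
- have h : x e <= be e + w e by near: e.
  by apply: le_trans h _; rewrite lerD2l (le_trans (ler_norm _)) // lerDr.
Unshelve. all: by end_near. Qed.

(** Produces a representative whose first coordinate lies in the real interval for e small, so that
    real segments between two such nets remain over that interval. *)
Lemma slab_clamp n (x : R -> 'rV[R]_n.+1) : nets (@slab n) x ->
  let x' := fun e => upd0 (x e) (clamp (ae e) (be e) (x e 0 ord0)) in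
  [/\ vmoderate x', forall m, vclose x x' m & gvec x' = gvec x].
Proof.
move=> [xm]; rewrite /slab /= mxE => xX.
set x' := fun e => _.
have xx' m : vclose x x' m.
  move=> i; rewrite /x'; under eq_near do rewrite mxE.
  case: eqP => [->|_].
    have /negligible_netP h := gcc_clamp (vmoderate_coord ord0 xm) xX.
    exact: h.
  by move: (gauge_near01 rho); apply: filterS => e [_ r0 _];
    rewrite subrr normr0 exprn_ge0.
have x'm := vclose_moderate xm (xx' 0%N).
by split=> //; apply/esym/gvec_closeP.
Qed.

(* The derivatives of f are bounded by a single power of rho on the unit box
   around x intersected with [a, b] x R^n, so that f is Lipschitz there. *)
Lemma slab_continuous n (U : R -> set 'rV[R]_n.+1) f x m :
  gdom (@slab n) U -> tame 1 (@slab n) U f -> nets (@slab n) x ->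
  exists p : nat, forall y, nets (@slab n) y -> vclose x y p ->
    \forall e \near 0^'+, `|f e (y e) - f e (x e)| <= rho e ^+ m.
Proof.
move=> XU ft xX; have [x'm xx' x'x] := slab_clamp xX; have [xm _] := xX.
set x' := fun e => upd0 (x e) (clamp (ae e) (be e) (x e 0 ord0)) in x'm xx' x'x.
(* Centred at the clamped net, these sets are convex and nonempty for e small, and every net in them
   is a generalized point of the slab, so that both selection lemmas apply. *)
pose K e : set 'rV[R]_n.+1 := [set z | ae e <= z 0 ord0 <= be e /\
  forall i, `|z 0 i - x' e 0 i| <= 1].
have Kx' : \forall e \near 0^'+, K e (x' e).
  apply: filterS near_slab_le => e abe; split.
    by rewrite mxE eqxx; exact: clamp_in.
  by move=> i; rewrite subrr normr0.
have KX z : (\forall e \near 0^'+, K e (z e)) -> nets (@slab n) z.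
  move=> Kz.
  have zm : vmoderate z.
    apply: (vclose_moderate x'm (m := 0)) => i; apply: filterS Kz => e [_ +].
    by rewrite expr0; exact.
  split => //; rewrite /slab /= mxE; apply: gcc_near; first exact: vmoderate_coord.
  by apply: filterS Kz => e [].
have K0 : \forall e \near 0^'+, K e !=set0 by apply: filterS Kx' => e; exists (x' e).
have KU : \forall e \near 0^'+, K e `<=` U e.
  apply: (near_forall_selection 0 K0) => z Kz; exact: gdom_near XU (KX z Kz).
have /choice [N hN] : forall i, exists N : nat, \forall e \near 0^'+,
    forall t, K e t -> `|pd i f e t| * rho e ^+ N <= 1.
  move=> i; apply: (uniform_moderate 0 K0) => z Kz.
  exact: tame_moderate (tame_pd i ft) _ (KX z Kz).
pose M := (\sum_i N i)%N.
(* [M] makes up for the loss rho^-(N i) of each partial derivative, and rho^(m+1) is left. The shift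
   to [q.+2] pays for going from x' to y' by way of x and y. *)
pose q := (M + m.+1)%N.
exists q.+2 => y yX xy; have [y'm yy' y'y] := slab_clamp yX; have [ym _] := yX.
set y' := fun e => upd0 (y e) (clamp (ae e) (be e) (y e 0 ord0)) in y'm yy' y'y.
have x'y' : vclose x' y' q.
  apply: vclose_trans (vclose_sym (xx' q.+1)) _.
  by apply: vclose_trans xy (yy' q.+2).
have x'X : nets (@slab n) x' by split => //; rewrite x'x; exact: xX.2.
have y'X : nets (@slab n) y' by split => //; rewrite y'y; exact: yX.2.
have fx : negligible (fun e => f e (x e) - f e (x' e)).
  apply: (proj1 (gclass_eq (tame_moderate ft xX) (tame_moderate ft x'X))).
  exact: tame_class XU ft xX x'm (esym x'x).
have fy : negligible (fun e => f e (y e) - f e (y' e)).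
  apply: (proj1 (gclass_eq (tame_moderate ft yX) (tame_moderate ft y'X))).
  exact: tame_class XU ft yX y'm (esym y'y).
have hNn : \forall e \near 0^'+, forall i t, K e t ->
  `|pd i f e t| * rho e ^+ N i <= 1.
  exact: filter_forall.
have x'y'n : \forall e \near 0^'+, forall i, `|y' e 0 i - x' e 0 i| <= rho e ^+ q.
  exact: filter_forall.
near=> e.
have e1 : 0 < e <= 1 by near: e; exact: near_index.
have abe : ae e <= be e by near: e; exact: near_slab_le.
have [r0 r0' r1] : [/\ 0 < rho e, 0 <= rho e & rho e <= 1].
  by near: e; exact: gauge_near01.
have rn : rho e *+ n.+3 <= 1 by near: e; exact: gauge_near_mulrn_le1.
have hx : `|f e (x e) - f e (x' e)| <= rho e ^+ m.+1.
  by near: e; move/negligible_netP : fx; exact.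
have hy : `|f e (y e) - f e (y' e)| <= rho e ^+ m.+1.
  by near: e; move/negligible_netP : fy; exact.
have hd : forall i, `|y' e 0 i - x' e 0 i| <= rho e ^+ q by near: e.
have hK : forall i t, K e t -> `|pd i f e t| * rho e ^+ N i <= 1 by near: e.
have KUe : K e `<=` U e by near: e.
have [x'0 _] : K e (x' e) by near: e.
have y'0 : ae e <= y' e 0 ord0 <= be e by rewrite mxE eqxx; exact: clamp_in.
have Kseg t : 0 <= t <= 1 -> K e (x' e + t *: (y' e - x' e)).
  move=> /andP[t0 t1]; split=> [|i].
    rewrite [X in _ <= X <= _](_ : _ = (1 - t) * x' e 0 ord0 + t * y' e 0 ord0);
      last first.
      by rewrite !mxE; ring.
    move: (x' e 0 ord0) (y' e 0 ord0) x'0 y'0 => X Y /andP[X1 X2] /andP[Y1 Y2].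
    have t1' : 0 <= 1 - t by rewrite subr_ge0.
    apply/andP; split.
      by have := lerD (ler_wpM2l t1' X1) (ler_wpM2l t0 Y1);
        rewrite -mulrDl subrK mul1r.
    by have := lerD (ler_wpM2l t1' X2) (ler_wpM2l t0 Y2); rewrite -mulrDl subrK mul1r.
  rewrite [X in `|X|](_ : _ = t * (y' e 0 i - x' e 0 i)); last by rewrite !mxE; ring.
  rewrite normrM (ger0_norm t0) mulr_ile1 // (le_trans (hd i)) //.
  exact: exprn_ile1.
have [t t01 E] : exists2 t, 0 <= t <= 1 & f e (y' e) - f e (x' e) =
    \sum_i (y' e 0 i - x' e 0 i) * pd i f e (x' e + t *: (y' e - x' e)).
  by apply: segment_mvt => t /Kseg /KUe; exact: (tame_diff ft).
have hs : `|f e (y' e) - f e (x' e)| <= rho e ^+ m.+1 *+ n.+1.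
  rewrite E; apply: le_trans (ler_norm_sum _ _ _) _.
  apply: (@le_trans _ _ (\sum_(i < n.+1) rho e ^+ m.+1));
    last by rewrite sumr_const card_ord.
  apply: ler_sum => i _; have := hK i _ (Kseg t t01); have := hd i.
  move: (pd i f e _) (y' e 0 i - x' e 0 i) => P D Dq PN.
  have Nq : (N i <= M)%N by rewrite /M (bigD1 i) //= leq_addr.
  rewrite normrM; apply: (@le_trans _ _ (rho e ^+ q * `|P|));
    first by rewrite ler_wpM2r.
  rewrite /q exprD -(subnK Nq) exprD.
  rewrite (_ : _ * _ = rho e ^+ (M - N i) * (`|P| * rho e ^+ N i) * rho e ^+
    m.+1); last by ring.
  by rewrite ler_piMl ?exprn_ge0 // mulr_ile1 ?mulr_ge0 ?exprn_ge0 // exprn_ile1.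
(* One term for each of the n + 1 coordinates and one for each of the two replacements of a net by
   its clamped version. *)
have fin : rho e ^+ m.+1 *+ n.+3 <= rho e ^+ m.
  by rewrite exprS -mulrnAl ler_piMl // exprn_ge0.
apply: le_trans fin; move: hs hx hy.
rewrite (_ : f e (y e) - f e (x e) = (f e (y' e) - f e (x' e)) + (f e (y e) - f e
  (y' e))
  - (f e (x e) - f e (x' e))); last by ring.
move: (f e (y' e) - f e (x' e)) (f e (x e) - f e (x' e)) (f e (y e) - f e (y' e)).
move=> A B C hA hB hC.
rewrite !mulrSr -mulrSr; apply: le_trans (ler_normB _ _) _.
by rewrite lerD // (le_trans (ler_normD _ _)) // lerD.
Unshelve. all: by end_near. Qed.

(** The first coordinate is pushed inwards by clamping it to [ae + rho^q, be - rho^q]; the margin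
    rho^q on either side makes the new point sharply interior. *)
Lemma slab_adherent n (x : R -> 'rV[R]_n.+1) p : nets (@slab n) x ->
  exists y, [/\ vmoderate y, vclose x y p & sharp_interior (@slab n) (gvec y)].
Proof.
move=> xX; have [xm x0] := xX; rewrite /slab /= mxE in x0.
have [k hk] := near_slab_width.
(* Twice rho^q has to fit under rho^k, which bounds the width of [a, b] from below, and under rho^p,
   as the push of rho^q adds to the error rho^q of the representative. *)
pose q := (p + k).+2.
pose y e := upd0 (x e) (clamp (ae e + rho e ^+ q) (be e - rho e ^+ q) (x e 0 ord0)).
have wid : \forall e \near 0^'+, ae e + rho e ^+ q <= be e - rho e ^+ q.
  near=> e.
  have [r0 r0' r1] : [/\ 0 < rho e, 0 <= rho e & rho e <= 1].
    by near: e; exact: gauge_near01.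
  have r2 : rho e *+ 2 <= 1 by near: e; exact: gauge_near_mulrn_le1.
  have hke : ae e + rho e ^+ k <= be e by near: e.
  have : rho e ^+ q *+ 2 <= rho e ^+ k.
    rewrite exprS -mulrnAl (@le_trans _ _ (rho e ^+ (p + k).+1)) //.
      by rewrite ler_piMl // exprn_ge0.
    by rewrite ler_wiXn2l // -addSn leq_addl.
  by rewrite mulr2n; lra.
have xy : vclose x y p.
  move=> i; rewrite /y; under eq_near do rewrite mxE.
  case: eqP => [->|_]; last first.
    by move: (gauge_near01 rho); apply: filterS => e [_ r0 _];
      rewrite subrr normr0 exprn_ge0.
  have /negligible_netP nx := gcc_clamp (vmoderate_coord ord0 xm) x0.
  near=> e.
  have [r0 r0' r1] : [/\ 0 < rho e, 0 <= rho e & rho e <= 1].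
    by near: e; exact: gauge_near01.
  have r2 : rho e *+ 2 <= 1 by near: e; exact: gauge_near_mulrn_le1.
  have abe : ae e <= be e by near: e; exact: near_slab_le.
  have nxe : `|clamp (ae e) (be e) (x e 0 ord0) - x e 0 ord0| <= rho e ^+ q by
    near: e; exact: nx.
  have h1 := clamp_in (x e 0 ord0) abe.
  apply: (@le_trans _ _ (rho e ^+ q *+ 2)); last first.
    rewrite exprS -mulrnAl (@le_trans _ _ (rho e ^+ (p + k).+1)) //.
      by rewrite ler_piMl // exprn_ge0.
    by rewrite ler_wiXn2l // -addnS leq_addr.
  have q0 : 0 <= rho e ^+ q by rewrite exprn_ge0.
  move: (clamp (ae e) _ _) nxe h1 => c; rewrite ler_norml =>
    /andP[c1 c2] /andP[c3 c4].
  apply: clamp_dist; rewrite ?mulr2n; [by near: e|by rewrite addr_ge0|lra|lra].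
have ym := vclose_moderate xm xy.
exists y; split => //; apply/sharp_interiorP => //; exists q => z zm yz.
rewrite /slab /= mxE; apply: gcc_near; first exact: vmoderate_coord.
near=> e.
have h : `|z e 0 ord0 - y e 0 ord0| <= rho e ^+ q by near: e; exact: yz.
have we : ae e + rho e ^+ q <= be e - rho e ^+ q by near: e.
move: h; have := clamp_in (x e 0 ord0) we; rewrite [y e]/(upd0 _ _) mxE eqxx.
move: (clamp _ _ _) => c /andP[c1 c2]; rewrite ler_norml => /andP[h1 h2].
apply/andP; split; lra.
Unshelve. all: by end_near. Qed.

(** Away from the sharp interior the derivative is by definition a sharp limit. [slab_continuous],
    applied to the net of derivatives, shows that its value at x is such a limit, and
    [slab_adherent] makes the limit unique. *)
Lemma gpartialE_slab n k f U (fe : R -> 'rV[R]_n.+1 -> 'rV[R]_k) x i :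
  defined_by (@slab n) f U fe -> nets (@slab n) x ->
  gpartial (@slab n) f [:: i] (gvec x) = gvec (fun e => partial [:: i] (fe e) (x e)).
Proof.
move=> Xf xX; have [xm xXX] := xX; have [xi|nxi] :=
  pselect (sharp_interior (@slab n) (gvec x)).
  exact: gpartialE_int Xf xm xi.
rewrite /gpartial; case: pselect => [//|_nxi].
have fm y : nets (@slab n) y -> vmoderate (fun e => partial [:: i] (fe e) (y e)).
  by move=> [ym yX]; have [_ _ _] := Xf; apply; [exact: yX|split].
suff lim : sharp_lim (sharp_interior (@slab n)) (gpartial_int (@slab n) f [:: i])
    (gvec x) (gvec (fun e => partial [:: i] (fe e) (x e))).
  case: xgetP => [v -> /= vl|/(_ _ lim)//].
  apply: sharp_lim_unique vl lim => // p; exact: slab_adherent.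
apply/sharp_limP => //; first exact: fm.
move=> m.
have XU := defined_by_gdom Xf.
have /choice [p hp] : forall j : 'I_k, exists p : nat, forall y, nets (@slab n) y ->
   vclose x y p -> \forall e \near 0^'+,
   `|pd i (fun e y => fe e y 0 j) e (y e) - pd i (fun e y =>
     fe e y 0 j) e (x e)| <= rho e ^+ m.+1.
  move=> j; apply: (slab_continuous _ XU) => //.
  exact: (gsmooth_pd i (defined_by_gsmooth j Xf)) 1%N.
have ps j : (p j <= \sum_j p j)%N by rewrite (bigD1 j) //= leq_addr.
(* The sum dominates each [p j] and so serves all coordinates at once. *)
exists (\sum_j p j)%N => y ym xy yi w [wm wE] j.
have yX := sharp_interior_sub ym yi.
have pj := vcloseW (ps j) xy.
have hj := hp j y yX pj.
move: wE; rewrite (gpartial_intE i Xf ym yi) => wE.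
have wy := proj1 (gvec_eqP wm (fm y yX)) wE j.
have xj := near_partial1_coord i j Xf xX; have yj := near_partial1_coord i j Xf yX.
near=> e.
have [r0 r0' r1] : [/\ 0 < rho e, 0 <= rho e & rho e <= 1].
  by near: e; exact: gauge_near01.
have d2 : rho e ^+ m.+1 *+ 2 <= rho e ^+ m by near: e; exact: gauge_near_double.
have -> : partial [:: i] (fe e) (x e) 0 j = pd i (fun e y =>
  fe e y 0 j) e (x e) by near: e.
have hje : `|pd i (fun e y => fe e y 0 j) e (y e) - pd i (fun e y =>
  fe e y 0 j) e (x e)| <= rho e ^+ m.+1.
  by near: e.
have hwe : `|partial [:: i] (fe e) (y e) 0 j - w e 0 j| <= rho e ^+ m.+1.
  by near: e; move/negligible_netP : wy; exact.
have yje : partial [:: i] (fe e) (y e) 0 j = pd i (fun e y =>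
  fe e y 0 j) e (y e) by near: e.
move: hwe hje; rewrite yje; move: (pd i _ e (x e)) (pd i _ e (y e)) (w e 0 j) =>
  A B C CB BA.
exact: (dist_triangle2 CB BA d2).
Unshelve. all: by end_near. Qed.

End Slab.

(** * Calculus of the point values of derivatives *)

Section Evaluation.
Context {R : realType} {rho : gauge R}.
Local Notation GR := (GR rho).
Local Notation cl := (@gclass R rho).
Local Notation moderate := (moderate rho).

Definition ev n (f : R -> 'rV[R]_n -> R) (x : R -> 'rV[R]_n) : GR :=
  cl (fun e => f e (x e)).

(** Supplies the domain on which a composite makes sense at every index, as the closure under
    composition demands. *)
Lemma gdom_preimage n k (X : set 'rV[GR]_n) U (Y : set 'rV[GR]_k) V
    (g : R -> 'rV[R]_n -> 'rV[R]_k) : gdom X U -> gdom Y V ->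
  (forall j, gsmooth X U (fun e x => g e x 0 j)) ->
  (forall x, nets X x -> nets Y (fun e => g e (x e))) ->
  gdom X (fun e => U e `&` g e @^-1` V e).
Proof.
move=> XU YV gs XY; split=> [e e1|a Xa x [xm xa]].
  apply: open_preimage_in; [exact: XU.1|exact: YV.1|move=> x Ux].
  apply: differentiable_continuous; apply: differentiable_rV => j.
  exact: (tame_diff (gs j 0%N) e1 Ux).
have xX : nets X x by split => //; rewrite xa.
apply: filterS2 (gdom_near XU xX) (gdom_near YV (XY x xX)) => e Ux Vx.
by split.
Qed.

Section OnDomain.
Variables (n : nat) (X : set 'rV[GR]_n) (U : R -> set 'rV[R]_n).
Hypothesis XU : gdom X U.
Implicit Types f g : R -> 'rV[R]_n -> R.

Lemma gsmooth_sub (Y : set 'rV[GR]_n) V f : Y `<=` X ->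
  (forall e, V e `<=` U e) -> gsmooth X U f -> gsmooth Y V f.
Proof. by move=> YX VU fs m; exact: tame_sub (fs m). Qed.

Lemma gsmoothD f g : gsmooth X U f -> gsmooth X U g ->
  gsmooth X U (fun e x => f e x + g e x).
Proof. by move=> fs gs m; exact: tameD. Qed.

Lemma gsmoothM f g : gsmooth X U f -> gsmooth X U g ->
  gsmooth X U (fun e x => f e x * g e x).
Proof. by move=> fs gs m; exact: tameM. Qed.

Lemma gsmooth_cst c : moderate c -> gsmooth X U (fun e _ => c e).
Proof. by move=> cm m; exact: tame_cst. Qed.

Lemma gsmooth_coord i : gsmooth X U (fun _ x => x 0 i).
Proof. by move=> m; exact: tame_coord. Qed.

Lemma gsmooth_sum (I : finType) (f : I -> R -> 'rV[R]_n -> R) :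
  (forall j, gsmooth X U (f j)) -> gsmooth X U (fun e x => \sum_j f j e x).
Proof. by move=> fs m; apply: tame_sum => // j; exact: fs. Qed.

Lemma gsmooth_comp k (Y : set 'rV[GR]_k) V (f : R -> 'rV[R]_k -> R) (g : R ->
  'rV[R]_n -> 'rV[R]_k) :
  (forall e x, 0 < e <= 1 -> U e x -> V e (g e x)) ->
  (forall x, nets X x -> nets Y (fun e => g e (x e))) ->
  gsmooth Y V f -> (forall j, gsmooth X U (fun e x => g e x 0 j)) ->
  gsmooth X U (fun e x => f e (g e x)).
Proof.
move=> UV XY fs gs m; apply: (tame_comp XU UV XY (fs m)) => j; exact: gs.
Qed.

Lemma gsmooth_eq f g : (forall e x, 0 < e <= 1 -> U e x -> f e x = g e x) ->
  gsmooth X U f -> gsmooth X U g.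
Proof. by move=> fg fs m; exact: tame_eq fg (fs m). Qed.

Lemma gsmooth_moderate f x : gsmooth X U f -> nets X x ->
  moderate (fun e => f e (x e)).
Proof. by move=> fs; exact: tame_moderate (fs 0%N) _. Qed.

Lemma gsmooth_diff f e x : gsmooth X U f -> 0 < e <= 1 -> U e x ->
  differentiable (f e) x.
Proof. by move=> fs; exact: tame_diff (fs 0%N) _ _. Qed.

Lemma unit_inv_moderate c : moderate c -> cl c \is a GRing.unit ->
  moderate (fun e => (c e)^-1).
Proof.
move=> cm /(gclass_unitP cm) [n0 h]; apply/moderate_netP; exists n0.
apply: filterS2 h (gauge_near01 rho) => e h [r0 r0' _].
have c0 : 0 < `|c e| by apply: lt_le_trans h; rewrite exprn_gt0.
by rewrite normfV mulrC ler_pdivrMr // mul1r.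
Qed.

(** An invertible value is bounded below by a power of rho and so is nonzero for e small; removing
    the zeros of f keeps every generalized point of X. *)
Lemma gdom_neq0 f : gsmooth X U f ->
  (forall x, nets X x -> ev f x \is a GRing.unit) ->
  gdom X (fun e => U e `&` [set x | f e x != 0]).
Proof.
move=> fs fu; split=> [e e1|a Xa x [xm xa]].
  apply: (@open_preimage_in _ _ _ (U e) [set y : R | y != 0] (f e)).
  - exact: XU.1.
  - exact: open_neq.
  - by move=> x Ux; apply: differentiable_continuous; exact: gsmooth_diff fs e1 Ux.
have xX : nets X x by split => //; rewrite xa.
have /(gclass_unitP (gsmooth_moderate fs xX)) [n0 h] := fu x xX.
apply: filterS3 h (gauge_near01 rho) (gdom_near XU xX) => e h [r0 _ _] Ux.
by split => //; rewrite /= -normr_gt0; apply: lt_le_trans h; rewrite exprn_gt0.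
Qed.

Lemma gsmoothV f : gsmooth X U f -> (forall e x, 0 < e <= 1 -> U e x -> f e x != 0) ->
  (forall x, nets X x -> ev f x \is a GRing.unit) ->
  gsmooth X U (fun e x => (f e x)^-1).
Proof.
move=> fs f0 fu m; apply: (tameV XU (fs m) f0) => x xX.
by apply: unit_inv_moderate (fu x xX); exact: gsmooth_moderate.
Qed.

Section AtPoint.
Variable x : R -> 'rV[R]_n.
Hypothesis xX : nets X x.

Lemma ev_near_eq f g : (forall e, 0 < e <= 1 -> U e (x e) -> f e (x e) = g e (x e)) ->
  moderate (fun e => f e (x e)) -> ev f x = ev g x.
Proof.
move=> fg fm; apply: gclass_near_eq => //.
by apply: filterS2 near_index (gdom_near XU xX) => e; exact: fg.
Qed.

Lemma evD f g : gsmooth X U f -> gsmooth X U g ->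
  ev (fun e y => f e y + g e y) x = ev f x + ev g x.
Proof. by move=> fs gs; apply: gclassD; exact: gsmooth_moderate. Qed.

Lemma evM f g : gsmooth X U f -> gsmooth X U g ->
  ev (fun e y => f e y * g e y) x = ev f x * ev g x.
Proof. by move=> fs gs; apply: gclassM; exact: gsmooth_moderate. Qed.

Lemma ev_sum (I : finType) (f : I -> R -> 'rV[R]_n -> R) :
  (forall j, gsmooth X U (f j)) ->
  ev (fun e y => \sum_j f j e y) x = \sum_j ev (f j) x.
Proof. by move=> fs; apply: gclass_sum => j; exact: gsmooth_moderate. Qed.

Lemma ev_pd_eq i f g : (forall e y, 0 < e <= 1 -> U e y -> f e y = g e y) ->
  gsmooth X U f -> ev (pd i f) x = ev (pd i g) x.
Proof.
move=> fg fs; apply: ev_near_eq; last exact: gsmooth_moderate (gsmooth_pd i fs) xX.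
move=> e e1 Ux; apply: near_eq_derive.
by apply: (open_near (XU.1 e e1) Ux) => y; exact: fg.
Qed.

Lemma ev_pdD i f g : gsmooth X U f -> gsmooth X U g ->
  ev (pd i (fun e y => f e y + g e y)) x = ev (pd i f) x + ev (pd i g) x.
Proof.
move=> fs gs; rewrite -evD; [|exact: gsmooth_pd..].
apply: ev_near_eq; last exact: gsmooth_moderate (gsmooth_pd i (gsmoothD fs gs)) xX.
move=> e e1 Ux; rewrite /pd [LHS](@deriveD _ _ _ (f e) (g e)) //;
  apply: diff_derivable; [exact: gsmooth_diff fs e1 Ux|exact: gsmooth_diff gs e1 Ux].
Qed.

Lemma ev_pdM i f g : gsmooth X U f -> gsmooth X U g ->
  ev (pd i (fun e y => f e y * g e y)) x =
  ev f x * ev (pd i g) x + ev g x * ev (pd i f) x.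
Proof.
move=> fs gs; have dfs := gsmooth_pd i fs; have dgs := gsmooth_pd i gs.
rewrite -(evM fs dgs) -(evM gs dfs) -evD; [|exact: gsmoothM..].
apply: ev_near_eq; last exact: gsmooth_moderate (gsmooth_pd i (gsmoothM fs gs)) xX.
by move=> e e1 Ux; apply: derive_mulE; [exact: gsmooth_diff fs e1 Ux|exact:
  gsmooth_diff gs e1 Ux].
Qed.

Lemma ev_pd_cst i (c : R -> R) : ev (pd i (fun e _ => c e)) x = 0.
Proof.
rewrite -gclass0; congr gclass; apply/funext => e.
by rewrite /pd derive_cst.
Qed.

Lemma ev_pdZ i (c : R) f : gsmooth X U f ->
  ev (pd i (fun e y => c * f e y)) x = cl (cst c) * ev (pd i f) x.
Proof.
move=> fs; rewrite (ev_pdM i (f := fun _ _ => c)) //; last first.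
  by apply: gsmooth_cst; exact: moderate_cst.
by rewrite ev_pd_cst mulr0 addr0.
Qed.

Lemma ev_pd_sum (I : finType) i (f : I -> R -> 'rV[R]_n -> R) :
  (forall j, gsmooth X U (f j)) ->
  ev (pd i (fun e y => \sum_j f j e y)) x = \sum_j ev (pd i (f j)) x.
Proof.
move=> fs; suff: gsmooth X U (fun e y => \sum_j f j e y) /\
    ev (pd i (fun e y => \sum_j f j e y)) x = \sum_j ev (pd i (f j)) x by case.
elim: (index_enum I) => [|j s [IHs IH]].
  under eq_fun => e do under eq_fun => y do rewrite big_nil.
  split; first by apply: gsmooth_cst; exact: moderate_cst.
  by rewrite big_nil; exact: ev_pd_cst.
under eq_fun => e do under eq_fun => y do rewrite big_cons.
by split; [exact: gsmoothD|rewrite ev_pdD // IH big_cons].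
Qed.

Lemma ev_pd_comp k i (Y : set 'rV[GR]_k) V (f : R -> 'rV[R]_k -> R) (g : R ->
  'rV[R]_n -> 'rV[R]_k) :
  (forall e x, 0 < e <= 1 -> U e x -> V e (g e x)) ->
  (forall x, nets X x -> nets Y (fun e => g e (x e))) ->
  gsmooth Y V f -> (forall j, gsmooth X U (fun e x => g e x 0 j)) ->
  ev (pd i (fun e y => f e (g e y))) x =
  \sum_j ev (pd j f) (fun e => g e (x e)) * ev (pd i (fun e y => g e y 0 j)) x.
Proof.
move=> UV XY fs gs.
have cs h : gsmooth Y V h -> gsmooth X U (fun e y => h e (g e y)).
  by move=> hs; exact: gsmooth_comp UV XY hs gs.
transitivity (ev (fun e y => \sum_j pd j f e (g e y) * pd i (fun e y =>
  g e y 0 j) e y) x).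
  apply: ev_near_eq; last exact: gsmooth_moderate (gsmooth_pd i (cs f fs)) xX.
  move=> e e1 Ux; apply: derive_chain => [|j]; last exact: gsmooth_diff (gs j) e1 Ux.
  exact: (tame_diff (fs 0%N) e1 (UV _ _ e1 Ux)).
have gds j := gsmooth_pd i (gs j).
have fds j := cs _ (gsmooth_pd j fs).
rewrite ev_sum => [|j]; last exact: gsmoothM.
by apply: eq_bigr => j _; rewrite evM.
Qed.

Lemma ev_pd_comm i j f : gsmooth X U f ->
  ev (pd i (pd j f)) x = ev (pd j (pd i f)) x.
Proof.
move=> fs; have dfi := gsmooth_pd i fs; have dfj := gsmooth_pd j fs.
have dij := gsmooth_pd i dfj; have dji := gsmooth_pd j dfi.
apply: ev_near_eq; last exact: gsmooth_moderate dij xX.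
move=> e e1 Ux; apply: derive_comm.
- apply: (open_near (XU.1 e e1) Ux) => y Uy; split.
  + exact: gsmooth_diff fs e1 Uy.
  + exact: gsmooth_diff dfj e1 Uy.
  + exact: gsmooth_diff dfi e1 Uy.
- by apply: differentiable_continuous; exact: gsmooth_diff dij e1 Ux.
- by apply: differentiable_continuous; exact: gsmooth_diff dji e1 Ux.
Qed.

End AtPoint.
End OnDomain.

End Evaluation.

(** * Restriction to coordinate lines *)

Section Slices.
Context {R : realType} {rho : gauge R}.
Local Notation GR := (GR rho).
Local Notation cl := (@gclass R rho).
Local Notation moderate := (moderate rho).
Local Notation vmoderate := (vmoderate (rho := rho)).
Local Notation gvec := (@gvec R rho _).
Local Notation δ i := (delta_mx 0 i).

Definition put n (i : 'I_n) (x : 'rV[R]_n) (y : 'rV[R]_1) : 'rV[R]_n :=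
  \row_k if k == i then y 0 0 else x 0 k.

Lemma put_id n (i : 'I_n) x : put i x (const_mx (x 0 i)) = x.
Proof. by apply/rowP => k; rewrite !mxE; case: eqP => [->|]. Qed.

Lemma put_affine n (i : 'I_n) x (y : 'rV[R]_1) h :
  put i x (h *: δ ord0 + y) = h *: δ i + put i x y.
Proof.
apply/rowP => k; rewrite !mxE !eqxx /=; case: (k == i); first by [].
by rewrite mulr0 add0r.
Qed.

Lemma pt_class tau : pt (cl tau) = gvec (fun e => const_mx (tau e)).
Proof.
by apply/rowP => i; rewrite !mxE; congr gclass; apply/funext => e; rewrite mxE.
Qed.

Lemma const_moderate tau : moderate tau -> vmoderate (fun e =>
  const_mx (tau e) : 'rV[R]_1).
Proof.
by move=> tm; apply/vmoderateP => i; under eq_fun do rewrite mxE.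
Qed.

Lemma gdomT n (X : set 'rV[GR]_n) : gdom X (fun _ => setT).
Proof.
split=> [e _|a _ x _]; first exact: openT.
exact: filterE.
Qed.

Lemma gsmooth_put n (X : set 'rV[GR]_1) U (i : 'I_n) x : gdom X U -> vmoderate x ->
  forall j, gsmooth X U (fun e y => put i (x e) y 0 j).
Proof.
move=> XU xm j.
have [ji|ji] := eqVneq j i.
  apply: (@gsmooth_eq _ _ _ _ _ XU (fun e y => y 0 0)); last exact: gsmooth_coord.
  by move=> e y _ _; rewrite mxE ji eqxx.
apply: (@gsmooth_eq _ _ _ _ _ XU (fun e y => x e 0 j)).
  by move=> e y _ _; rewrite mxE (negbTE ji).
by apply: gsmooth_cst => //; exact: vmoderate_coord.
Qed.

Section Slice.
Variables (n k : nat) (X : set 'rV[GR]_n) (U : R -> set 'rV[R]_n).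
Variables (fe : R -> 'rV[R]_n -> 'rV[R]_k) (D : set GR) (g : GR -> 'rV[GR]_k).
Variables (i : 'I_n) (x : R -> 'rV[R]_n).
Hypothesis XU : gdom X U.
Hypothesis fs : forall j, gsmooth X U (fun e y => fe e y 0 j).
Hypothesis xX : nets X x.
Hypothesis xD : forall y, nets (line D) y -> nets X (fun e => put i (x e) (y e)) /\
  g (cl (fun e => y e 0 0)) = gvec (fun e => fe e (put i (x e) (y e))).

Lemma slice_defined_by : defined_by (line D) (lift1 g)
  (fun e => setT `&` put i (x e) @^-1` U e) (fun e y => fe e (put i (x e) y)).
Proof.
have xm := xX.1.
have YU : gdom (line D) (fun e => setT `&` put i (x e) @^-1` U e).
  apply: (gdom_preimage (gdomT _) XU); first exact: gsmooth_put (gdomT _) xm.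
  by move=> y /xD [].
apply: gsmooth_defined_by => //.
  move=> j; apply: (gsmooth_comp YU _ _ (fs j)).
  - by move=> e y _ [_].
  - by move=> y /xD [].
  - exact: gsmooth_put YU xm.
by move=> y /xD [_ <-]; rewrite /lift1 mxE.
Qed.

(** Turns derivatives of functions of one variable, such as those in t or in s of T_s and L_s along
    the curve, into partial derivatives of a single net in several variables. *)
Lemma slice_deriv : sharp_interior (line D) (pt (cl (fun e => x e 0 i))) ->
  gderivv D g (cl (fun e => x e 0 i)) =
  \row_j ev (rho := rho) (pd i (fun e y => fe e y 0 j)) x.
Proof.
have xm := xX.1; have tm := const_moderate (vmoderate_coord i xm).
rewrite /gderivv pt_class => ti.
rewrite (gpartialE_int _ slice_defined_by tm ti); apply/rowP => j.
rewrite [RHS]mxE.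
apply: etrans (partial1_class _ _ slice_defined_by (sharp_interior_sub tm ti)) _.
rewrite /ev; congr gclass; apply/funext => e; rewrite /pd.
rewrite (@derive_affine _ _ _ _ (fun y => fe e y 0 j) (put i (x e)) _ _ (δ i)
  (put_affine _ _ _)).
by rewrite put_id.
Qed.

End Slice.

(** * Open intervals of generalized numbers *)

Section Intervals.
Variables (a b : GR).
Hypothesis ab : glt a b.

Lemma gooP x : moderate x -> goo a b (cl x) <->
  exists n : nat, \forall e \near 0^'+,
    grepr a e + rho e ^+ n <= x e /\ x e + rho e ^+ n <= grepr b e.
Proof.
move=> xm; rewrite /goo /= -{1}(greprK a) -{1}(greprK b).
split=> [[]|[n h]].
  move=> /(glt_repP (grepr_moderate _) xm) [n hn] /(glt_repP xm (grepr_moderate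
    _)) [m hm].
  exists (n + m)%N.
  apply: filterS2 (filterI hn (gauge_near_leX rho (leq_addr m n)))
    (filterI hm (gauge_near_leX rho (leq_addl n m))) => e [h1 h2] [h3 h4].
  split; [apply: le_trans h1|apply: le_trans h3]; by rewrite lerD2l.
by split; apply/glt_repP => //; try exact: grepr_moderate; exists n;
  apply: filterS h => e [].
Qed.

Lemma goo_gcc : goo a b `<=` gcc a b.
Proof. by move=> t [h1 h2]; split; exact: glt_gle. Qed.

Lemma goo_interior t : goo a b t -> sharp_interior (line (goo a b)) (pt t).
Proof.
rewrite -(greprK t) => /(gooP (grepr_moderate t)) [n h].
have tm := grepr_moderate t; rewrite pt_class.
apply/sharp_interiorP; first exact: const_moderate.
exists n.+1 => y ym ty; rewrite /line /= mxE.
apply/(gooP (vmoderate_coord 0 ym)); exists n.+1.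
near=> e.
have d2 : rho e ^+ n.+1 *+ 2 <= rho e ^+ n by near: e; exact: gauge_near_double.
have : `|y e 0 0 - (const_mx (grepr t e) : 'rV[R]_1) 0 0| <= rho e ^+ n.+1.
  by near: e; exact: ty.
have [h1 h2] : grepr a e + rho e ^+ n <= grepr t e /\
  grepr t e + rho e ^+ n <= grepr b e.
  by near: e.
rewrite mxE ler_norml => /andP[h3 h4]; move: d2; rewrite mulr2n => d2.
by split; lra.
Unshelve. all: by end_near. Qed.

(** The weight varies with e, but both nets keep the margin rho^(n+m) from the end points, and it
    survives a convex combination at each index. *)
Lemma goo_btw x y t : moderate x -> moderate y -> (forall e, 0 <= t e <= 1) ->
  goo a b (cl x) -> goo a b (cl y) -> moderate (fun e => x e + t e * (y e - x e)) ->
  goo a b (cl (fun e => x e + t e * (y e - x e))).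
Proof.
move=> xm ym t01 /(gooP xm) [n hn] /(gooP ym) [m hm] xym.
apply/gooP => //; exists (n + m)%N.
have hn' : \forall e \near 0^'+, grepr a e + rho e ^+ (n + m) <= x e /\
  x e + rho e ^+ (n + m) <= grepr b e.
  apply: filterS2 hn (gauge_near_leX rho (leq_addr m n)) => e [h1 h2] h3; split; lra.
have hm' : \forall e \near 0^'+, grepr a e + rho e ^+ (n + m) <= y e /\
  y e + rho e ^+ (n + m) <= grepr b e.
  apply: filterS2 hm (gauge_near_leX rho (leq_addl n m)) => e [h1 h2] h3; split; lra.
apply: filterS2 hn' hm' => e [h1 h2] [h3 h4].
have /andP[t0 t1] := t01 e; have t1' : 0 <= 1 - t e by rewrite subr_ge0.
rewrite (_ : x e + _ = (1 - t e) * x e + t e * y e); last by ring.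
split.
  by have := lerD (ler_wpM2l t1' h1) (ler_wpM2l t0 h3); rewrite -mulrDl subrK mul1r.
rewrite -lerBrDr; rewrite -lerBrDr in h2; rewrite -lerBrDr in h4.
by have := lerD (ler_wpM2l t1' h2) (ler_wpM2l t0 h4); rewrite -mulrDl subrK mul1r.
Qed.

Lemma goo_nonempty : exists t, goo a b t.
Proof.
have am := grepr_moderate a; have bm := grepr_moderate b.
have mm : moderate (fun e => (grepr a e + grepr b e) * 2^-1).
  by apply: moderateM; [exact: moderateD|exact: (moderate_cst rho 2^-1)].
exists (cl (fun e => (grepr a e + grepr b e) * 2^-1)); apply/gooP => //.
have [n hn] := near_slab_width ab; exists n.+1.
apply: filterS2 hn (gauge_near_double n) => e h; rewrite mulr2n => d2.
by split; lra.
Qed.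

End Intervals.
End Slices.

(** * The Lagrangian along an extremal *)

Section Extremal.
Context {R : realType} {rho : gauge R}.
Local Notation GR := (GR rho).
Local Notation cl := (@gclass R rho).
Local Notation moderate := (moderate rho).
Local Notation vmoderate := (vmoderate (rho := rho)).
Local Notation gvec := (@gvec R rho _).
Local Notation ev := (@ev R rho _).

Lemma gvec_row_mx m n (x : R -> 'rV[R]_m) (y : R -> 'rV[R]_n) :
  gvec (fun e => row_mx (x e) (y e)) = row_mx (gvec x) (gvec y).
Proof.
apply/rowP => k; case: (split_ordP k) => k' ->.
  rewrite row_mxEl [LHS]mxE [RHS]mxE; congr gclass; apply/funext => e.
  by rewrite row_mxEl.
rewrite row_mxEr [LHS]mxE [RHS]mxE; congr gclass; apply/funext => e.
by rewrite row_mxEr.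
Qed.

Lemma vmoderate_row_mx m n (x : R -> 'rV[R]_m) (y : R -> 'rV[R]_n) :
  vmoderate x -> vmoderate y -> vmoderate (fun e => row_mx (x e) (y e)).
Proof.
move=> xm ym; apply/vmoderateP => k; case: (split_ordP k) => k' ->.
  by under eq_fun do rewrite row_mxEl; exact: vmoderate_coord.
by under eq_fun do rewrite row_mxEr; exact: vmoderate_coord.
Qed.

Lemma gsmooth_row_mx n (X : set 'rV[GR]_n) U k l (f : R -> 'rV[R]_n -> 'rV[R]_k)
    (g : R -> 'rV[R]_n -> 'rV[R]_l) :
  (forall j, gsmooth X U (fun e x => f e x 0 j)) ->
  (forall j, gsmooth X U (fun e x => g e x 0 j)) ->
  forall j, gsmooth X U (fun e x => row_mx (f e x) (g e x) 0 j).
Proof.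
move=> fs gs j; case: (split_ordP j) => j' ->.
  under eq_fun => e do under eq_fun => x do rewrite row_mxEl.
  exact: fs.
under eq_fun => e do under eq_fun => x do rewrite row_mxEr.
exact: gs.
Qed.

Lemma gfst_gpair n (t : GR) (l : 'rV[GR]_n) : gfst (gpair t l) = t.
Proof. by rewrite /gfst /gpair row_mxKl mxE. Qed.

Lemma gsnd_gpair n (t : GR) (l : 'rV[GR]_n) : gsnd (gpair t l) = l.
Proof. by rewrite /gsnd /gpair row_mxKr. Qed.

Lemma gfstE n (x : 'rV[GR]_(1 + n)) : gfst x = x 0 (lshift n 0).
Proof. by rewrite /gfst mxE. Qed.

Lemma line_pt (D : set GR) tau : moderate tau -> D (cl tau) ->
  nets (line D) (fun e => const_mx (tau e)).
Proof.
by move=> tm Dt; split; [exact: const_moderate|rewrite -pt_class /line /= mxE].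
Qed.

Lemma line_net (D : set GR) y : nets (line D) y -> D (cl (fun e => y e 0 0)).
Proof. by move=> [_]; rewrite /line /= mxE. Qed.

Lemma pt_net (y : R -> 'rV[R]_1) : pt (cl (fun e => y e 0 0)) = gvec y.
Proof. by apply/rowP => i; rewrite !mxE ord1. Qed.

Lemma slab_gprod (a b : GR) n :
  (gprod (gcc a b) setT : set 'rV[GR]_(1 + n)) = @slab R rho a b n.
Proof.
by apply/seteqP; split=> x; rewrite /gprod /slab /= gfstE;
  rewrite (_ : lshift n 0 = ord0) //; try exact/val_inj; case.
Qed.

Variables (d : nat) (a b : GR).
Hypothesis ab : glt a b.
Variables (F : GR -> 'rV[GR]_d -> 'rV[GR]_d -> GR) (u : GR -> 'rV[GR]_d).
Variables (UF : R -> set 'rV[R]_(1 + (d + d)))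
          (Fe : R -> 'rV[R]_(1 + (d + d)) -> 'rV[R]_1).
Variables (Uu : R -> set 'rV[R]_1) (ue : R -> 'rV[R]_1 -> 'rV[R]_d).
Hypothesis hF : defined_by (lagr_dom a b) (lagr_map F) UF Fe.
Hypothesis hu : defined_by (line (gcc a b)) (lift1 u) Uu ue.
Hypothesis EL : euler_lagrange a b F u.

Let du := gderivv (gcc a b) u.
Let I := line (gcc a b).
Let phi : R -> 'rV[R]_(1 + (d + d)) -> R := fun e x => Fe e x 0 0.
Let cu j : R -> 'rV[R]_1 -> R := fun e y => ue e y 0 j.
Let cv j := pd ord0 (cu j).
Definition idx_u (j : 'I_d) : 'I_(1 + (d + d)) := rshift 1 (lshift d j).
Definition idx_v (j : 'I_d) : 'I_(1 + (d + d)) := rshift 1 (rshift d j).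

(* The net (t, u, u'), at which the Lagrangian and its gradients are evaluated. *)
Definition jet e (y : 'rV[R]_1) : 'rV[R]_(1 + (d + d)) :=
  row_mx y (row_mx (ue e y) (\row_j cv j e y)).
Definition jet_dom e := Uu e `&` jet e @^-1` UF e.
Definition momentum j : R -> 'rV[R]_1 -> R := fun e y => pd (idx_v j) phi e (jet e y).

Lemma curve_value y : nets I y -> u (cl (fun e => y e 0 0)) = gvec (fun e =>
  ue e (y e)).
Proof. by move=> yI; have [_] := defined_by_val hu yI; rewrite /lift1 mxE. Qed.

(** [du] is a derivative on the closed interval; [gpartialE_slab] covers the points of [a, b] that
    are not sharply interior. *)
Lemma velocity_value y : nets I y ->
  du (cl (fun e => y e 0 0)) = gvec (fun e => \row_j cv j e (y e)).
Proof.
move=> yI; rewrite /du /gderivv pt_net.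
have hu' : defined_by (@slab R rho a b 0) (lift1 u) Uu ue := hu.
apply: etrans (gpartialE_slab ab _ hu' yI) _.
apply/rowP => j; apply: etrans (partial1_class _ _ hu yI) _.
by rewrite !mxE; congr gclass; apply/funext => e; rewrite mxE.
Qed.

Lemma cu_gsmooth j : gsmooth I Uu (cu j).
Proof. exact: defined_by_gsmooth hu. Qed.

Lemma phi_gsmooth : gsmooth (lagr_dom a b) UF phi.
Proof. exact: defined_by_gsmooth hF. Qed.

Lemma jet_gsmooth0 j : gsmooth I Uu (fun e y => jet e y 0 j).
Proof.
apply: gsmooth_row_mx => [k|k].
  by rewrite ord1; apply: gsmooth_coord; exact: defined_by_gdom hu.
move: k; apply: gsmooth_row_mx => k; first exact: cu_gsmooth.
under eq_fun => e do under eq_fun => x do rewrite mxE.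
exact: gsmooth_pd (cu_gsmooth k).
Qed.

Lemma jet_moderate y : nets I y -> vmoderate (fun e => jet e (y e)).
Proof.
by move=> yI; apply/vmoderateP => j; exact: gsmooth_moderate (jet_gsmooth0 j) yI.
Qed.

Lemma jet_value y : nets I y -> let t := cl (fun e => y e 0 0) in
  gvec (fun e => jet e (y e)) = gpair t (row_mx (u t) (du t)).
Proof.
move=> yI /=; rewrite curve_value // velocity_value // /gpair pt_net.
by rewrite !gvec_row_mx.
Qed.

Lemma jet_nets y : nets I y -> nets (lagr_dom a b) (fun e => jet e (y e)).
Proof.
move=> yI; split; first exact: jet_moderate.
rewrite jet_value //; split => //; rewrite gfst_gpair; exact: line_net.
Qed.

Lemma jet_gdom : gdom I jet_dom.
Proof.
apply: gdom_preimage (defined_by_gdom hu) (defined_by_gdom hF) jet_gsmooth0 _.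
exact: jet_nets.
Qed.

Lemma jet_gsmooth j : gsmooth I jet_dom (fun e y => jet e y 0 j).
Proof. by apply: gsmooth_sub (jet_gsmooth0 j) => // e y []. Qed.

Lemma gsmooth_jet f : gsmooth (lagr_dom a b) UF f ->
  gsmooth I jet_dom (fun e y => f e (jet e y)).
Proof.
move=> fs; apply: (gsmooth_comp jet_gdom _ _ fs) => [e y _ []//||];
  first exact: jet_nets.
exact: jet_gsmooth.
Qed.

Lemma lagr_value w t l v : nets (lagr_dom a b) w -> gvec w = gpair t (row_mx l v) ->
  F t l v = ev phi w.
Proof.
move=> wX wE; have [_] := defined_by_val hF wX.
rewrite wE /lagr_map gfst_gpair gsnd_gpair row_mxKl row_mxKr => /rowP /(_ 0).
by rewrite !mxE.
Qed.

Lemma lagr_partial_value w i : nets (lagr_dom a b) w ->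
  gpartial (lagr_dom a b) (lagr_map F) [:: i] (gvec w) 0 0 = ev (pd i phi) w.
Proof.
move=> wX.
have E : lagr_dom a b = @slab R rho a b (d + d) by exact: slab_gprod.
have hF' : defined_by (@slab R rho a b (d + d)) (lagr_map F) UF Fe by rewrite -E.
have wX' : nets (@slab R rho a b (d + d)) w by rewrite -E.
have := gpartialE_slab ab i hF' wX'; rewrite -E => ->.
exact: partial1_class hF wX.
Qed.

Lemma lagr_udot_value y j : nets I y -> let t := cl (fun e => y e 0 0) in
  lagr_udot a b F j t (u t) (du t) = ev (momentum j) y.
Proof.
move=> yI /=; rewrite /lagr_udot -jet_value //.
exact: lagr_partial_value (jet_nets yI).
Qed.

Lemma lagr_u_value y j : nets I y -> let t := cl (fun e => y e 0 0) in
  lagr_u a b F j t (u t) (du t) = ev (pd (idx_u j) phi) (fun e => jet e (y e)).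
Proof.
move=> yI /=; rewrite /lagr_u -jet_value //.
exact: lagr_partial_value (jet_nets yI).
Qed.

Lemma momentum_gsmooth j : gsmooth I jet_dom (momentum j).
Proof. by apply: gsmooth_jet; exact: gsmooth_pd phi_gsmooth. Qed.

(** The values of [lagr_udot] along the curve come from the net [momentum j] on all of [a, b]. That
    net therefore defines a generalized smooth function, and the outer derivative in t is the class
    of its ordinary derivative. *)
Lemma euler_lagrange_value y j : nets I y ->
  ev (pd ord0 (momentum j)) y = ev (pd (idx_u j) phi) (fun e => jet e (y e)).
Proof.
move=> yI; rewrite -lagr_u_value //.
have := EL (line_net yI) j; rewrite -/du => /subr0_eq ->.
pose h t := lagr_udot a b F j t (u t) (du t).
have hD : defined_by I (lift1 (fun t => pt (h t))) jet_dom (fun e y =>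
  const_mx (momentum j e y)).
  apply: gsmooth_defined_by jet_gdom _ _ => [k|w wI].
    under eq_fun => e do under eq_fun => x do rewrite mxE.
    exact: momentum_gsmooth.
  rewrite /lift1 mxE /h lagr_udot_value // /ev -pt_class //.
rewrite /gderiv /gderivv -/h pt_net.
have hD' : defined_by (@slab R rho a b 0) (lift1 (fun t =>
  pt (h t))) jet_dom (fun e y => const_mx (momentum j e y)) := hD.
rewrite -[line (gcc a b)]/(@slab R rho a b 0) (gpartialE_slab ab _ hD' yI).
rewrite (partial1_class _ _ hD yI); congr gclass; apply/funext => e.
by rewrite /pd; under [in RHS]eq_fun do rewrite mxE.
Qed.

End Extremal.

(** * Invariance and the conserved quantity *)

Section Variation.
Context {R : realType} {rho : gauge R}.
Local Notation GR := (GR rho).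
Local Notation cl := (@gclass R rho).
Local Notation moderate := (moderate rho).
Local Notation vmoderate := (vmoderate (rho := rho)).
Local Notation vclose := (vclose (rho := rho)).
Local Notation gvec := (@gvec R rho _).
Local Notation ev := (@ev R rho _).

Lemma gclassV c : moderate c -> cl c \is a GRing.unit ->
  cl (fun e => (c e)^-1) = (cl c)^-1.
Proof.
move=> cm cu; have im := unit_inv_moderate cm cu.
apply: (mulIr cu); rewrite mulVr // -gclassM // -gclass1.
apply: gclass_near_eq; first exact: moderateM.
have [n h] := proj1 (gclass_unitP cm) cu.
apply: filterS2 h (gauge_near01 rho) => e h [r0 _ _].
by rewrite mulVf // -normr_gt0 (lt_le_trans _ h) // exprn_gt0.
Qed.

Variables (d : nat) (a b : GR).
Hypothesis ab : glt a b.
Variables (F : GR -> 'rV[GR]_d -> 'rV[GR]_d -> GR) (u : GR -> 'rV[GR]_d).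
Variables (UF : R -> set 'rV[R]_(1 + (d + d)))
          (Fe : R -> 'rV[R]_(1 + (d + d)) -> 'rV[R]_1).
Variables (Uu : R -> set 'rV[R]_1) (ue : R -> 'rV[R]_1 -> 'rV[R]_d).
Hypothesis hF : defined_by (lagr_dom a b) (lagr_map F) UF Fe.
Hypothesis hu : defined_by (line (gcc a b)) (lift1 u) Uu ue.
Hypothesis EL : euler_lagrange a b F u.
Variables (J : set GR) (X : GR -> 'rV[GR]_(1 + d) -> 'rV[GR]_(1 + d)).
Variables (UX : R -> set 'rV[R]_(1 + (1 + d)))
          (Xe : R -> 'rV[R]_(1 + (1 + d)) -> 'rV[R]_(1 + d)).
Hypothesis J0 : sharp_interior (line J) (pt 0).
Hypothesis XY : forall x, gprod J (gprod (goo a b) setT) x ->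
  (gprod (goo a b) setT : set 'rV[GR]_(1 + d)) (X (gfst x) (gsnd x)).
Hypothesis hX : defined_by (gprod J (gprod (goo a b) setT))
  (fun x => X (gfst x) (gsnd x)) UX Xe.

Let du := gderivv (gcc a b) u.
Let I := line (gcc a b).
Let phi : R -> 'rV[R]_(1 + (d + d)) -> R := fun e x => Fe e x 0 0.
Let cu j : R -> 'rV[R]_1 -> R := fun e y => ue e y 0 j.
Let cv j := pd ord0 (cu j).
Let T s t l := gfst (X s (gpair t l)).
Let L s t l := gsnd (X s (gpair t l)).
Let dtT s t := gderiv (goo a b) (fun t' => T s t' (u t')) t.
Let dtL s t := gderivv (goo a b) (fun t' => L s t' (u t')) t.

Hypothesis dtT_unit : forall t s, goo a b t -> J s -> dtT s t \is a GRing.unit.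
Hypothesis T0 : forall t, goo a b t -> T 0 t (u t) = t.
Hypothesis L0 : forall t, goo a b t -> L 0 t (u t) = u t.
Hypothesis invariance : forall t s, goo a b t -> J s ->
  F t (u t) (du t) = F (T s t (u t)) (L s t (u t)) ((dtT s t)^-1 *: dtL s t) *
    dtT s t.

(** * Nets in the variables (s, t) along the varied curve *)

Definition i_s : 'I_2 := ord0.
Definition i_t : 'I_2 := ord_max.

(* The plane of the parameters (s, t); the nets below are restricted, in turn, to
   the open sets where the curve u, the family X, the quotient L' / T' and the
   Lagrangian at (T, L, L' / T') are defined. *)
Definition param_dom : set 'rV[GR]_2 := [set z | J (z 0 i_s) /\ goo a b (z 0 i_t)].

Definition prj (z : 'rV[R]_2) : 'rV[R]_1 := const_mx (z 0 i_t).

Definition graph e (z : 'rV[R]_2) : 'rV[R]_(1 + (1 + d)) :=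
  row_mx (const_mx (z 0 i_s)) (row_mx (prj z) (ue e (prj z))).

Let Uj := jet_dom UF Uu ue.
(** The preimage of the domain of the whole jet, not of the curve alone, since momentum and energy
    are composed with [prj] later; [setT] gives the shape produced by [gdom_preimage]. *)
Definition dom_curve e := setT `&` prj @^-1` Uj e.
Definition dom_graph e := dom_curve e `&` graph e @^-1` UX e.

Let cT (z : R -> 'rV[R]_2) := cl (fun e => z e 0 i_t).
Let cS (z : R -> 'rV[R]_2) := cl (fun e => z e 0 i_s).

Lemma param_domP z : nets param_dom z -> [/\ moderate (fun e => z e 0 i_s),
  moderate (fun e => z e 0 i_t), J (cS z) & goo a b (cT z)].
Proof.
move=> [zm]; rewrite /param_dom /= !mxE => -[zJ zt].
by split => //; exact: vmoderate_coord.
Qed.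

Lemma prj_nets z : nets param_dom z -> nets I (fun e => prj (z e)).
Proof. by move=> /param_domP[_ tm _ tg]; apply: line_pt => //; exact: goo_gcc. Qed.

Lemma prj_class (z : R -> 'rV[R]_2) : cl (fun e => prj (z e) 0 0) = cT z.
Proof. by congr gclass; apply/funext => e; rewrite mxE. Qed.

Lemma prj_gsmooth0 U : gdom param_dom U -> forall j,
  gsmooth param_dom U (fun e z => prj z 0 j).
Proof.
move=> YU j; under eq_fun => e do under eq_fun => x do rewrite mxE.
exact: gsmooth_coord.
Qed.

Lemma dom_curve_gdom : gdom param_dom dom_curve.
Proof.
exact: (gdom_preimage (g := fun _ => prj) (gdomT _) (jet_gdom ab hF hu)
  (prj_gsmooth0 (gdomT _)) prj_nets).
Qed.

Lemma gsmooth_prj U f : gdom param_dom U -> (forall e, U e `<=` dom_curve e) ->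
  gsmooth I Uj f -> gsmooth param_dom U (fun e z => f e (prj z)).
Proof.
move=> YU UW fs; apply: (gsmooth_comp YU _ prj_nets fs); last exact: prj_gsmooth0.
by move=> e z _ /UW [].
Qed.

Lemma cu_gsmooth_jet j : gsmooth I Uj (cu j).
Proof. by apply: gsmooth_sub (cu_gsmooth hu j) => // e y []. Qed.

Lemma graph_gsmooth U : gdom param_dom U -> (forall e, U e `<=` dom_curve e) ->
  forall j, gsmooth param_dom U (fun e z => graph e z 0 j).
Proof.
move=> YU UW; apply: gsmooth_row_mx => [j|].
  under eq_fun => e do under eq_fun => x do rewrite mxE.
  exact: gsmooth_coord.
apply: gsmooth_row_mx; first exact: prj_gsmooth0.
by move=> j; exact: gsmooth_prj YU UW (cu_gsmooth_jet j).
Qed.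

Lemma graph_value z : nets param_dom z ->
  gvec (fun e => graph e (z e)) = gpair (cS z) (gpair (cT z) (u (cT z))).
Proof.
move=> zY; rewrite /graph !gvec_row_mx -(curve_value hu (prj_nets zY)) prj_class.
by rewrite /gpair /prj -!pt_class.
Qed.

Lemma graph_nets z : nets param_dom z ->
  nets (gprod J (gprod (goo a b) setT)) (fun e => graph e (z e)).
Proof.
move=> zY; have [sm tm zJ zt] := param_domP zY; split; last first.
  by rewrite graph_value // /gprod /= !gfst_gpair !gsnd_gpair gfst_gpair.
have um : vmoderate (fun e => ue e (prj (z e))).
  by have [] := defined_by_val hu (prj_nets zY).
apply: vmoderate_row_mx; first exact: const_moderate.
by apply: vmoderate_row_mx um; exact: const_moderate.
Qed.

Lemma dom_graph_gdom : gdom param_dom dom_graph.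
Proof.
apply: gdom_preimage dom_curve_gdom (defined_by_gdom hX) _ graph_nets.
exact: graph_gsmooth dom_curve_gdom (fun e => @subset_refl _ _).
Qed.

Definition Tcurve e (z : 'rV[R]_2) : R := Xe e (graph e z) 0 (lshift d 0).
Definition Lcurve (j : 'I_d) e (z : 'rV[R]_2) : R := Xe e (graph e z) 0 (rshift 1 j).

Lemma Xe_gsmooth j : gsmooth param_dom dom_graph (fun e z => Xe e (graph e z) 0 j).
Proof.
apply: (gsmooth_comp dom_graph_gdom _ graph_nets (defined_by_gsmooth j hX)).
  by move=> e z _ [].
by apply: graph_gsmooth dom_graph_gdom _ => e z [].
Qed.

Lemma Tcurve_gsmooth : gsmooth param_dom dom_graph Tcurve. Proof. exact:
  Xe_gsmooth. Qed.
Lemma Lcurve_gsmooth j : gsmooth param_dom dom_graph (Lcurve j). Proof. exact: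
  Xe_gsmooth. Qed.

Lemma X_value z : nets param_dom z ->
  X (cS z) (gpair (cT z) (u (cT z))) = gvec (fun e => Xe e (graph e (z e))).
Proof.
move=> zY; have [_] := defined_by_val hX (graph_nets zY).
by rewrite graph_value // gfst_gpair gsnd_gpair.
Qed.

Lemma T_value z : nets param_dom z -> T (cS z) (cT z) (u (cT z)) = ev Tcurve z.
Proof. by move=> zY; rewrite /T X_value // gfstE mxE. Qed.

Lemma L_value z : nets param_dom z ->
  L (cS z) (cT z) (u (cT z)) = gvec (fun e => \row_j Lcurve j e (z e)).
Proof.
move=> zY; rewrite /L X_value //; apply/rowP => j; rewrite !mxE.
by congr gclass; apply/funext => e; rewrite mxE.
Qed.

(** The family X takes values over (a, b), which keeps the varied curve in the domain of F. *)
Lemma T_goo z : nets param_dom z -> goo a b (ev Tcurve z).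
Proof.
move=> zY; rewrite -T_value //; have [_ _ zJ zt] := param_domP zY.
have [|] := XY (x := gpair (cS z) (gpair (cT z) (u (cT z)))).
  by split; rewrite ?gfst_gpair //; split; rewrite gsnd_gpair // gfst_gpair.
by rewrite gfst_gpair gsnd_gpair.
Qed.

Lemma put_t z y : nets param_dom z -> nets (line (goo a b)) y ->
  [/\ nets param_dom (fun e => put i_t (z e) (y e)),
    cS (fun e => put i_t (z e) (y e)) = cS z &
      cT (fun e => put i_t (z e) (y e)) = cl (fun e => y e 0 0)].
Proof.
move=> zY yD; have [sm tm zJ zt] := param_domP zY.
have sE : cS (fun e => put i_t (z e) (y e)) = cS z.
  by congr gclass; apply/funext => e; rewrite mxE.
have tE : cT (fun e => put i_t (z e) (y e)) = cl (fun e => y e 0 0).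
  by congr gclass; apply/funext => e; rewrite mxE.
split => //; split.
  apply/vmoderateP => k; have [->|k1] := eqVneq k i_t.
    by under eq_fun do rewrite mxE eqxx; exact: vmoderate_coord yD.1.
  by under eq_fun do rewrite mxE (negbTE k1); exact: vmoderate_coord zY.1.
rewrite /param_dom /= !mxE -/(cS _) -/(cT _) sE tE; split => //; exact: line_net.
Qed.

Lemma put_s z y : nets param_dom z -> nets (line J) y ->
  [/\ nets param_dom (fun e => put i_s (z e) (y e)),
    cT (fun e => put i_s (z e) (y e)) = cT z &
      cS (fun e => put i_s (z e) (y e)) = cl (fun e => y e 0 0)].
Proof.
move=> zY yD; have [sm tm zJ zt] := param_domP zY.
have sE : cT (fun e => put i_s (z e) (y e)) = cT z.
  by congr gclass; apply/funext => e; rewrite mxE.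
have tE : cS (fun e => put i_s (z e) (y e)) = cl (fun e => y e 0 0).
  by congr gclass; apply/funext => e; rewrite mxE.
split => //; split.
  apply/vmoderateP => k; have [->|k1] := eqVneq k i_s.
    by under eq_fun do rewrite mxE eqxx; exact: vmoderate_coord yD.1.
  by under eq_fun do rewrite mxE (negbTE k1); exact: vmoderate_coord zY.1.
rewrite /param_dom /= !mxE -/(cS _) -/(cT _) sE tE; split => //; exact: line_net.
Qed.

Let As e (z : 'rV[R]_2) : 'rV[R]_1 := const_mx (Tcurve e z).
Let Bs e (z : 'rV[R]_2) : 'rV[R]_d := \row_j Lcurve j e z.

Lemma As_gsmooth j : gsmooth param_dom dom_graph (fun e z => As e z 0 j).
Proof.
under eq_fun => e do under eq_fun => x do rewrite mxE.
exact: Tcurve_gsmooth.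
Qed.

Lemma Bs_gsmooth j : gsmooth param_dom dom_graph (fun e z => Bs e z 0 j).
Proof.
under eq_fun => e do under eq_fun => x do rewrite mxE.
exact: Lcurve_gsmooth.
Qed.

Lemma ev_pd_As i z : ev (pd i (fun e y => As e y 0 0)) z = ev (pd i Tcurve) z.
Proof.
congr gclass; apply/funext => e.
by rewrite /pd; under [in LHS]eq_fun do rewrite mxE.
Qed.

Lemma ev_pd_Bs i j z : ev (pd i (fun e y => Bs e y 0 j)) z = ev (pd i (Lcurve j)) z.
Proof.
congr gclass; apply/funext => e.
by rewrite /pd; under [in LHS]eq_fun do rewrite mxE.
Qed.

Lemma dtT_value z : nets param_dom z -> dtT (cS z) (cT z) = ev (pd i_t Tcurve) z.
Proof.
move=> zY; have [_ _ _ zt] := param_domP zY.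
have h y : nets (line (goo a b)) y -> nets param_dom (fun e => put i_t (z e) (y e)) /\
   pt (T (cS z) (cl (fun e => y e 0 0)) (u (cl (fun e => y e 0 0)))) =
   gvec (fun e => As e (put i_t (z e) (y e))).
  move=> yD; have [pY sE tE] := put_t zY yD; split => //.
  by rewrite -tE -sE T_value // pt_class.
have E := slice_deriv (g := fun t => pt (T (cS z) t (u t))) dom_graph_gdom
  As_gsmooth zY h (goo_interior zt).
apply: etrans (congr1 (fun v : 'rV_1 => v 0 0) E) _.
by rewrite mxE; exact: ev_pd_As.
Qed.

Lemma dtL_value z : nets param_dom z -> dtL (cS z) (cT z) =
  \row_j ev (pd i_t (Lcurve j)) z.
Proof.
move=> zY; have [_ _ _ zt] := param_domP zY.
have h y : nets (line (goo a b)) y -> nets param_dom (fun e => put i_t (z e) (y e)) /\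
   L (cS z) (cl (fun e => y e 0 0)) (u (cl (fun e => y e 0 0))) =
   gvec (fun e => Bs e (put i_t (z e) (y e))).
  move=> yD; have [pY sE tE] := put_t zY yD; split => //.
  by rewrite -tE -sE L_value.
have E := slice_deriv (g := fun t => L (cS z) t (u t)) dom_graph_gdom Bs_gsmooth
  zY h (goo_interior zt).
apply: etrans E _; apply/rowP => j; rewrite !mxE; exact: ev_pd_Bs.
Qed.

Lemma dsT_value z : nets param_dom z -> cS z = 0 ->
  gderiv J (fun s => T s (cT z) (u (cT z))) 0 = ev (pd i_s Tcurve) z.
Proof.
move=> zY z0.
have h y : nets (line J) y -> nets param_dom (fun e => put i_s (z e) (y e)) /\
   pt (T (cl (fun e => y e 0 0)) (cT z) (u (cT z))) =
   gvec (fun e => As e (put i_s (z e) (y e))).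
  move=> yD; have [pY sE tE] := put_s zY yD; split => //.
  by rewrite -tE -sE T_value // pt_class.
have zi : sharp_interior (line J) (pt (cS z)) by rewrite z0.
have E := slice_deriv (g := fun s => pt (T s (cT z) (u (cT z)))) dom_graph_gdom
  As_gsmooth zY h zi.
move: E; rewrite -/(cS z) z0 => E.
apply: etrans (congr1 (fun v : 'rV_1 => v 0 0) E) _.
by rewrite mxE; exact: ev_pd_As.
Qed.

Lemma dsL_value z : nets param_dom z -> cS z = 0 ->
  gderivv J (fun s => L s (cT z) (u (cT z))) 0 = \row_j ev (pd i_s (Lcurve j)) z.
Proof.
move=> zY z0.
have h y : nets (line J) y -> nets param_dom (fun e => put i_s (z e) (y e)) /\
   L (cl (fun e => y e 0 0)) (cT z) (u (cT z)) =
   gvec (fun e => Bs e (put i_s (z e) (y e))).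
  move=> yD; have [pY sE tE] := put_s zY yD; split => //.
  by rewrite -tE -sE L_value.
have zi : sharp_interior (line J) (pt (cS z)) by rewrite z0.
have E := slice_deriv (g := fun s => L s (cT z) (u (cT z))) dom_graph_gdom
  Bs_gsmooth zY h zi.
move: E; rewrite -/(cS z) z0 => E.
apply: etrans E _; apply/rowP => j; rewrite !mxE; exact: ev_pd_Bs.
Qed.

Let At := pd i_t Tcurve.
Let Bt j := pd i_t (Lcurve j).

Lemma At_unit z : nets param_dom z -> ev At z \is a GRing.unit.
Proof. by move=> zY; have [_ _ zJ zt] := param_domP zY; rewrite -dtT_value //;
  exact: dtT_unit. Qed.

Definition dom_reg e := dom_graph e `&` [set z | At e z != 0].

Lemma dom_reg_gdom : gdom param_dom dom_reg.
Proof. exact: (gdom_neq0 (f := At) dom_graph_gdom (gsmooth_pd i_t Tcurve_gsmooth)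
  At_unit). Qed.

Lemma dom_reg_graph e : dom_reg e `<=` dom_graph e. Proof. by move=> z []. Qed.

Definition Vcurve j e z := Bt j e z * (At e z)^-1.

Lemma At_gsmooth U : (forall e, U e `<=` dom_reg e) -> gsmooth param_dom U At.
Proof.
move=> UW; apply: gsmooth_sub (gsmooth_pd i_t Tcurve_gsmooth) => // e.
exact: subset_trans (UW e) (@dom_reg_graph e).
Qed.

Lemma Bt_gsmooth U j : (forall e, U e `<=` dom_reg e) -> gsmooth param_dom U (Bt j).
Proof.
move=> UW; apply: gsmooth_sub (gsmooth_pd i_t (Lcurve_gsmooth j)) => // e.
exact: subset_trans (UW e) (@dom_reg_graph e).
Qed.

Lemma Vcurve_gsmooth U j : gdom param_dom U -> (forall e, U e `<=` dom_reg e) ->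
  gsmooth param_dom U (Vcurve j).
Proof.
move=> YU UW; apply: (gsmoothM YU (Bt_gsmooth j UW)).
apply: (gsmoothV YU (At_gsmooth UW) _ At_unit).
by move=> e z _ /UW [].
Qed.

(* The net (T_s, L_s, L_s' / T_s'), with T_s and L_s taken along the curve u. *)
Definition varjet e (z : 'rV[R]_2) : 'rV[R]_(1 + (d + d)) :=
  row_mx (As e z) (row_mx (Bs e z) (\row_j Vcurve j e z)).

Lemma varjet_gsmooth U : gdom param_dom U -> (forall e, U e `<=` dom_reg e) ->
  forall j, gsmooth param_dom U (fun e z => varjet e z 0 j).
Proof.
move=> YU UW.
have U2 e : U e `<=` dom_graph e by exact: subset_trans (UW e) (@dom_reg_graph e).
apply: gsmooth_row_mx => [j|]; first exact: gsmooth_sub (As_gsmooth j).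
apply: gsmooth_row_mx => j; first exact: gsmooth_sub (Bs_gsmooth j).
under eq_fun => e do under eq_fun => x do rewrite mxE.
exact: Vcurve_gsmooth.
Qed.

Lemma Vcurve_value z j : nets param_dom z ->
  ev (Vcurve j) z = ((dtT (cS z) (cT z))^-1 *: dtL (cS z) (cT z)) 0 j.
Proof.
move=> zY; have Am := gsmooth_moderate (gsmooth_pd i_t Tcurve_gsmooth) zY.
have Bm := gsmooth_moderate (gsmooth_pd i_t (Lcurve_gsmooth j)) zY.
rewrite dtT_value // dtL_value // !mxE mulrC.
have Vm := unit_inv_moderate Am (At_unit zY).
by rewrite -(gclassV Am (At_unit zY)) -(gclassM Bm Vm).
Qed.

Lemma varjet_value z : nets param_dom z -> gvec (fun e => varjet e (z e)) =
  gpair (T (cS z) (cT z) (u (cT z))) (row_mx (L (cS z) (cT z) (u (cT z)))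
     ((dtT (cS z) (cT z))^-1 *: dtL (cS z) (cT z))).
Proof.
move=> zY; rewrite /varjet !gvec_row_mx T_value // L_value // /gpair pt_class.
congr (row_mx _ (row_mx _ _)); apply/rowP => j.
by rewrite -Vcurve_value // mxE; congr gclass; apply/funext => e; rewrite mxE.
Qed.

Lemma varjet_nets z : nets param_dom z -> nets (lagr_dom a b) (fun e =>
  varjet e (z e)).
Proof.
move=> zY; split.
  apply/vmoderateP => j.
  exact: gsmooth_moderate (varjet_gsmooth dom_reg_gdom (fun e =>
    @subset_refl _ _) j) zY.
by rewrite varjet_value //; split=> //; rewrite gfst_gpair T_value //;
  apply: goo_gcc; exact: T_goo.
Qed.

Definition dom_full e := dom_reg e `&` varjet e @^-1` UF e.

Lemma dom_full_gdom : gdom param_dom dom_full.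
Proof.
apply: gdom_preimage dom_reg_gdom (defined_by_gdom hF) _ varjet_nets.
exact: varjet_gsmooth dom_reg_gdom (fun e => @subset_refl _ _).
Qed.

Lemma dom_full_reg e : dom_full e `<=` dom_reg e. Proof. by move=> z []. Qed.
Lemma dom_full_graph e : dom_full e `<=` dom_graph e. Proof. by move=> z [] []. Qed.
Lemma dom_full_curve e : dom_full e `<=` dom_curve e. Proof. by move=> z [] []
  []. Qed.

Lemma gsmooth_varjet f : gsmooth (lagr_dom a b) UF f ->
  gsmooth param_dom dom_full (fun e z => f e (varjet e z)).
Proof.
move=> fs; apply: (gsmooth_comp dom_full_gdom _ varjet_nets fs) => [e z _ []//|].
exact: varjet_gsmooth dom_full_gdom dom_full_reg.
Qed.

(** * The invariance identity and its derivatives at s = 0 *)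

Let jphi : R -> 'rV[R]_1 -> R := fun e y => phi e (jet ue e y).

Lemma jphi_gsmooth : gsmooth I Uj jphi.
Proof. exact (gsmooth_jet ab hF hu (phi_gsmooth hF)). Qed.

Lemma prj_gsmooth f : gsmooth I Uj f -> gsmooth param_dom dom_full (fun e z =>
  f e (prj z)).
Proof. exact: gsmooth_prj dom_full_gdom dom_full_curve. Qed.

Lemma invariance_value z : nets param_dom z ->
  ev jphi (fun e => prj (z e)) = ev (fun e z => phi e (varjet e z)) z * ev At z.
Proof.
move=> zY; have [_ _ zJ zt] := param_domP zY; have pI := prj_nets zY.
have h1 := lagr_value hF (jet_nets ab hu pI) (jet_value ab hu pI).
have h2 := lagr_value hF (varjet_nets zY) (varjet_value zY).
by move: h1; rewrite prj_class -/du (invariance zt zJ) h2 dtT_value.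
Qed.

(** The invariance hypothesis as a net with vanishing values on all of [param_dom]. The subtraction
    is spelled with a factor -1 so that closure under sums and products applies. *)
Definition defect e (z : 'rV[R]_2) : R :=
  phi e (varjet e z) * At e z + (-1) * jphi e (prj z).

Lemma const_gsmooth U (c : R) : gdom param_dom U ->
  gsmooth param_dom U (fun _ _ => c).
Proof. by move=> YU; apply: gsmooth_cst => //; exact: moderate_cst. Qed.

Lemma defect_gsmooth : gsmooth param_dom dom_full defect.
Proof.
apply: (gsmoothD dom_full_gdom).
  by apply: (gsmoothM dom_full_gdom); [exact: gsmooth_varjet (phi_gsmooth
    hF)|exact: At_gsmooth dom_full_reg].
apply: (gsmoothM dom_full_gdom); first exact: const_gsmooth dom_full_gdom.
exact: prj_gsmooth jphi_gsmooth.
Qed.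

Lemma ev_defect z : nets param_dom z -> ev defect z = 0.
Proof.
move=> zY.
have ps := gsmooth_varjet (phi_gsmooth hF); have As' := At_gsmooth dom_full_reg.
have js := prj_gsmooth jphi_gsmooth; have cs := const_gsmooth (-1) dom_full_gdom.
rewrite /defect.
rewrite (evD zY (gsmoothM dom_full_gdom ps As') (gsmoothM dom_full_gdom cs js)).
rewrite (evM zY ps As') (evM zY cs js) -(invariance_value zY).
rewrite (_ : ev (fun=> fun=> -1) z = -1); last by rewrite -gclass1 -gclassN //;
  exact: moderate_cst.
by rewrite mulN1r subrr.
Qed.

(* The net of the points (0, t) for t = [tau_e]. *)
Definition slice0 (tau : R -> R) (e : R) : 'rV[R]_2 :=
  \row_k if k == i_t then tau e else 0.

Lemma slice0_t tau e : slice0 tau e 0 i_t = tau e. Proof. by rewrite mxE eqxx. Qed.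
Lemma slice0_s tau e : slice0 tau e 0 i_s = 0. Proof. by rewrite mxE. Qed.

Lemma slice0_cT tau : cT (slice0 tau) = cl tau.
Proof. by congr gclass; apply/funext => e; rewrite slice0_t. Qed.

Lemma slice0_cS tau : cS (slice0 tau) = 0.
Proof. by rewrite -gclass0; congr gclass; apply/funext => e; rewrite slice0_s. Qed.

Lemma slice0_prj tau e : prj (slice0 tau e) = const_mx (tau e).
Proof. by rewrite /prj slice0_t. Qed.

Lemma slice0_moderate tau : moderate tau -> vmoderate (slice0 tau).
Proof.
move=> tm; apply/vmoderateP => k.
have [->|k1] := eqVneq k i_t; first by under eq_fun do rewrite slice0_t.
by under eq_fun do rewrite mxE (negbTE k1); exact: moderate_cst.
Qed.

Lemma J_near0 : exists m : nat, forall c, (\forall e \near 0^'+,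
  `|c e| <= rho e ^+ m) ->
  moderate c /\ J (cl c).
Proof.
have zm : vmoderate (fun=> const_mx 0 : 'rV[R]_1) by apply: const_moderate;
  exact: moderate_cst.
have := J0; rewrite -gclass0 pt_class => /(sharp_interiorP _ zm) [m hm].
exists m => c cm.
have cc : vclose (fun=> const_mx 0) (fun e => const_mx (c e) : 'rV[R]_1) m.
  by move=> i; apply: filterS cm => e; rewrite !mxE subr0.
have ccm := vclose_moderate zm cc.
split; first by have := vmoderate_coord 0 ccm; under eq_fun do rewrite mxE.
by have := hm _ ccm cc; rewrite -pt_class /line /= mxE.
Qed.

Lemma J_0 : J 0.
Proof.
have [m hm] := J_near0; rewrite -gclass0; apply: (hm _ _).2.
by move: (gauge_near01 rho); apply: filterS => e [_ r0 _]; rewrite normr0 exprn_ge0.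
Qed.

Lemma slice0_nets tau : moderate tau -> goo a b (cl tau) ->
  nets param_dom (slice0 tau).
Proof.
move=> tm tg; split; first exact: slice0_moderate.
by rewrite /param_dom /= !mxE -/(cS _) -/(cT _) slice0_cS slice0_cT; split => //;
  exact: J_0.
Qed.

Lemma slice0_add_t tau (c : R -> R) e :
  slice0 tau e + c e *: delta_mx 0 i_t = slice0 (fun e => tau e + c e) e.
Proof.
apply/rowP => k; rewrite !mxE eqxx /=; case: (k == i_t); first by rewrite mulr1.
by rewrite mulr0 addr0.
Qed.

Lemma goo_near tau : moderate tau -> goo a b (cl tau) -> exists m : nat, forall c,
  (\forall e \near 0^'+, `|c e| <= rho e ^+ m) ->
  moderate (fun e => tau e + c e) /\ goo a b (cl (fun e => tau e + c e)).
Proof.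
move=> tm tg; have := goo_interior tg; rewrite pt_class.
have ctm := const_moderate tm.
move=> /(sharp_interiorP _ ctm) [m hm]; exists m => c cm.
have cc : vclose (fun e => const_mx (tau e)) (fun e =>
  const_mx (tau e + c e) : 'rV[R]_1) m.
  by move=> i; apply: filterS cm => e; rewrite !mxE addrAC subrr add0r.
have ccm := vclose_moderate ctm cc.
split; first by have := vmoderate_coord 0 ccm; under eq_fun do rewrite mxE.
by have := hm _ ccm cc; rewrite -pt_class /line /= mxE.
Qed.

(** [negligible_pd] asks for negligible values along the direction of differentiation only, so
    vanishing on the line s = 0 is enough for the derivative in t. *)
Lemma ev_pd_t_zero f tau : gsmooth param_dom dom_full f -> moderate tau ->
  goo a b (cl tau) ->
  (forall tau', moderate tau' -> goo a b (cl tau') -> ev f (slice0 tau') = 0) ->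
  ev (pd i_t f) (slice0 tau) = 0.
Proof.
move=> fs tm tg f0; have bY := slice0_nets tm tg.
apply/gclass_eq0; first exact: gsmooth_moderate (gsmooth_pd i_t fs) bY.
have [m hm] := goo_near tm tg.
apply: (negligible_pd (m := m) dom_full_gdom (fs 2%N)); first exact: bY.1.
move=> c /hm [tcm tcg].
have bE : (fun e => slice0 tau e + c e *: delta_mx 0 i_t) = slice0 (fun e =>
  tau e + c e).
  by apply/funext => e; exact: slice0_add_t.
rewrite bE; have tY := slice0_nets tcm tcg; split; first exact: tY.2.
have : ev f (slice0 (fun e => tau e + c e)) = 0 by exact: f0.
move/(gclass_eq0 (gsmooth_moderate fs tY)) => h; apply: negligible_near_eq h _.
by apply: filterE => e; rewrite slice0_add_t.
Qed.

(** Here 0 has to be sharply interior to J: increments of s of size rho^m stay in J, where the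
    defect vanishes. *)
Lemma ev_pd_s_defect tau : moderate tau -> goo a b (cl tau) ->
  ev (pd i_s defect) (slice0 tau) = 0.
Proof.
move=> tm tg; have bY := slice0_nets tm tg; have fs := defect_gsmooth.
apply/gclass_eq0; first exact: gsmooth_moderate (gsmooth_pd i_s fs) bY.
have [m hm] := J_near0.
apply: (negligible_pd (m := m) dom_full_gdom (fs 2%N)); first exact: bY.1.
move=> c /hm [cm cJ].
have tY : nets param_dom (fun e => slice0 tau e + c e *: delta_mx 0 i_s).
  split.
    apply/vmoderateP => k; under eq_fun do rewrite !mxE eqxx /=.
    case: (k == i_t).
      apply: moderateD tm _; apply: moderateM cm _; exact: moderate_cst.
    apply: moderateD (moderate_cst _ _) _; apply: moderateM cm _; exact: moderate_cst.
  rewrite /param_dom /= !mxE; split.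
    by under eq_fun do rewrite !mxE /= mulr1 add0r.
  by under eq_fun do rewrite !mxE /= mulr0 addr0.
by split; [exact: tY.2|exact: (proj1 (gclass_eq0 (gsmooth_moderate fs tY))
  (ev_defect tY))].
Qed.

Lemma ev_pd_coord n (i j : 'I_n) (x : R -> 'rV[R]_n) :
  ev (pd i (fun=> (fun y : 'rV[R]_n => y 0 j))) x = (i == j)%:R.
Proof.
have E e : pd i (fun=> (fun y : 'rV[R]_n => y 0 j)) e (x e) = (i == j)%:R.
  by rewrite /pd -(derive_row_coord (g := id)) // derive_id mxE eqxx eq_sym.
rewrite (_ : ev _ x = cl (cst (i == j)%:R)); last first.
  by congr gclass; apply/funext => e; exact: E.
by case: (i == j); rewrite ?gclass1 ?gclass0.
Qed.

Lemma prj_affine (z : 'rV[R]_2) i h :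
  prj (h *: delta_mx 0 i + z) = h *: (if i == i_t then delta_mx 0 ord0 else 0) +
    prj z.
Proof.
apply/rowP => k; rewrite ord1; have [->|ni] := eqVneq i i_t.
  by rewrite !mxE !eqxx.
by rewrite !mxE [i_t == i]eq_sym (negbTE ni).
Qed.

Lemma ev_pd_t_prj f z : ev (pd i_t (fun e z => f e (prj z))) z =
  ev (pd ord0 f) (fun e => prj (z e)).
Proof.
congr gclass; apply/funext => e.
by rewrite /pd (derive_affine _ (fun h => prj_affine (z e) i_t h)).
Qed.

Lemma ev_pd_s_prj f z : ev (pd i_s (fun e z => f e (prj z))) z = 0.
Proof.
rewrite -gclass0; congr gclass; apply/funext => e.
by rewrite /pd (derive_affine _ (fun h => prj_affine (z e) i_s h)) derive0.
Qed.

Lemma gclassN1 : cl (cst (-1)) = -1.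
Proof. by rewrite -gclass1 -gclassN //; exact: moderate_cst. Qed.

Lemma ev_N1 n (x : R -> 'rV[R]_n) : ev (fun _ _ => -1) x = -1.
Proof. exact: gclassN1. Qed.

Lemma Tcurve_gsmooth_full : gsmooth param_dom dom_full Tcurve.
Proof. exact: gsmooth_sub dom_full_graph Tcurve_gsmooth. Qed.

Lemma Lcurve_gsmooth_full j : gsmooth param_dom dom_full (Lcurve j).
Proof. exact: gsmooth_sub dom_full_graph (Lcurve_gsmooth j). Qed.

Lemma ev_pd_opp i f z : nets param_dom z -> gsmooth param_dom dom_full f ->
  ev (pd i (fun e y => (-1) * f e y)) z = - ev (pd i f) z.
Proof. by move=> zY fs; rewrite (ev_pdZ dom_full_gdom zY) // gclassN1 mulN1r. Qed.

Lemma ev_opp f z : nets param_dom z -> gsmooth param_dom dom_full f ->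
  ev (fun e y => (-1) * f e y) z = - ev f z.
Proof.
move=> zY fs; rewrite (evM zY (const_gsmooth (-1) dom_full_gdom) fs).
by rewrite ev_N1 mulN1r.
Qed.

Lemma opp_gsmooth f : gsmooth param_dom dom_full f ->
  gsmooth param_dom dom_full (fun e y => (-1) * f e y).
Proof. by move=> fs; apply: (gsmoothM dom_full_gdom) => //;
  exact: const_gsmooth dom_full_gdom. Qed.

(** * The conserved quantity as a net *)

Let mom j : R -> 'rV[R]_1 -> R := momentum Fe ue j.

Lemma mom_gsmooth j : gsmooth I Uj (mom j).
Proof. exact: (momentum_gsmooth ab hF hu j). Qed.

Lemma cv_gsmooth j : gsmooth I Uj (cv j).
Proof. exact: gsmooth_pd (cu_gsmooth_jet j). Qed.

(** Along the curve, the negative of the Hamiltonian F_udot u' - F. *)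
Definition energy e (y : 'rV[R]_1) : R :=
  jphi e y + (-1) * \sum_j mom j e y * cv j e y.

(** Kept as a function of both s and t, although it is evaluated at s = 0, so that its derivative in
    t contains genuine mixed derivatives of T and L that can be exchanged. *)
Definition noether e (z : 'rV[R]_2) : R :=
  \sum_j mom j e (prj z) * pd i_s (Lcurve j) e z + energy e (prj z) * pd i_s
    Tcurve e z.

Lemma mom_cv_gsmooth j : gsmooth I Uj (fun e y => mom j e y * cv j e y).
Proof. by apply: (gsmoothM (jet_gdom ab hF hu));
  [exact: mom_gsmooth|exact: cv_gsmooth]. Qed.

Lemma energy_gsmooth : gsmooth I Uj energy.
Proof.
have Jd := jet_gdom ab hF hu; apply: (gsmoothD Jd jphi_gsmooth).
apply: (gsmoothM Jd); first by apply: gsmooth_cst => //; exact: moderate_cst.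
by apply: (gsmooth_sum Jd) => j; exact: mom_cv_gsmooth.
Qed.

Lemma mom_Lcurve_gsmooth j : gsmooth param_dom dom_full (fun e z =>
  mom j e (prj z) * pd i_s (Lcurve j) e z).
Proof.
apply: (gsmoothM dom_full_gdom); first exact: prj_gsmooth (mom_gsmooth j).
exact: gsmooth_pd (Lcurve_gsmooth_full j).
Qed.

Lemma energy_Tcurve_gsmooth : gsmooth param_dom dom_full (fun e z =>
  energy e (prj z) * pd i_s Tcurve e z).
Proof.
apply: (gsmoothM dom_full_gdom); first exact: prj_gsmooth energy_gsmooth.
exact: gsmooth_pd Tcurve_gsmooth_full.
Qed.

Lemma sum_mom_Lcurve_gsmooth :
  gsmooth param_dom dom_full (fun e z => \sum_j mom j e (prj z) * pd i_s (Lcurve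
    j) e z).
Proof. by apply: (gsmooth_sum dom_full_gdom) => j; exact: mom_Lcurve_gsmooth. Qed.

Lemma noether_gsmooth : gsmooth param_dom dom_full noether.
Proof. exact: (gsmoothD dom_full_gdom sum_mom_Lcurve_gsmooth
  energy_Tcurve_gsmooth). Qed.

Lemma sum_jet (V : nmodType) (G : 'I_(1 + (d + d)) -> V) :
  \sum_k G k = G (lshift (d + d) 0) + (\sum_j G (idx_u j) + \sum_j G (idx_v j)).
Proof. by rewrite big_split_ord big_ord1 big_split_ord. Qed.

Lemma sum_mulDr (G1 G2 G3 : 'I_d -> GR) (c : GR) :
  \sum_j (G1 j * c + (G2 j + G3 j)) = (\sum_j G1 j) * c + (\sum_j G2 j + \sum_j G3 j).
Proof. by rewrite !big_split /= -big_distrl. Qed.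

Lemma energy_rate_algebra (f p q : GR) : f + (p + q) + (-1) * (q + p) = f.
Proof. by rewrite mulN1r [q + p]addrC addrK. Qed.

Lemma momentum_rate_algebra (p v x c q f : GR) :
  p * (v * x + c) + q * f = p * v * x + (f * q + p * c).
Proof. by rewrite mulrDr mulrA -addrA [q * f]mulrC [f * q + _]addrC. Qed.

(** The cancelling p x is the sum over j of F_udot^j u'^j times the s-derivative of T'; it enters
    positively through the momenta and negatively through the energy. *)
Lemma noether_rate_algebra (p x s h f q : GR) :
  p * x + s + ((h - p) * x + q * f) = h * x + (f * q + s).
Proof. by rewrite addrACA -mulrDl [p + _]addrC subrK [s + _]addrC [q * f]mulrC. Qed.

Lemma eq_ev_pd n i (f : R -> 'rV[R]_n -> R) g x : (forall e y, f e y = g e y) ->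
  ev (pd i f) x = ev (pd i g) x.
Proof.
move=> fg; congr gclass; apply/funext => e; rewrite /pd.
by rewrite (_ : f e = g e) //; apply/funext => y; exact: fg.
Qed.

(** * Evaluation at a point of the line s = 0 *)

Section AtBase.
Variable tau : R -> R.
Hypothesis tm : moderate tau.
Hypothesis tg : goo a b (cl tau).
Let z := slice0 tau.
Let y e : 'rV[R]_1 := const_mx (tau e).
Let zY : nets param_dom z := slice0_nets tm tg.

Lemma slice0_prj_net : (fun e => prj (z e)) = y.
Proof. by apply/funext => e; rewrite /z slice0_prj. Qed.

Lemma y_nets : nets I y.
Proof. by rewrite -slice0_prj_net; exact: prj_nets. Qed.

Lemma ev_At : ev At z = 1.
Proof.
have cs := gsmooth_coord dom_full_gdom i_t.
have os := opp_gsmooth cs.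
have h := ev_pd_t_zero (gsmoothD dom_full_gdom Tcurve_gsmooth_full os) tm tg.
rewrite (ev_pdD dom_full_gdom zY _ Tcurve_gsmooth_full os) in h.
rewrite (ev_pd_opp _ zY cs) ev_pd_coord eqxx in h.
apply/subr0_eq; rewrite h // => tau' tm' tg'; have zY' := slice0_nets tm' tg'.
rewrite (evD zY' Tcurve_gsmooth_full os).
rewrite (ev_opp zY' cs) -(T_value zY') slice0_cS slice0_cT T0 //.
by rewrite [ev (fun=> _) _]slice0_cT subrr.
Qed.

Lemma ev_Bt j : ev (Bt j) z = ev (cv j) y.
Proof.
have cs := prj_gsmooth (cu_gsmooth_jet j).
have os := opp_gsmooth cs.
have h := ev_pd_t_zero (gsmoothD dom_full_gdom (Lcurve_gsmooth_full j) os) tm tg.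
rewrite (ev_pdD dom_full_gdom zY _ (Lcurve_gsmooth_full j) os) in h.
rewrite (ev_pd_opp _ zY cs) ev_pd_t_prj slice0_prj_net in h.
apply/subr0_eq; rewrite h // => tau' tm' tg'; have zY' := slice0_nets tm' tg'.
rewrite (evD zY' (Lcurve_gsmooth_full j) os).
rewrite (ev_opp zY' cs).
have := L_value zY'; rewrite slice0_cS slice0_cT L0 // => /rowP /(_ j).
have pI := prj_nets zY'.
have := curve_value hu pI; rewrite prj_class slice0_cT => ->.
rewrite !mxE => E; rewrite /ev -/(cu j) E; apply/eqP; rewrite subr_eq0; apply/eqP.
by congr gclass; apply/funext => e; rewrite mxE.
Qed.


(** At s = 0 the varied jet and the jet of u agree as classes, though not as nets. That suffices for
    F and its derivatives to take the same values at both. *)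
Lemma slice0_jet : gvec (fun e => varjet e (z e)) = gvec (fun e => jet ue e (y e)).
Proof.
have yE : cl (fun e => y e 0 0) = cl tau.
  by congr gclass; apply/funext => e; rewrite mxE.
rewrite (jet_value ab hu y_nets) yE (varjet_value zY).
rewrite (dtT_value zY) (dtL_value zY) ev_At invr1 scale1r slice0_cS slice0_cT.
rewrite T0 // L0 //; congr (gpair _ (row_mx _ _)).
have := velocity_value ab hu y_nets; rewrite yE => ->.
apply/rowP => j; rewrite !mxE; apply: etrans (ev_Bt j) _.
by congr gclass; apply/funext => e; rewrite mxE.
Qed.

Lemma ev_varjet f : gsmooth (lagr_dom a b) UF f ->
  ev f (fun e => varjet e (z e)) = ev f (fun e => jet ue e (y e)).
Proof.
move=> fs; apply: gsmooth_class (defined_by_gdom hF) fs (varjet_nets zY) _ slice0_jet.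
exact: (jet_moderate hu y_nets).
Qed.

Lemma ev_prj f : ev (fun e z => f e (prj z)) z = ev f y.
Proof. by congr gclass; apply/funext => e; rewrite -slice0_prj_net. Qed.

Let Ft := ev (pd (lshift (d + d) 0) phi) (fun e => jet ue e (y e)).
Let Fu j := ev (pd (idx_u j) phi) (fun e => jet ue e (y e)).
Let Fv j := ev (mom j) y.
Let V j := ev (cv j) y.

Lemma ev_Vcurve j : ev (Vcurve j) z = V j.
Proof.
have cs := Vcurve_gsmooth j dom_full_gdom dom_full_reg;
  have ats := At_gsmooth dom_full_reg.
have -> : V j = ev (fun e z => Vcurve j e z * At e z) z.
  rewrite -[V j]ev_Bt; apply: (ev_near_eq dom_full_gdom zY) => [e e1 [[_ At0] _]|].
    by rewrite /Vcurve divfK.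
  exact: gsmooth_moderate (Bt_gsmooth j dom_full_reg) zY.
by rewrite (evM zY cs ats) ev_At mulr1.
Qed.

(** The product rule for L' = V T', valid where T' has no zero. At s = 0 it involves only T' = 1 and
    V = u', and no derivative of 1/T' has to be computed. *)
Lemma ev_Bts j : ev (pd i_s (Bt j)) z =
  V j * ev (pd i_s At) z + ev (pd i_s (Vcurve j)) z.
Proof.
have cs := Vcurve_gsmooth j dom_full_gdom dom_full_reg;
  have ats := At_gsmooth dom_full_reg.
have E e x : 0 < e <= 1 -> dom_full e x -> Bt j e x = Vcurve j e x * At e x.
  by move=> _ [[_ At0] _]; rewrite /Vcurve divfK.
apply: etrans (ev_pd_eq dom_full_gdom zY i_s E (Bt_gsmooth j dom_full_reg)) _.
by rewrite (ev_pdM dom_full_gdom zY _ cs ats) ev_Vcurve ev_At mul1r.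
Qed.

Lemma ev_pd_phi_varjet : ev (pd i_s (fun e z => phi e (varjet e z))) z =
  Ft * ev (pd i_s Tcurve) z + (\sum_j Fu j * ev (pd i_s (Lcurve j)) z +
    \sum_j Fv j * ev (pd i_s (Vcurve j)) z).
Proof.
have ps := phi_gsmooth hF.
have UV e x : 0 < e <= 1 -> dom_full e x -> UF e (varjet e x) by move=> _ [].
have pjs := varjet_gsmooth dom_full_gdom dom_full_reg.
apply: etrans (ev_pd_comp dom_full_gdom zY i_s UV varjet_nets ps pjs) _.
apply: etrans (sum_jet _) _.
apply: (f_equal2 +%R); last apply: (f_equal2 +%R).
- apply: (f_equal2 *%R); first exact: ev_varjet (gsmooth_pd _ ps).
  by apply: eq_ev_pd => e x; rewrite /varjet row_mxEl mxE.
- apply: eq_bigr => j _.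
  apply: (f_equal2 *%R); first exact: ev_varjet (gsmooth_pd _ ps).
  by apply: eq_ev_pd => e x; rewrite /varjet row_mxEr row_mxEl mxE.
- apply: eq_bigr => j _.
  apply: (f_equal2 *%R); first exact: ev_varjet (gsmooth_pd _ ps).
  by apply: eq_ev_pd => e x; rewrite /varjet row_mxEr row_mxEr mxE.
Qed.

(* The invariance hypothesis, differentiated in s at s = 0. *)
Lemma infinitesimal_invariance :
  ev jphi y * ev (pd i_s At) z + (Ft * ev (pd i_s Tcurve) z +
    (\sum_j Fu j * ev (pd i_s (Lcurve j)) z + \sum_j Fv j * ev (pd i_s (Vcurve
      j)) z)) = 0.
Proof.
have ps := gsmooth_varjet (phi_gsmooth hF); have As' := At_gsmooth dom_full_reg.
have js := prj_gsmooth jphi_gsmooth; have os := opp_gsmooth js.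
have h1 := ev_pdD dom_full_gdom zY i_s (gsmoothM dom_full_gdom ps As') os.
have h2 := etrans (ev_pd_opp i_s zY js)
  (etrans (congr1 -%R (ev_pd_s_prj jphi z)) (oppr0 _)).
have h3 := ev_pdM dom_full_gdom zY i_s ps As'.
have h := etrans h1 (etrans (f_equal2 +%R h3 h2) (addr0 _)).
apply: etrans _ (etrans (esym h) (ev_pd_s_defect tm tg)).
apply: (f_equal2 +%R).
  by apply: (f_equal2 *%R); [exact: esym (ev_varjet (phi_gsmooth hF))|exact: erefl].
exact: esym (etrans (f_equal2 *%R ev_At ev_pd_phi_varjet) (mul1r _)).
Qed.

Lemma ev_pd_jphi : ev (pd ord0 jphi) y =
  Ft + (\sum_j Fu j * V j + \sum_j Fv j * ev (pd ord0 (cv j)) y).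
Proof.
have ps := phi_gsmooth hF.
have UV e x : 0 < e <= 1 -> Uj e x -> UF e (jet ue e x) by move=> _ [].
have Jd := jet_gdom ab hF hu.
apply: etrans (ev_pd_comp Jd y_nets ord0 UV (jet_nets ab hu) ps (jet_gsmooth UF
  hu)) _.
apply: etrans (sum_jet _) _.
apply: (f_equal2 +%R); last apply: (f_equal2 +%R).
- apply: etrans (f_equal2 *%R (erefl Ft) (_ : _ = 1)) (mulr1 _).
  apply: etrans _ (ev_pd_coord ord0 ord0 y).
  by apply: eq_ev_pd => e x; rewrite /jet row_mxEl.
- apply: eq_bigr => j _; apply: (f_equal2 *%R); first exact: erefl.
  by apply: eq_ev_pd => e x; rewrite /jet row_mxEr row_mxEl.
- apply: eq_bigr => j _; apply: (f_equal2 *%R); first exact: erefl.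
  by apply: eq_ev_pd => e x; rewrite /jet row_mxEr row_mxEr mxE.
Qed.

Lemma ev_pd_mom j : ev (pd ord0 (mom j)) y = Fu j.
Proof. exact: (euler_lagrange_value ab hF hu EL j y_nets). Qed.

(** The DuBois-Reymond equation. The total derivative of F is F_t + F_u u' + F_udot u''; by the
    Euler-Lagrange equation the last two terms are the derivative of F_udot u'. *)
Lemma ev_pd_energy : ev (pd ord0 energy) y = Ft.
Proof.
have Jd := jet_gdom ab hF hu.
have ss : gsmooth I Uj (fun e y => \sum_j mom j e y * cv j e y).
  by apply: (gsmooth_sum Jd) => j; exact: mom_cv_gsmooth.
have os : gsmooth I Uj (fun e y => (-1) * \sum_j mom j e y * cv j e y).
  by apply: (gsmoothM Jd) => //; apply: gsmooth_cst => //; exact: moderate_cst.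
have E : \sum_j ev (pd ord0 (fun e y => mom j e y * cv j e y)) y =
    \sum_j (Fv j * ev (pd ord0 (cv j)) y + Fu j * V j).
  apply: eq_bigr => j _.
  apply: etrans (ev_pdM Jd y_nets ord0 (mom_gsmooth j) (cv_gsmooth j)) _.
  apply: (f_equal2 +%R); first exact: erefl.
  apply: etrans _ (mulrC (V j) (Fu j)).
  apply: (f_equal2 *%R); first exact: erefl.
  exact: ev_pd_mom.
have h := etrans (ev_pd_sum Jd y_nets ord0 mom_cv_gsmooth) (etrans E (big_split _
  _ _ _ _)).
apply: etrans (ev_pdD Jd y_nets ord0 jphi_gsmooth os) _.
apply: etrans (f_equal2 +%R ev_pd_jphi
  (etrans (ev_pdZ Jd y_nets ord0 _ ss) (f_equal2 *%R gclassN1 h))) _.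
exact: energy_rate_algebra.
Qed.

Lemma ev_energy : ev energy y = ev jphi y - \sum_j Fv j * V j.
Proof.
have Jd := jet_gdom ab hF hu.
have ss : gsmooth I Uj (fun e y => \sum_j mom j e y * cv j e y).
  by apply: (gsmooth_sum Jd) => j; exact: mom_cv_gsmooth.
have ns : gsmooth I Uj (fun=> fun=> (-1)).
  by apply: gsmooth_cst => //; exact: moderate_cst.
apply: etrans (evD y_nets jphi_gsmooth (gsmoothM Jd ns ss)) _.
apply: (f_equal2 +%R); first exact: erefl.
apply: etrans (evM y_nets ns ss) _.
apply: etrans (f_equal2 *%R (ev_N1 y) (ev_sum y_nets mom_cv_gsmooth)) _.
apply: etrans (mulN1r _) (congr1 -%R _); apply: eq_bigr => j _.
exact: (evM y_nets (mom_gsmooth j) (cv_gsmooth j)).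
Qed.

(** Exchanging mixed derivatives turns the t-derivative of the s-derivative of L into that of V T'
    in s, and likewise for T. With the rates of momentum and energy the sum is exactly the left-hand
    side of [infinitesimal_invariance]. *)
Lemma ev_pd_noether : ev (pd i_t noether) z = 0.
Proof.
have As' := gsmooth_pd i_s Tcurve_gsmooth_full.
have es := prj_gsmooth energy_gsmooth.
have Es : \sum_j ev (pd i_t (fun e z => mom j e (prj z) * pd i_s (Lcurve j) e z)) z =
    (\sum_j Fv j * V j) * ev (pd i_s At) z +
    (\sum_j Fu j * ev (pd i_s (Lcurve j)) z + \sum_j Fv j * ev (pd i_s (Vcurve j)) z).
  apply: etrans _ (sum_mulDr (fun j => Fv j * V j) _ _ _); apply: eq_bigr => j _.
  have Bs' := gsmooth_pd i_s (Lcurve_gsmooth_full j).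
  apply: etrans (ev_pdM dom_full_gdom zY i_t (prj_gsmooth (mom_gsmooth j)) Bs') _.
  have h1 := f_equal2 *%R (ev_prj (mom j))
    (etrans (ev_pd_comm dom_full_gdom zY i_t i_s (Lcurve_gsmooth_full j)) (ev_Bts j)).
  have h2 := f_equal2 *%R (erefl (ev (pd i_s (Lcurve j)) z)) (etrans (ev_pd_t_prj
    (mom j) z)
    (etrans (congr1 (ev (pd ord0 (mom j))) slice0_prj_net) (ev_pd_mom j))).
  apply: etrans (f_equal2 +%R h1 h2) _.
  exact: momentum_rate_algebra.
have h1 := etrans (ev_pd_sum dom_full_gdom zY i_t mom_Lcurve_gsmooth) Es.
have h2 := f_equal2 *%R (etrans (ev_prj energy) ev_energy)
  (ev_pd_comm dom_full_gdom zY i_t i_s Tcurve_gsmooth_full).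
have h3 := f_equal2 *%R (erefl (ev (pd i_s Tcurve) z)) (etrans (ev_pd_t_prj energy z)
  (etrans (congr1 (ev (pd ord0 energy)) slice0_prj_net) ev_pd_energy)).
have h4 := etrans (ev_pdM dom_full_gdom zY i_t es As') (f_equal2 +%R h2 h3).
apply: etrans (ev_pdD dom_full_gdom zY i_t sum_mom_Lcurve_gsmooth
  energy_Tcurve_gsmooth) _.
apply: etrans (f_equal2 +%R h1 h4) _.
apply: etrans (noether_rate_algebra _ _ _ _ _ _) infinitesimal_invariance.
Qed.

Lemma noether_value : let t := cl tau in
  \sum_(j < d) lagr_udot a b F j t (u t) (du t) *
    gderivv J (fun s => L s t (u t)) 0 0 j +
  (F t (u t) (du t) - \sum_(k < d) lagr_udot a b F k t (u t) (du t) * du t 0 k) *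
    gderiv J (fun s => T s t (u t)) 0 = ev noether z.
Proof.
have As' := gsmooth_pd i_s Tcurve_gsmooth_full.
have es := prj_gsmooth energy_gsmooth.
have yE : cl (fun e => y e 0 0) = cl tau.
  by congr gclass; apply/funext => e; rewrite mxE.
have Fv_value j : lagr_udot a b F j (cl tau) (u (cl tau)) (du (cl tau)) = Fv j.
  by have := lagr_udot_value ab hF hu j y_nets; rewrite yE.
have V_value j : du (cl tau) 0 j = V j.
  have := velocity_value ab hu y_nets; rewrite yE /du => ->; rewrite mxE.
  by congr gclass; apply/funext => e; rewrite mxE.
have F_value : F (cl tau) (u (cl tau)) (du (cl tau)) = ev jphi y.
  by have := lagr_value hF (jet_nets ab hu y_nets) (jet_value ab hu y_nets);
    rewrite yE.
have T_deriv := dsT_value zY (slice0_cS tau); rewrite slice0_cT in T_deriv.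
have L_deriv := dsL_value zY (slice0_cS tau); rewrite slice0_cT in L_deriv.
apply: esym; apply: etrans (evD zY sum_mom_Lcurve_gsmooth energy_Tcurve_gsmooth) _.
apply: (f_equal2 +%R).
  apply: etrans (ev_sum zY mom_Lcurve_gsmooth) _; apply: eq_bigr => j _.
  apply: etrans (evM zY (prj_gsmooth (mom_gsmooth j)) (gsmooth_pd i_s
    (Lcurve_gsmooth_full j))) _.
  apply: (f_equal2 *%R); first exact: etrans (ev_prj (mom j)) (esym (Fv_value j)).
  by rewrite L_deriv mxE.
apply: etrans (evM zY es As') _; apply: (f_equal2 *%R); last exact: esym T_deriv.
apply: etrans (ev_prj energy) _; apply: etrans ev_energy _.
apply: (f_equal2 +%R); first exact: esym F_value.
apply: (congr1 -%R); apply: eq_bigr => j _.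
exact: esym (f_equal2 *%R (Fv_value j) (V_value j)).
Qed.

End AtBase.

Lemma slice0_btw tau tau' t e :
  btw (slice0 tau) (slice0 tau') t e = slice0 (fun e =>
    tau e + t e * (tau' e - tau e)) e.
Proof.
apply/rowP => k; rewrite !mxE; case: (k == i_t) => //.
by rewrite subrr mulr0 addr0.
Qed.

(** The segment joining two points of the line s = 0 stays on it, so only the t-component of the
    gradient contributes. That component is negligible at the intermediate net, which is a point of
    (a, b) by convexity. *)
Lemma noether_const tau tau' : moderate tau -> goo a b (cl tau) ->
  moderate tau' -> goo a b (cl tau') ->
  ev noether (slice0 tau) = ev noether (slice0 tau').
Proof.
move=> tm tg tm' tg'; have xY := slice0_nets tm tg; have yY := slice0_nets tm' tg'.
have bE t : btw (slice0 tau) (slice0 tau') t = slice0 (fun e =>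
  tau e + t e * (tau' e - tau e)).
  by apply/funext => e; exact: slice0_btw.
have bt t : (forall e, 0 <= t e <= 1) ->
    moderate (fun e => tau e + t e * (tau' e - tau e)) /\
    goo a b (cl (fun e => tau e + t e * (tau' e - tau e))).
  move=> t01; have bm := btw_moderate xY.1 yY.1 t01.
  have m : moderate (fun e => tau e + t e * (tau' e - tau e)).
    have := vmoderate_coord i_t bm; rewrite bE.
    by under eq_fun do rewrite slice0_t.
  by split => //; exact: goo_btw.
have [|t [t01 E]] := net_mvt dom_full_gdom (noether_gsmooth 1%N) (x :=
  slice0 tau) (y := slice0 tau').
  by move=> t t01; rewrite bE; have [m g] := bt t t01; exact: slice0_nets.
have [m g] := bt t t01.
apply/esym/gclass_eq; [exact: gsmooth_moderate noether_gsmooth _..|].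
have h := ev_pd_noether m g.
have mY := slice0_nets m g.
move/(gclass_eq0 (gsmooth_moderate (gsmooth_pd i_t noether_gsmooth) mY)): h => h.
have dm : moderate (fun e => tau' e - tau e) by apply: moderateD => //;
  exact: moderateN.
apply: negligible_near_eq (negligibleMr h dm) _.
apply: filterS E => e; rewrite slice0_btw.
rewrite big_ord_recl big_ord1 => E; apply: esym; apply: etrans E _.
rewrite [slice0 tau' e 0 _]slice0_s [slice0 tau e 0 _]slice0_s subrr mul0r add0r.
rewrite (_ : lift ord0 ord0 = i_t); last exact/val_inj.
by rewrite !slice0_t mulrC.
Qed.


End Variation.

Unset Implicit Arguments.

(** As the family X lives over the open interval, the quantity is asserted to equal c on (a, b), and
    to have the sharp limit c from (a, b) at every point of [a, b]. The order of generalized numbers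
    being partial, [a, b] may contain points other than a and b outside (a, b). *)
Theorem theorem61 (R : realType) (rho : gauge R) (d : nat) (a b : GR rho)
    (F : GR rho -> 'rV[GR rho]_d -> 'rV[GR rho]_d -> GR rho)
    (u : GR rho -> 'rV[GR rho]_d) (J : set (GR rho))
    (X : GR rho -> 'rV[GR rho]_(1 + d) -> 'rV[GR rho]_(1 + d)) :
  let du := gderivv (gcc a b) u in
  let T s t l := gfst (X s (gpair t l)) in
  let L s t l := gsnd (X s (gpair t l)) in
  let dtT s t := gderiv (goo a b) (fun t' => T s t' (u t')) t in
  let dtL s t := gderivv (goo a b) (fun t' => L s t' (u t')) t in
  let dsT0 t := gderiv J (fun s => T s t (u t)) 0 in
  let dsL0 t := gderivv J (fun s => L s t (u t)) 0 in
  let Q t :=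
    \sum_(j < d) lagr_udot a b F j t (u t) (du t) * dsL0 t 0 j
    + (F t (u t) (du t)
       - \sum_(k < d) lagr_udot a b F k t (u t) (du t) * du t 0 k) * dsT0 t in
  glt a b ->
  GSF (lagr_dom a b) setT (lagr_map F) ->
  GSF (line (gcc a b)) setT (lift1 u) ->
  euler_lagrange a b F u ->
  sharp_interior (line J) (pt 0) ->
  gs_family J (gprod (goo a b) setT) (gprod (goo a b) setT) X ->
  (forall t, goo a b t ->
     [/\ forall s, J s -> dtT s t \is a GRing.unit,
         T 0 t (u t) = t,
         L 0 t (u t) = u t &
         forall s, J s ->
           F t (u t) (du t)
           = F (T s t (u t)) (L s t (u t)) ((dtT s t)^-1 *: dtL s t)
             * dtT s t]) ->
  exists c : GR rho, forall t, gcc a b t ->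
    (goo a b t -> Q t = c) /\
    sharp_lim (line (goo a b)) (lift1 (fun t' => pt (Q t'))) (pt t) (pt c).
Proof.
move=> du T L dtT dtL dsT0 dsL0 Q ab [_ [UF [Fe hF]]] [_ [Uu [ue hu]]] EL J0
  [XY [UX [Xe hX]]] H.
have dtT_unit t s : goo a b t -> J s -> dtT s t \is a GRing.unit.
  by move=> /H [hu' _ _ _]; exact: hu'.
have T0 t : goo a b t -> T 0 t (u t) = t by move=> /H [].
have L0 t : goo a b t -> L 0 t (u t) = u t by move=> /H [].
have inv t s : goo a b t -> J s ->
    F t (u t) (du t) = F (T s t (u t)) (L s t (u t)) ((dtT s t)^-1 *: dtL s t) *
      dtT s t.
  by move=> /H [_ _ _ hi]; exact: hi.
have [t0 t0g] := goo_nonempty ab.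
have QE t : goo a b t ->
    Q t = ev (noether Fe ue Xe) (slice0 (grepr t)).
  move=> tg; have tg' : goo a b (gclass (grepr t)) by rewrite greprK.
  have := noether_value ab hF hu J0 XY hX dtT_unit (grepr_moderate t) tg'.
  by rewrite greprK => <-.
have Qc t : goo a b t -> Q t = Q t0.
  move=> tg; rewrite (QE t tg) (QE t0 t0g).
  have tg' : goo a b (gclass (grepr t)) by rewrite greprK.
  have t0g' : goo a b (gclass (grepr t0)) by rewrite greprK.
  exact (noether_const ab hF hu EL J0 XY hX dtT_unit T0 L0 inv
    (grepr_moderate t) tg' (grepr_moderate t0) t0g').
exists (Q t0) => t tab; split; first exact: Qc.
(* On (a, b) the function is constant, so any positive radius would do; r is one at hand. *)
move=> r r0; exists r; first exact: r0.
move=> x xg _.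
have -> : lift1 (fun t' => pt (Q t')) x = pt (Q t0) by exact: congr1 (Qc _ xg).
rewrite -(vreprK (pt (Q t0))).
have [m rm] := gt0_gauge_le r0.
have vm := vrepr_moderate (pt (Q t0)).
by apply: (gball_near vm vm rm); exact: vclose_refl.
Qed.
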